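(* Let $\ell\ge2$, $k\in I=\{0,1,\dots,\ell\}$, and let a sign $\pm$ be chosen (the same throughout) with $k\pm2\in I$. Then the algebra $R^{\Lambda_k}(\delta-\xi_{k,\pm2})$ of type $C^{(1)}_\ell$ is of finite representation type.
   Context: Lie theory. Let $\ell\ge2$, $I=\{0,1,\dots,\ell\}$, and let $\mathsf A=(a_{ij})_{i,j\in I}$ be the affine Cartan matrix of type $C^{(1)}_\ell$: $a_{ii}=2$, $a_{01}=-1$, $a_{10}=-2$, $a_{\ell,\ell-1}=-1$, $a_{\ell-1,\ell}=-2$, $a_{j,j+1}=a_{j+1,j}=-1$ for $1\le j\le \ell-2$, all other entries $0$. Simple roots are $\alpha_i$, simple coroots $\alpha_i^\vee=h_i$, fundamental weights $\Lambda_i$ $(i\in I)$, with $\langle \alpha_i^\vee,\alpha_j\rangle=a_{ij}$ and $\langle\alpha_i^\vee,\Lambda_j\rangle=\delta_{ij}$. The null root is $\delta=\alpha_0+2\alpha_1+\dots+2\alpha_{\ell-1}+\alpha_\ell$. Put $\mathsf Q^+=\bigoplus_{i\in I}\mathbb Z_{\ge0}\alpha_i$. With $(d_0,\dots,d_\ell)=(2,1,\dots,1,2)$, let $(\alpha_i,\alpha_j)=d_ia_{ij}$. The elements $\xi$. For $k\in I$ put $\xi_{k,0}=0$, and for integers $i\ge1$: if $k+i\in I$, $\xi_{k,i}=\sum_{t=1}^{i-1}t\,\alpha_{k+t}+i\sum_{j=k+i}^{\ell-1}\alpha_j+\frac i2\alpha_\ell$; if $k-i\in I$, $\xi_{k,-i}=\sum_{t=1}^{i-1}t\,\alpha_{k-t}+i\sum_{j=1}^{k-i}\alpha_j+\frac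 i2\alpha_0$ (empty sums are $0$). Algebras. Let $\mathbb F$ be an algebraically closed field. Fix polynomials $\mathcal Q_{i,j}(u,v)\in\mathbb F[u,v]$ $(i,j\in I)$ with $\mathcal Q_{i,i}=0$ and, for $i\ne j$, $\mathcal Q_{i,j}(u,v)=\sum t_{i,j;p,q}u^pv^q$, the sum over $p,q\ge0$ with $p(\alpha_i,\alpha_i)+q(\alpha_j,\alpha_j)+2(\alpha_i,\alpha_j)=0$, where $t_{i,j;p,q}\in\mathbb F$, $t_{i,j;-a_{ij},0}\ne0$ and $\mathcal Q_{i,j}(u,v)=\mathcal Q_{j,i}(v,u)$. For a dominant integral weight $\Lambda$ and $n\ge0$, the cyclotomic quiver Hecke (KLR) algebra $R^\Lambda_n$ is the $\mathbb F$-algebra generated by $e(\nu)$ $(\nu\in I^n)$, $x_1,\dots,x_n$, $\psi_1,\dots,\psi_{n-1}$ subject to: $e(\nu)e(\nu')=\delta_{\nu,\nu'}e(\nu)$; $\sum_\nu e(\nu)=1$; $x_re(\nu)=e(\nu)x_r$; $\psi_re(\nu)=e(s_r\nu)\psi_r$; $x_rx_s=x_sx_r$; $\psi_rx_s=x_s\psi_r$ if $s\ne r,r+1$; $\psi_r\psi_s=\psi_s\psi_r$ if $|r-s|>1$; $x_r\psi_re(\nu)=(\psi_rx_{r+1}-\delta_{\nu_r,\nu_{r+1}})e(\nu)$; $x_{r+1}\psi_re(\nu)=(\psi_rx_r+\delta_{\nu_r,\nu_{r+1}})e(\nu)$; $\psi_r^2e(\nu)=\mathcal Q_{\nu_r,\nu_{r+1}}(x_r,x_{r+1})e(\nu)$;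 $(\psi_{r+1}\psi_r\psi_{r+1}-\psi_r\psi_{r+1}\psi_r)e(\nu)$ equals $\frac{\mathcal Q_{\nu_r,\nu_{r+1}}(x_r,x_{r+1})-\mathcal Q_{\nu_r,\nu_{r+1}}(x_{r+2},x_{r+1})}{x_r-x_{r+2}}e(\nu)$ if $\nu_r=\nu_{r+2}$ and $0$ otherwise; and $x_1^{\langle\alpha^\vee_{\nu_1},\Lambda\rangle}e(\nu)=0$. Here $s_r$ swaps the entries in places $r$ and $r+1$. For $\beta\in\mathsf Q^+$ of height $n$ (sum of coefficients), let $I^\beta=\{\nu\in I^n:\alpha_{\nu_1}+\dots+\alpha_{\nu_n}=\beta\}$ and $e(\beta)=\sum_{\nu\in I^\beta}e(\nu)$, a central idempotent; the block algebra is $R^\Lambda(\beta)=R^\Lambda_ne(\beta)$. *)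

(* Defs.v *)
From HB Require Import structures.
From mathcomp Require Import all_boot all_order perm all_algebra.
From mathcomp Require Import boolp zify lra.

Set Implicit Arguments.
Unset Strict Implicit.
Unset Printing Implicit Defensive.

Import Order.TTheory GRing.Theory Num.Theory.
Local Open Scope ring_scope.
Local Open Scope quotient_scope.

(** MathComp's [algType] requires [1 != 0]; a block [R e] of an algebra given by
    generators and relations is an algebra with unit [e], but [e] may be [0].
    An algebra over [F] is here a ring with a central ring morphism from [F],
    the scalar [c] acting as multiplication by [scal c]. *)

HB.mixin Record hasScalars (F : pzRingType) A of GRing.PzRing A := {
  scal : {rmorphism F -> A};
  scalC : forall (c : F) (a : A), scal c * a = a * scal c
}.

#[short(type="pzAlgType")]
HB.structure Definition PzAlgebra (F : pzRingType) :=
  {A of GRing.PzRing A & hasScalars F A}.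

Section RepresentationType.
Variables (F : fieldType) (A : pzAlgType F).

(* Finite dimension over [F]; modules are left modules *)
Definition fin_dim (M : lmodType A) : Prop :=
  exists (m : nat) (b : 'I_m -> M),
    forall v : M, exists c : 'I_m -> F, v = \sum_(i < m) (scal (c i) : A) *: b i.

Definition mod_iso (M N : lmodType A) : Prop :=
  exists f : {linear M -> N}, bijective f.

Definition zero_mod (M : lmodType A) : Prop := forall v : M, v = 0.

Definition indecomposable (M : lmodType A) : Prop :=
  ~ zero_mod M /\
  forall N1 N2 : lmodType A, mod_iso M (N1 * N2)%type ->
    zero_mod N1 \/ zero_mod N2.

Definition finite_representation_type : Prop :=
  exists (m : nat) (N : 'I_m -> lmodType A),
    forall M : lmodType A, fin_dim M -> indecomposable M ->
      exists i : 'I_m, mod_iso M (N i).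

End RepresentationType.

(** [P g] says that the family [g] of elements of an algebra satisfies the
    relations.  The elements of [presented P] are the noncommutative polynomial
    expressions in the generators, two of them being identified when they
    take the same value at every such family in every algebra.  When [P] is a
    conjunction of equations, the generators of [presented P] satisfy [P] (see
    [klr_presentation] below), so that, with [lift] and [lift_unique],
    [presented P] is the quotient of the free algebra by the two-sided ideal
    generated by the relations. *)

Section Presented.
Variables (F : fieldType) (G : Type).

Inductive term : Type :=
| TGen of G
| TConst of F
| TAdd of term & term
| TMul of term & term.

HB.instance Definition _ := gen_eqMixin term.
HB.instance Definition _ := gen_choiceMixin term.

Fixpoint teval (A : pzAlgType F) (g : G -> A) (t : term) : A :=
  match t with
  | TGen x => g x
  | TConst c => scal c
  | TAdd t u => teval g t + teval g u
  | TMul t u => teval g t * teval g u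
  end.

Variable P : forall A : pzAlgType F, (G -> A) -> Prop.

Definition term_equiv (t u : term) : bool :=
  `[< forall (A : pzAlgType F) (g : G -> A), P g -> teval g t = teval g u >].

Lemma term_equivP t u :
  reflect (forall (A : pzAlgType F) (g : G -> A), P g -> teval g t = teval g u)
    (term_equiv t u).
Proof. exact: asboolP. Qed.

Lemma term_equiv_refl : reflexive term_equiv.
Proof. by move=> t; apply/term_equivP. Qed.

Lemma term_equiv_sym : symmetric term_equiv.
Proof.
by move=> t u; apply/term_equivP/term_equivP => h A g Pg; rewrite h.
Qed.

Lemma term_equiv_trans : transitive term_equiv.
Proof.
move=> u t v /term_equivP h1 /term_equivP h2; apply/term_equivP => A g Pg.
by rewrite h1 // h2.
Qed.

Canonical term_equiv_rel :=
  EquivRel term_equiv term_equiv_refl term_equiv_sym term_equiv_trans.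

Definition presented : Type := {eq_quot term_equiv_rel}.
HB.instance Definition _ := Choice.on presented.

Local Notation cls t := (\pi_{eq_quot term_equiv_rel} t : presented).
Local Notation rep a := (repr (a : {eq_quot term_equiv_rel})).

Lemma clsP t u : term_equiv t u -> cls t = cls u.
Proof. by move=> h; apply/eqmodP. Qed.

Lemma rep_cls t (A : pzAlgType F) (g : G -> A) :
  P g -> teval g (rep (cls t)) = teval g t.
Proof.
move=> Pg; have /eqmodP : rep (cls t) = t %[mod {eq_quot term_equiv_rel}].
  by rewrite reprK.
by move/term_equivP; apply.
Qed.

Lemma presented_ext (a b : presented) :
  (forall (A : pzAlgType F) (g : G -> A), P g ->
    teval g (rep a) = teval g (rep b)) -> a = b.
Proof.
move=> h; rewrite -[a]reprK -[b]reprK; apply: clsP.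
exact/term_equivP.
Qed.

Definition gen (x : G) : presented := cls (TGen x).

Definition presented_zero : presented := cls (TConst 0).
Definition presented_one : presented := cls (TConst 1).
Definition presented_add (a b : presented) : presented :=
  cls (TAdd (rep a) (rep b)).
Definition presented_mul (a b : presented) : presented :=
  cls (TMul (rep a) (rep b)).
Definition presented_opp (a : presented) : presented :=
  cls (TMul (TConst (-1)) (rep a)).
Definition presented_scal (c : F) : presented := cls (TConst c).

Local Ltac by_models :=
  apply: presented_ext => ? ? ?;
  match goal with Pg : P _ |- _ => do 3 ?rewrite !(rep_cls _ Pg) /= end.

Fact presented_addA : associative presented_add.
Proof. by move=> a b c; by_models; rewrite addrA. Qed.
Fact presented_addC : commutative presented_add.
Proof. by move=> a b; by_models; rewrite addrC. Qed.
Fact presented_add0 : left_id presented_zero presented_add.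
Proof. by move=> a; by_models; rewrite rmorph0 add0r. Qed.
Fact presented_addN : left_inverse presented_zero presented_opp presented_add.
Proof. by move=> a; by_models; rewrite rmorphN1 mulN1r addNr rmorph0. Qed.
Fact presented_mulA : associative presented_mul.
Proof. by move=> a b c; by_models; rewrite mulrA. Qed.
Fact presented_mul1 : left_id presented_one presented_mul.
Proof. by move=> a; by_models; rewrite rmorph1 mul1r. Qed.
Fact presented_mulr1 : right_id presented_one presented_mul.
Proof. by move=> a; by_models; rewrite rmorph1 mulr1. Qed.
Fact presented_mulDl : left_distributive presented_mul presented_add.
Proof. by move=> a b c; by_models; rewrite mulrDl. Qed.
Fact presented_mulDr : right_distributive presented_mul presented_add.
Proof. by move=> a b c; by_models; rewrite mulrDr. Qed.

HB.instance Definition _ := GRing.isPzRing.Build presented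
  presented_addA presented_addC presented_add0 presented_addN
  presented_mulA presented_mul1 presented_mulr1
  presented_mulDl presented_mulDr.

Fact presented_scal_zmod : zmod_morphism presented_scal.
Proof.
by move=> c d; by_models; rewrite rmorphB rmorphN1 mulN1r.
Qed.
Fact presented_scal_monoid : monoid_morphism presented_scal.
Proof. by split=> [|c d] //; by_models; rewrite rmorphM. Qed.

HB.instance Definition _ := GRing.isZmodMorphism.Build F presented
  presented_scal presented_scal_zmod.
HB.instance Definition _ := GRing.isMonoidMorphism.Build F presented
  presented_scal presented_scal_monoid.

Fact presented_scalC (c : F) (a : presented) :
  presented_scal c * a = a * presented_scal c.
Proof. by by_models; rewrite scalC. Qed.

HB.instance Definition _ := hasScalars.Build F presented presented_scalC.

Section Lift.
Variables (A : pzAlgType F) (g : G -> A).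

Definition lift (_ : P g) (a : presented) : A := teval g (rep a).

Variable Pg : P g.

Lemma lift_gen x : lift Pg (gen x) = g x.
Proof. exact: rep_cls. Qed.

Lemma lift_scal c : lift Pg (scal c) = scal c.
Proof. exact: rep_cls. Qed.

Fact lift_zmod : zmod_morphism (lift Pg).
Proof.
by move=> a b; rewrite /lift !(rep_cls _ Pg) /= !(rep_cls _ Pg) /= rmorphN1 mulN1r.
Qed.
Fact lift_monoid : monoid_morphism (lift Pg).
Proof. by split=> [|a b]; rewrite /lift !(rep_cls _ Pg) //= rmorph1. Qed.

HB.instance Definition _ := GRing.isZmodMorphism.Build presented A (lift Pg) lift_zmod.
HB.instance Definition _ :=
  GRing.isMonoidMorphism.Build presented A (lift Pg) lift_monoid.
End Lift.

Lemma lift_ext (a b : presented) :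
  (forall (A : pzAlgType F) (g : G -> A) (Pg : P g), lift Pg a = lift Pg b) ->
  a = b.
Proof. exact: presented_ext. Qed.

Lemma gen_ind (S : presented -> Prop) :
  (forall x, S (gen x)) -> (forall c : F, S (scal c)) ->
  (forall a b, S a -> S b -> S (a + b)) ->
  (forall a b, S a -> S b -> S (a * b)) ->
  forall a, S a.
Proof.
move=> Sg Sc SD SM a; rewrite -[a]reprK.
elim: (rep a) => [x|c|t IHt u IHu|t IHt u IHu].
- exact: Sg.
- exact: Sc.
- suff -> : cls (TAdd t u) = cls t + cls u :> presented by exact: SD.
  by by_models.
- suff -> : cls (TMul t u) = cls t * cls u :> presented by exact: SM.
  by by_models.
Qed.

Lemma lift_unique (A : pzAlgType F) (f h : {rmorphism presented -> A}) :
  (forall c, f (scal c) = scal c) -> (forall c, h (scal c) = scal c) ->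
  (forall x, f (gen x) = h (gen x)) -> f =1 h.
Proof.
move=> fc hc fh; elim/gen_ind => [//|c|a b fa fb|a b fa fb].
- by rewrite fc hc.
- by rewrite !rmorphD fa fb.
- by rewrite !rmorphM fa fb.
Qed.

End Presented.

(** [cut c] is the ideal [A c] of a central idempotent [c], as an algebra with unit [c] *)

Record central_idempotent (F : fieldType) (A : pzAlgType F) := CentralIdempotent {
  cidem : A;
  cidem_idem : cidem * cidem = cidem;
  cidem_central : forall a : A, a * cidem = cidem * a
}.

Section Cut.
Variables (F : fieldType) (A : pzAlgType F) (c : central_idempotent A).

Definition cut : Type := {a : A | a * cidem c == a}.
HB.instance Definition _ := SubChoice.on cut.

Implicit Types a b : cut.

Lemma cutP a : val a * cidem c = val a. Proof. exact: (eqP (valP a)). Qed.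

Definition mkcut (a : A) (h : a * cidem c = a) : cut := exist _ a (introT eqP h).

Fact cut_zero_subproof : 0 * cidem c = 0 :> A. Proof. exact: mul0r. Qed.
Fact cut_add_subproof a b : (val a + val b) * cidem c = val a + val b.
Proof. by rewrite mulrDl !cutP. Qed.
Fact cut_opp_subproof a : (- val a) * cidem c = - val a.
Proof. by rewrite mulNr cutP. Qed.
Fact cut_mul_subproof a b : (val a * val b) * cidem c = val a * val b.
Proof. by rewrite -mulrA cutP. Qed.
Fact cut_scal_subproof (k : F) : (scal k * cidem c) * cidem c = scal k * cidem c :> A.
Proof. by rewrite -mulrA cidem_idem. Qed.

Definition cut_zero := mkcut cut_zero_subproof.
Definition cut_one := mkcut (cidem_idem c).
Definition cut_add a b := mkcut (cut_add_subproof a b).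
Definition cut_opp a := mkcut (cut_opp_subproof a).
Definition cut_mul a b := mkcut (cut_mul_subproof a b).
Definition cut_scal (k : F) : cut := mkcut (cut_scal_subproof k).

Fact cut_addA : associative cut_add.
Proof. by move=> x y z; apply: val_inj; rewrite /= addrA. Qed.
Fact cut_addC : commutative cut_add.
Proof. by move=> x y; apply: val_inj; rewrite /= addrC. Qed.
Fact cut_add0 : left_id cut_zero cut_add.
Proof. by move=> x; apply: val_inj; rewrite /= add0r. Qed.
Fact cut_addN : left_inverse cut_zero cut_opp cut_add.
Proof. by move=> x; apply: val_inj; rewrite /= addNr. Qed.
Fact cut_mulA : associative cut_mul.
Proof. by move=> x y z; apply: val_inj; rewrite /= mulrA. Qed.
Fact cut_mul1 : left_id cut_one cut_mul.
Proof. by move=> x; apply: val_inj; rewrite /= -cidem_central cutP. Qed.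
Fact cut_mulr1 : right_id cut_one cut_mul.
Proof. by move=> x; apply: val_inj; rewrite /= cutP. Qed.
Fact cut_mulDl : left_distributive cut_mul cut_add.
Proof. by move=> x y z; apply: val_inj; rewrite /= mulrDl. Qed.
Fact cut_mulDr : right_distributive cut_mul cut_add.
Proof. by move=> x y z; apply: val_inj; rewrite /= mulrDr. Qed.

HB.instance Definition _ := GRing.isPzRing.Build cut
  cut_addA cut_addC cut_add0 cut_addN
  cut_mulA cut_mul1 cut_mulr1 cut_mulDl cut_mulDr.

Fact cut_scal_zmod : zmod_morphism cut_scal.
Proof. by move=> k m; apply: val_inj; rewrite /= rmorphB mulrBl. Qed.
Fact cut_scal_monoid : monoid_morphism cut_scal.
Proof.
split=> [|k m]; apply: val_inj; rewrite /= ?rmorph1 ?mul1r // rmorphM.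
by rewrite -!mulrA; congr (_ * _); rewrite -cidem_central -mulrA cidem_idem.
Qed.

HB.instance Definition _ := GRing.isZmodMorphism.Build F cut
  cut_scal cut_scal_zmod.
HB.instance Definition _ := GRing.isMonoidMorphism.Build F cut
  cut_scal cut_scal_monoid.

Fact cut_scalC (k : F) a : cut_scal k * a = a * cut_scal k.
Proof.
by apply: val_inj; rewrite /= -mulrA -cidem_central cutP mulrA -scalC -mulrA cutP.
Qed.

HB.instance Definition _ := hasScalars.Build F cut cut_scalC.

End Cut.

Section CartanData.
Variable l : nat.

Local Notation I := 'I_l.+1.

Definition cartan (i j : nat) : int :=
  if i == j then 2
  else if (i == 0%N) && (j == 1%N) then -1
  else if (i == 1%N) && (j == 0%N) then -2
  else if (i == l) && (j == l.-1) then -1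
  else if (i == l.-1) && (j == l) then -2
  else if (i == j.+1) || (j == i.+1) then -1
  else 0.

Definition symmetrizer (i : nat) : int :=
  if (i == 0%N) || (i == l) then 2 else 1.

Definition root_form (i j : nat) : int := symmetrizer i * cartan i j.

(* The element sum_i b_i alpha_i of the rational span of the simple roots is
   the row vector (b_0, ..., b_l). *)
Definition alpha (m : nat) : 'rV[rat]_l.+1 := \row_(j < l.+1) (j == m :> nat)%:R.

Definition null_root : 'rV[rat]_l.+1 :=
  alpha 0 + 2%:R *: \sum_(1 <= j < l) alpha j + alpha l.

(* xi k i is only meaningful when k + i lies in {0, ..., l}. *)
Definition xi (k : nat) (i : int) : 'rV[rat]_l.+1 :=
  match i with
  | Posz i =>
      \sum_(1 <= t < i) t%:R *: alpha (k + t)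
      + i%:R *: \sum_(k + i <= j < l) alpha j + (i%:R / 2%:R) *: alpha l
  | Negz i' => let i := i'.+1 in
      \sum_(1 <= t < i) t%:R *: alpha (k - t)
      + i%:R *: \sum_(1 <= j < (k - i).+1) alpha j + (i%:R / 2%:R) *: alpha 0
  end.

Definition Qplus : Type := {ffun I -> nat}.

Definition root_of (beta : Qplus) : 'rV[rat]_l.+1 :=
  \sum_(i < l.+1) (beta i)%:R *: alpha i.

Definition height (beta : Qplus) : nat := (\sum_(i < l.+1) beta i)%N.

(* A dominant integral weight L is recorded by the numbers <alpha_i^vee, L>;
   nothing else of L enters the definition of the cyclotomic algebra. *)
Definition fundamental_weight (k : I) : I -> nat := fun i => (i == k).

Lemma alphaE m (j : I) : alpha m 0 j = (j == m :> nat)%:R.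
Proof. by rewrite mxE. Qed.

Lemma root_ofE beta (j : I) : root_of beta 0 j = (beta j)%:R.
Proof.
rewrite summxE (bigD1 j) //= big1 => [|i /negPf nij].
  by rewrite !mxE eqxx mulr1 addr0.
by rewrite !mxE; case: eqP => [/val_inj ji|_]; [rewrite ji eqxx in nij | rewrite mulr0].
Qed.

Lemma sum_alphaE a b (j : I) :
  (\sum_(a <= m < b) alpha m) 0 j = (a <= j < b)%N%:R.
Proof.
rewrite summxE; under eq_bigr do rewrite alphaE.
case: (boolP (a <= j < b)%N) => hj.
  rewrite (bigD1_seq (j : nat)) ?mem_index_iota ?iota_uniq //= eqxx big1 ?addr0 //.
  by move=> m /negPf; rewrite eq_sym => ->.
rewrite big_nat big1 // => m hm; case: eqP => // jm.
by rewrite jm hm in hj.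
Qed.

(* The elements delta - xi_{k,2} and delta - xi_{k,-2} do lie in Q^+. *)
Lemma null_root_sub_xi (k : I) (i : int) :
  (2 <= l)%N -> i \in [:: 2; -2] -> 0 <= k%:Z + i <= l%:Z ->
  exists beta : Qplus, root_of beta = null_root - xi k i.
Proof.
move=> l2; have hk := ltn_ord k; rewrite !inE => /orP[]/eqP -> hki.
  have {}hki : (k + 2 <= l)%N by lia.
  exists [ffun j : I => if j == 0%N :> nat then 1%N else if (j <= k)%N then 2
    else if j == k.+1 :> nat then 1 else 0]%N.
  apply/rowP => j; have hj := ltn_ord j.
  rewrite -[2 : int]/(Posz 2) root_ofE ffunE /null_root /xi big_nat1 !mxE !sum_alphaE addn1.
  case: (boolP (j == 0%N :> nat)) => h0; case: (leqP j k) => h1;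
  case: (boolP (j == k.+1 :> nat)) => h2; case: (leqP 1 j) => h3;
  case: (boolP (j == l :> nat)) => h4; case: (ltnP j l) => h5;
  case: (leqP (k + 2) j) => h6 /=; try (exfalso; lia); lra.
have {}hki : (2 <= k)%N by lia.
exists [ffun j : I => if j == l :> nat then 1%N else if (k <= j)%N then 2
  else if j == k.-1 :> nat then 1 else 0]%N.
apply/rowP => j; have hj := ltn_ord j.
rewrite -[- 2 : int]/(Negz 1) root_ofE ffunE /null_root /xi big_nat1 !mxE !sum_alphaE subn1.
case: (boolP (j == 0%N :> nat)) => h0; case: (leqP k j) => h1;
case: (boolP (j == k.-1 :> nat)) => h2; case: (leqP 1 j) => h3;
case: (boolP (j == l :> nat)) => h4; case: (ltnP j l) => h5;
case: (ltnP j (k - 2).+1) => h6 /=; try (exfalso; lia); lra.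
Qed.

End CartanData.

(** An element q of F[u,v] is a polynomial in u with coefficients in F[v], so
    that [q`_m`_n] is the coefficient of u^m v^n. *)

Record klr_parameters (F : fieldType) (l : nat)
    (Q : 'I_l.+1 -> 'I_l.+1 -> {poly {poly F}}) : Prop := KlrParameters {
  klr_param_diag : forall i, Q i i = 0;
  klr_param_supp : forall (i j : 'I_l.+1) (p q : nat), i != j -> (Q i j)`_p`_q != 0 ->
    p%:Z * root_form l i i + q%:Z * root_form l j j
      + 2 * root_form l i j = 0;
  klr_param_lead : forall (i j : 'I_l.+1) (p : nat), i != j -> p%:Z = - cartan l i j ->
    (Q i j)`_p`_0 != 0;
  klr_param_sym : forall i j : 'I_l.+1, i != j -> Q i j = swapXY (Q j i)
}.

Section Evaluation.
Variable F : fieldType.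
Implicit Types A B : pzAlgType F.

Definition bieval A (q : {poly {poly F}}) (a b : A) : A :=
  \sum_(m < size q) \sum_(n < size q`_m) scal q`_m`_n * (a ^+ m * b ^+ n).

(* (q(a,b) - q(c,b)) / (a - c), where (a^m - c^m) / (a - c) is
   a^(m-1) + a^(m-2) c + ... + c^(m-1) *)
Definition bidivdiff A (q : {poly {poly F}}) (a b c : A) : A :=
  \sum_(m < size q) \sum_(n < size q`_m)
    scal q`_m`_n * ((\sum_(s < m) a ^+ (m.-1 - s) * c ^+ s) * b ^+ n).

Lemma bieval_rmorph A B (f : {rmorphism A -> B}) q a b :
  (forall c, f (scal c) = scal c) -> f (bieval q a b) = bieval q (f a) (f b).
Proof.
move=> fc; rewrite /bieval rmorph_sum; apply: eq_bigr => m _.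
rewrite rmorph_sum; apply: eq_bigr => n _.
by rewrite !rmorphM !rmorphXn fc.
Qed.

Lemma bidivdiff_rmorph A B (f : {rmorphism A -> B}) q a b c :
  (forall k, f (scal k) = scal k) ->
  f (bidivdiff q a b c) = bidivdiff q (f a) (f b) (f c).
Proof.
move=> fc; rewrite /bidivdiff rmorph_sum; apply: eq_bigr => m _.
rewrite rmorph_sum; apply: eq_bigr => n _.
rewrite !rmorphM rmorph_sum rmorphXn fc; congr (_ * (_ * _)).
by apply: eq_bigr => s _; rewrite rmorphM !rmorphXn.
Qed.

Lemma bidivdiffE A q (a b c : A) : GRing.comm a c ->
  (a - c) * bidivdiff q a b c = bieval q a b - bieval q c b.
Proof.
move=> ac; rewrite /bidivdiff /bieval mulr_sumr -sumrB.
apply: eq_bigr => m _; rewrite mulr_sumr -sumrB; apply: eq_bigr => n _.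
by rewrite mulrA -scalC -mulrA (mulrA (a - c)) -subrXX_comm // mulrBl mulrBr.
Qed.

End Evaluation.

Section KLR.
Variables (F : fieldType) (l : nat).
Local Notation I := 'I_l.+1.
Variables (Q : I -> I -> {poly {poly F}}) (L : I -> nat) (n : nat).

(* Places are numbered from 0: [x r] is the informal x_{r+1}, [psi r] is the
   informal psi_{r+1}, and [psi r] involves the places [fst_place r] = r and
   [snd_place r] = r + 1. *)

Fact snd_place_subproof (r : 'I_n.-1) : (r.+1 < n)%N.
Proof. by case: n r => [|m] [r hr]. Qed.

Definition fst_place (r : 'I_n.-1) : 'I_n := Ordinal (ltnW (snd_place_subproof r)).
Definition snd_place (r : 'I_n.-1) : 'I_n := Ordinal (snd_place_subproof r).

Definition swap (r : 'I_n.-1) (nu : n.-tuple I) : n.-tuple I :=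
  [tuple tnth nu (tperm (fst_place r) (snd_place r) i) | i < n].

Record klr_relations (A : pzAlgType F)
    (e : n.-tuple I -> A) (x : 'I_n -> A) (psi : 'I_n.-1 -> A) : Prop := {
  klr_ee : forall nu mu, e nu * e mu = if nu == mu then e nu else 0;
  klr_sum_e : \sum_nu e nu = 1;
  klr_xe : forall r nu, x r * e nu = e nu * x r;
  klr_psie : forall r nu, psi r * e nu = e (swap r nu) * psi r;
  klr_xx : forall r s, x r * x s = x s * x r;
  klr_psix : forall r (s : 'I_n), s != fst_place r -> s != snd_place r ->
    psi r * x s = x s * psi r;
  klr_psipsi : forall r s : 'I_n.-1, (r.+1 < s)%N || (s.+1 < r)%N ->
    psi r * psi s = psi s * psi r;
  klr_xpsi : forall r nu,
    x (fst_place r) * psi r * e nu =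
    (psi r * x (snd_place r)
     - (tnth nu (fst_place r) == tnth nu (snd_place r))%:R) * e nu;
  klr_xpsiS : forall r nu,
    x (snd_place r) * psi r * e nu =
    (psi r * x (fst_place r)
     + (tnth nu (fst_place r) == tnth nu (snd_place r))%:R) * e nu;
  klr_psi2 : forall r nu,
    psi r ^+ 2 * e nu =
    bieval (Q (tnth nu (fst_place r)) (tnth nu (snd_place r)))
      (x (fst_place r)) (x (snd_place r)) * e nu;
  klr_braid : forall (r s : 'I_n.-1) nu, s = r.+1 :> nat ->
    (psi s * psi r * psi s - psi r * psi s * psi r) * e nu =
    if tnth nu (fst_place r) == tnth nu (snd_place s) then
      bidivdiff (Q (tnth nu (fst_place r)) (tnth nu (snd_place r)))
        (x (fst_place r)) (x (snd_place r)) (x (snd_place s)) * e nu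
    else 0;
  klr_cyclotomic : forall (r : 'I_n) nu, r = 0%N :> nat ->
    x r ^+ L (tnth nu r) * e nu = 0
}.

Inductive klr_gen : Type :=
| KE of n.-tuple I
| KX of 'I_n
| KPsi of 'I_n.-1.

Definition klr_presents (A : pzAlgType F) (g : klr_gen -> A) : Prop :=
  klr_relations (fun nu => g (KE nu)) (fun r => g (KX r)) (fun r => g (KPsi r)).

Definition klr : Type := presented klr_presents.
HB.instance Definition _ := PzAlgebra.on klr.

Lemma klr_presentation : klr_presents (gen klr_presents).
Proof.
have sc (A : pzAlgType F) (g : klr_gen -> A) (Pg : klr_presents g) c :
  lift Pg (scal c) = scal c by exact: lift_scal.
split.
- move=> nu mu; apply: lift_ext => A g Pg; rewrite rmorphM /= !lift_gen (klr_ee Pg).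
  by case: eqP => _; rewrite /= ?rmorph0 ?lift_gen.
- apply: lift_ext => A g Pg; rewrite rmorph_sum rmorph1 -(klr_sum_e Pg).
  by apply: eq_bigr => nu _; rewrite /= lift_gen.
- by move=> r nu; apply: lift_ext => A g Pg; rewrite !rmorphM /= !lift_gen (klr_xe Pg).
- by move=> r nu; apply: lift_ext => A g Pg; rewrite !rmorphM /= !lift_gen (klr_psie Pg).
- by move=> r s; apply: lift_ext => A g Pg; rewrite !rmorphM /= !lift_gen (klr_xx Pg).
- move=> r s h1 h2; apply: lift_ext => A g Pg.
  by rewrite !rmorphM /= !lift_gen (klr_psix Pg).
- move=> r s h; apply: lift_ext => A g Pg.
  by rewrite !rmorphM /= !lift_gen (klr_psipsi Pg).
- move=> r nu; apply: lift_ext => A g Pg.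
  by rewrite !(rmorphM, rmorphB, rmorph_nat) /= !lift_gen (klr_xpsi Pg).
- move=> r nu; apply: lift_ext => A g Pg.
  by rewrite !(rmorphM, rmorphD, rmorph_nat) /= !lift_gen (klr_xpsiS Pg).
- move=> r nu; apply: lift_ext => A g Pg.
  rewrite rmorphM rmorphXn rmorphM bieval_rmorph; last exact: sc.
  by rewrite /= !lift_gen (klr_psi2 Pg).
- move=> r s nu rs; apply: lift_ext => A g Pg.
  rewrite !(rmorphM, rmorphB) /= !lift_gen (klr_braid Pg) //.
  case: ifP => _; rewrite ?rmorph0 // rmorphM bidivdiff_rmorph; last exact: sc.
  by rewrite /= !lift_gen.
- move=> r nu r0; apply: lift_ext => A g Pg.
  by rewrite rmorphM rmorphXn rmorph0 /= !lift_gen (klr_cyclotomic Pg).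
Qed.

Definition klr_e (nu : n.-tuple I) : klr := gen klr_presents (KE nu).

Definition in_I_beta (beta : Qplus l) (nu : n.-tuple I) : bool :=
  \sum_(r < n) alpha l (tnth nu r) == root_of beta.

Definition e_beta_elt (beta : Qplus l) : klr := \sum_(nu | in_I_beta beta nu) klr_e nu.

Lemma e_beta_idem beta : e_beta_elt beta * e_beta_elt beta = e_beta_elt beta.
Proof.
rewrite /e_beta_elt mulr_suml; apply: eq_bigr => nu nub.
rewrite mulr_sumr (bigD1 nu) //= big1 => [|mu /andP[_ /negPf numu]];
  rewrite (klr_ee klr_presentation).
  by rewrite eqxx addr0.
by rewrite eq_sym numu.
Qed.

Lemma swapK r : involutive (swap r).
Proof.
by move=> nu; apply: eq_from_tnth => i; rewrite !tnth_mktuple tpermK.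
Qed.

Lemma in_I_beta_swap beta r nu : in_I_beta beta (swap r nu) = in_I_beta beta nu.
Proof.
rewrite /in_I_beta; congr (_ == _).
rewrite (reindex_inj (@perm_inj _ (tperm (fst_place r) (snd_place r)))) /=.
by apply: eq_bigr => i _; rewrite tnth_mktuple tpermK.
Qed.

Lemma e_beta_central beta (a : klr) : a * e_beta_elt beta = e_beta_elt beta * a.
Proof.
elim/gen_ind: a => [[mu|r|r]|c|a b ha hb|a b ha hb].
- rewrite mulr_sumr mulr_suml; apply: eq_bigr => nu _.
  by rewrite !(klr_ee klr_presentation) eq_sym; case: eqP => // ->.
- rewrite mulr_sumr mulr_suml; apply: eq_bigr => nu _.
  exact: (klr_xe klr_presentation).
- rewrite mulr_sumr mulr_suml [RHS](reindex_inj (inv_inj (swapK r))) /=.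
  apply: eq_big => [nu|nu _]; first by rewrite in_I_beta_swap.
  exact: (klr_psie klr_presentation).
- exact: scalC.
- by rewrite mulrDl mulrDr ha hb.
- by rewrite -mulrA hb mulrA ha mulrA.
Qed.

Definition e_beta (beta : Qplus l) : central_idempotent klr :=
  CentralIdempotent (e_beta_idem beta) (@e_beta_central beta).

End KLR.

(* The block algebra R^L(beta) = R^L_n e(beta), n the height of beta *)
Definition klr_block (F : fieldType) (l : nat)
    (Q : 'I_l.+1 -> 'I_l.+1 -> {poly {poly F}}) (L : 'I_l.+1 -> nat)
    (beta : Qplus l) : pzAlgType F :=
  cut (e_beta Q L (height beta) beta).

(* Main.v *)
From HB Require Import structures.
Require Import Defs.
From mathcomp Require Import all_boot all_order perm all_algebra.
From mathcomp Require Import boolp zify lra.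

(** The Young diagrams contributing to the block have two columns: the nonzero [e nu] are
    the residue sequences of standard tableaux whose columns have lengths [K + 1 + s] and
    [K + 1 - s], where [K] is the distance of [k] to an end of the Dynkin diagram.  Before
    its last letter such a sequence determines its tableau, and rearranging it only swaps
    letters that are not neighbours, so that the generators [psi] other than the last one
    act as matrix units and the generators [x] other than the last one act as [0].  The block is
    thus, up to matrix units, a quotient of the zigzag algebra on vertices [0, ..., K]: its
    arrows come from the last [psi], and its loops from the last [x].
    Only upper bounds on the algebra are needed.  A vector on which the loop acts nontrivially
    splits off a projective module; if the loops act as [0], the functorial filtration by
    strings, read off from the leftmost vertex of the support, splits off a string module.
    An indecomposable module is determined by the type of such a summand, and there are
    finitely many types. *)

Set Implicit Arguments.
Unset Strict Implicit.
Unset Printing Implicit Defensive.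

Import Order.TTheory GRing.Theory Num.Theory.
Local Open Scope ring_scope.

(** * Linear algebra over a block *)

(** The residues on offer drive everything. When the columns have lengths [a] and [b] with [b < a],
    the next boxes have residues |K - a| and K + 1 - b, which differ by the smaller of a + 1 - b and
    2K + 1 - a - b. So they are at least 2 apart while a + b < 2K, neighbours at a + b = 2K, and
    equal at a + b = 2K + 1. The neighbours produce the arrows; the coincidence gives two tableaux
    the same residue sequence and leaves room for a loop. The obstacle is that the vanishing of
    words and the vanishing of the generators [x] cannot be separated: a repeated letter kills a
    word only where an [x] acts as 0, and an [x] is killed only by passing through a zero word. Both
    are proved in one induction on the length. The double bond is the exception in it: there the
    quadratic relation gives only the square of [x], and the braid relation has to supply the
    missing case. Modules of the same type are compared by maps in both directions whose composites
    are idempotent, so that the common summand never has to be described as a module over the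
    block. *)

Section IdempotentSplitting.
Variables (A : pzRingType) (M : lmodType A).

(** For an idempotent [f] these vectors form the image of [f], that is, the direct summand that it
    cuts out. *)
Definition fixed (f : {linear M -> M}) : pred M := fun v => f v == v.

Fact fixed_submod_closed (f : {linear M -> M}) : submod_closed (fixed f).
Proof.
split=> [|c u v /eqP fu /eqP fv]; first by rewrite unfold_in /fixed linear0.
by rewrite unfold_in /fixed linearP fu fv.
Qed.

HB.instance Definition _ f :=
  GRing.isSubmodClosed.Build A M (fixed f) (fixed_submod_closed f).

Record fixed_module (f : {linear M -> M}) :=
  FixedModule { fixed_val : M; _ : fixed_val \in fixed f }.

HB.instance Definition _ f := [isSub for @fixed_val f].
HB.instance Definition _ f := [Choice of fixed_module f by <:].
HB.instance Definition _ f := [SubChoice_isSubLmodule of fixed_module f by <:].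

End IdempotentSplitting.

Section Indecomposable.
Variables (F : fieldType) (A : pzAlgType F).

(** The module splits as the fixed vectors of [f] times those of [id - f]. The first factor contains
    the nonzero vector [f v], so the second is zero. *)
Lemma indecomposable_idempotent (M : lmodType A) (f : M -> M) :
  indecomposable M -> linear f -> (forall v, f (f v) = f v) ->
  (exists v, f v <> 0) -> f =1 id.
Proof.
move=> [_ indM] lf ff [v0 fv0].
pose fM := GRing.isLinear.Build A M M _ f lf.
pose g : {linear M -> M} := HB.pack f fM.
pose h : {linear M -> M} := idfun \- g.
have gE v : g v = f v by [].
have hE v : h v = v - f v by [].
have gfix v : g v \in fixed g by rewrite unfold_in /fixed !gE ff.
have hfix v : h v \in fixed h.
  by rewrite unfold_in /fixed !hE -!gE linearB !gE ff subrr subr0.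
pose k v : fixed_module g * fixed_module h :=
  (FixedModule (gfix v), FixedModule (hfix v)).
have lk : linear k.
  move=> c u v; congr pair; apply: val_inj; rewrite /= lf //.
  by rewrite scalerBr opprD addrACA.
pose kM := GRing.isLinear.Build A M (fixed_module g * fixed_module h)%type _ k lk.
pose kl : {linear M -> (fixed_module g * fixed_module h)%type} := HB.pack k kM.
have bk : bijective kl.
  exists (fun p => fixed_val p.1 + fixed_val p.2) => [v|[[u fu] [v fv]]] /=.
    by rewrite addrC subrK.
  have fuE : f u = u by apply/eqP; exact: fu.
  have fvE : f v = 0.
    by move: (fv) => /eqP; rewrite hE -[RHS]subr0 => /addrI /oppr_inj.
  have fuv : f (u + v) = u by rewrite -gE linearD !gE fuE fvE addr0.
  by congr pair; apply: val_inj; rewrite /= fuv // addrC addKr.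
case: (indM _ _ (ex_intro _ kl bk)) => z.
  by case: fv0; move: (z (FixedModule (gfix v0))) => /(congr1 val).
move=> v; move: (z (FixedModule (hfix v))) => /(congr1 val) /= /eqP.
by rewrite subr_eq0 => /eqP.
Qed.

End Indecomposable.

Section Functionals.
Variables (F : fieldType) (A : pzAlgType F).
Implicit Types M N : lmodType A.

Local Notation "c *:: v" := ((scal c : A) *: v) (at level 40).

Definition functional M (phi : M -> F) : Prop :=
  forall c u v, phi (c *:: u + v) = c * phi u + phi v.

Definition flinear M N (f : M -> N) : Prop :=
  forall c u v, f (c *:: u + v) = c *:: f u + f v.

Lemma scal1 M (v : M) : 1 *:: v = v.
Proof. by rewrite rmorph1 scale1r. Qed.

Lemma scal0 M (v : M) : 0 *:: v = 0.
Proof. by rewrite rmorph0 scale0r. Qed.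

Lemma scalA M c d (v : M) : c *:: (d *:: v) = (c * d) *:: v.
Proof. by rewrite scalerA rmorphM. Qed.

Lemma scal_comm M c (z : A) (v : M) : z *: (c *:: v) = c *:: (z *: v).
Proof. by rewrite !scalerA scalC. Qed.

Lemma functional0 M (phi : M -> F) : functional phi -> phi 0 = 0.
Proof.
move=> lphi; have := lphi 0 0 0; rewrite scal0 add0r mul0r add0r //.
have := lphi 1 0 0; rewrite scal1 addr0 mul1r => h _.
by apply: (addrI (phi 0)); rewrite addr0 -h.
Qed.

Lemma functionalZ M (phi : M -> F) c v : functional phi -> phi (c *:: v) = c * phi v.
Proof. by move=> lphi; have := lphi c v 0; rewrite (functional0 lphi) !addr0. Qed.

Lemma functionalD M (phi : M -> F) u v : functional phi -> phi (u + v) = phi u + phi v.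
Proof. by move=> lphi; have := lphi 1 u v; rewrite scal1 mul1r. Qed.

Lemma functional_comp M (phi : M -> F) (z : A) :
  functional phi -> functional (fun v => phi (z *: v)).
Proof. by move=> lphi c u v; rewrite scalerDr scal_comm lphi. Qed.

Lemma flinear0 M N (f : M -> N) : flinear f -> f 0 = 0.
Proof.
move=> lf; have := lf 1 0 0; rewrite !scal1 addr0 => h.
by apply: (addrI (f 0)); rewrite addr0 -h.
Qed.

Lemma flinearD M N (f : M -> N) u v : flinear f -> f (u + v) = f u + f v.
Proof. by move=> lf; have := lf 1 u v; rewrite !scal1. Qed.

Lemma flinearZ M N (f : M -> N) c v : flinear f -> f (c *:: v) = c *:: f v.
Proof. by move=> lf; have := lf c v 0; rewrite (flinear0 lf) !addr0. Qed.

Lemma flinear_sum M N (f : M -> N) (I : Type) (r : seq I) (P : pred I) (h : I -> M) :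
  flinear f -> f (\sum_(i <- r | P i) h i) = \sum_(i <- r | P i) f (h i).
Proof.
by move=> lf; apply: (big_morph f) => [u v|]; [exact: flinearD | exact: flinear0].
Qed.

Lemma functional_scale M (phi : M -> F) d :
  functional phi -> functional (fun v => d * phi v).
Proof. by move=> lphi c u v; rewrite lphi mulrDr mulrCA. Qed.

Lemma flinear_rank1 M N (phi : M -> F) (w : N) :
  functional phi -> flinear (fun v => phi v *:: w).
Proof. by move=> lphi c u v; rewrite lphi rmorphD rmorphM scalerDl scalerA. Qed.

Lemma flinear_add M N (f g : M -> N) :
  flinear f -> flinear g -> flinear (fun v => f v + g v).
Proof. by move=> lf lg c u v; rewrite lf lg scalerDr addrACA. Qed.

(** [Gam] is the graph of a partial linear functional. Finite dimension takes the place of Zorn's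
    lemma: the spanning vectors join the domain one at a time. *)
Lemma extend_functional M (Gam : M -> F -> Prop) :
  fin_dim M -> Gam 0 0 ->
  (forall c u s v t, Gam u s -> Gam v t -> Gam (c *:: u + v) (c * s + t)) ->
  (forall s, Gam 0 s -> s = 0) ->
  exists2 phi : M -> F, functional phi & forall u s, Gam u s -> phi u = s.
Proof.
move=> [m [b bspan]] G0 Glin Gfun.
have [G' [sGG' [G'0 [G'lin [G'fun G'b]]]]] : exists G' : M -> F -> Prop,
    (forall u s, Gam u s -> G' u s) /\ G' 0 0 /\
    (forall c u s v t, G' u s -> G' v t -> G' (c *:: u + v) (c * s + t)) /\
    (forall s, G' 0 s -> s = 0) /\
    forall v, v \in codom b -> exists s, G' v s.
  elim: (codom b) => [|w bs [G' [sGG' [G'0 [G'lin [G'fun G'b]]]]]].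
    by exists Gam; split=> //; split=> //; split=> //; split.
  have [[s0 Gw]|nGw] := pselect (exists s, G' w s).
    exists G'; split=> //; split=> //; split=> //; split=> // v.
    by rewrite inE => /orP[/eqP ->|/G'b //]; exists s0.
  (* A vector [w] outside the domain is given the value 0. *)
  exists (fun u s => exists c, G' (u - c *:: w) s); split.
    by move=> u s us; exists 0; rewrite scal0 subr0; apply: sGG'.
  split; first by exists 0; rewrite scal0 subr0.
  split.
    move=> c u s v t [d us] [d' vt]; exists (c * d + d').
    have -> : c *:: u + v - (c * d + d') *:: w = c *:: (u - d *:: w) + (v - d' *:: w).
      by rewrite scalerBr scalA rmorphD scalerDl opprD addrACA.
    exact: G'lin.
  split.
    move=> s [c]; rewrite sub0r => Gs.
    have [c0|c0] := eqVneq c 0; first by move: Gs; rewrite c0 scal0 oppr0; apply: G'fun.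
    case: nGw; exists (- c^-1 * s + 0).
    rewrite -[w]addr0; have -> : w = (- c^-1) *:: (- (c *:: w)).
      by rewrite rmorphN scaleNr scalerN opprK scalA mulVf // scal1.
    exact: G'lin.
  move=> v; rewrite inE => /orP[/eqP ->|/G'b [s vs]].
    by exists 0, 1; rewrite scal1 subrr.
  by exists s, 0; rewrite scal0 subr0.
have Gtot v : exists s, G' v s.
  have [c ->] := bspan v.
  elim/big_ind: _ => [|x y [s xs] [t yt]|i _]; first by exists 0.
    by exists (1 * s + t); rewrite -[x]scal1; apply: G'lin.
  have [s bs] := G'b _ (codom_f b i).
  by exists (c i * s + 0); rewrite -[_ *: _]addr0; apply: G'lin.
have [phi phiP] := boolp.choice Gtot.
have uniq u s t : G' u s -> G' u t -> s = t.
  move=> us ut; have := G'lin (-1) _ _ _ _ us ut.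
  rewrite rmorphN1 scaleN1r addNr mulN1r addrC => /G'fun /eqP.
  by rewrite subr_eq0 eq_sym => /eqP.
exists phi => [c u v|u s us]; last exact: uniq (phiP u) (sGG' _ _ us).
by apply: uniq (phiP _) _; apply: G'lin.
Qed.

Definition subspace M (G : M -> Prop) : Prop :=
  G 0 /\ forall c u v, G u -> G v -> G (c *:: u + v).

(** The partial functional on the span of [G] and [v] has the graph [G (u - s *:: v)]; it is
    single-valued because [v] lies outside [G]. *)
Lemma separate M (G : M -> Prop) v : fin_dim M -> subspace G -> ~ G v ->
  exists phi, [/\ functional phi, phi v = 1 & forall u, G u -> phi u = 0].
Proof.
move=> fM [G0 Glin] nGv.
have [||s|phi lphi phiP] := @extend_functional M (fun u s => G (u - s *:: v)) fM.
- by rewrite scal0 subr0.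
- move=> c u s u' t Gu Gu'.
  have -> : c *:: u + u' - (c * s + t) *:: v = c *:: (u - s *:: v) + (u' - t *:: v).
    by rewrite scalerBr scalA rmorphD scalerDl opprD addrACA.
  exact: Glin.
- rewrite sub0r => Gs; have [//|s0] := eqVneq s 0; case: nGv.
  rewrite -[v]addr0; have -> : v = (- s^-1) *:: (- (s *:: v)).
    by rewrite rmorphN scaleNr scalerN opprK scalA mulVf // scal1.
  exact: Glin.
exists phi; split=> //; first by apply: phiP; rewrite scal1 subrr.
by move=> u Gu; apply: phiP; rewrite scal0 subr0.
Qed.

(** The equation [psi (z u) = phi u] is solved on the image of [z], modulo [G]; the hypothesis on
    [phi] says that this is well defined. *)
Lemma factor_functional M (G : M -> Prop) (z : A) (phi : M -> F) :
  fin_dim M -> subspace G -> functional phi ->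
  (forall u, G (z *: u) -> phi u = 0) ->
  exists2 psi, functional psi & (forall u, psi (z *: u) = phi u) /\ forall u, G u -> psi u = 0.
Proof.
move=> fM [G0 Glin] lphi phi0.
have [||s|psi lpsi psiP] := @extend_functional M
   (fun w s => exists2 u, G (w - z *: u) & s = phi u) fM.
- by exists 0; rewrite ?scaler0 ?subr0 // (functional0 lphi).
- move=> c w s w' t [u Gu ->] [u' Gu' ->]; exists (c *:: u + u'); last by rewrite lphi.
  rewrite scalerDr scal_comm.
  have -> : c *:: w + w' - (c *:: (z *: u) + z *: u') = c *:: (w - z *: u) + (w' - z *: u').
    by rewrite scalerBr opprD addrACA.
  exact: Glin.
- case=> u Gu ->; apply: phi0; move: Gu; rewrite sub0r => Gu.
  have -> : z *: u = (-1) *:: (- (z *: u)) + 0.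
    by rewrite rmorphN1 scaleN1r opprK addr0.
  exact: Glin.
exists psi => //; split=> [u|u Gu]; first by apply: psiP; exists u; rewrite ?subrr.
by apply: psiP; exists 0; rewrite ?scaler0 ?subr0 // (functional0 lphi).
Qed.

End Functionals.

(** * Modules over a zigzag algebra *)

(** Only a corner of [A] is described: the [e s] are orthogonal idempotents that need not sum to 1.
    The arrow [a] leads from vertex [s] to [s.+1], [b] leads back, and [x] collects the loops.
    Nothing has to be nonzero, so quotients of the zigzag algebra are covered, and the scalars [c]
    may vary with [s]. *)
Record zigzag (F : fieldType) (A : pzAlgType F) (K : nat) (e : nat -> A) (x a b : A) :
    Prop := Zigzag {
  zz_ee : forall s t, e s * e t = if s == t then e s else 0;
  zz_e_large : forall s, (K < s)%N -> e s = 0;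
  zz_x_sum : x = x * \sum_(s < K.+1) e s;
  zz_xe : forall s, x * e s = e s * x;
  zz_ae : forall s, a * e s = e s.+1 * a;
  zz_be : forall s, b * e s.+1 = e s * b;
  zz_be0 : b * e 0%N = 0;
  zz_e0a : e 0%N * a = 0;
  zz_aa : a * a = 0;
  zz_bb : b * b = 0;
  zz_xx : x * x = 0;
  zz_xa : x * a = 0;
  zz_ax : a * x = 0;
  zz_xb : x * b = 0;
  zz_bx : b * x = 0;
  zz_ba : forall s, (s < K)%N -> exists2 c : F, c != 0 & b * a * e s = scal c * x * e s;
  zz_ab : forall s, (s < K)%N -> exists2 c : F, c != 0 & a * b * e s.+1 = scal c * x * e s.+1
}.

Section ZigzagModules.
Variables (F : fieldType) (A : pzAlgType F) (K : nat) (e : nat -> A) (x a b : A).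
Hypothesis zz : zigzag K e x a b.
Implicit Types M N : lmodType A.

Local Notation "c *:: v" := ((scal c : A) *: v) (at level 40).

Definition intertwines (M N : lmodType A) (f : M -> N) (z : A) : Prop :=
  forall v, f (z *: v) = z *: f v.

(** A morphism over the corner only. Linearity over [A] is recovered by [extension] below. *)
Definition zigzag_morphism (M N : lmodType A) (f : M -> N) : Prop :=
  [/\ flinear f, forall s, intertwines f (e s), intertwines f x, intertwines f a
    & intertwines f b].

Lemma act_xx M (v : M) : x *: (x *: v) = 0. Proof. by rewrite scalerA (zz_xx zz) scale0r. Qed.
Lemma act_aa M (v : M) : a *: (a *: v) = 0. Proof. by rewrite scalerA (zz_aa zz) scale0r. Qed.
Lemma act_bb M (v : M) : b *: (b *: v) = 0. Proof. by rewrite scalerA (zz_bb zz) scale0r. Qed.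
Lemma act_xa M (v : M) : x *: (a *: v) = 0. Proof. by rewrite scalerA (zz_xa zz) scale0r. Qed.
Lemma act_ax M (v : M) : a *: (x *: v) = 0. Proof. by rewrite scalerA (zz_ax zz) scale0r. Qed.
Lemma act_xb M (v : M) : x *: (b *: v) = 0. Proof. by rewrite scalerA (zz_xb zz) scale0r. Qed.
Lemma act_bx M (v : M) : b *: (x *: v) = 0. Proof. by rewrite scalerA (zz_bx zz) scale0r. Qed.
Lemma act_ae M s (v : M) : a *: (e s *: v) = e s.+1 *: (a *: v).
Proof. by rewrite !scalerA (zz_ae zz). Qed.
Lemma act_be M s (v : M) : b *: (e s.+1 *: v) = e s *: (b *: v).
Proof. by rewrite !scalerA (zz_be zz). Qed.
Lemma act_xe M s (v : M) : x *: (e s *: v) = e s *: (x *: v).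
Proof. by rewrite !scalerA (zz_xe zz). Qed.
Lemma act_ee M s t (v : M) : e s *: (e t *: v) = if s == t then e s *: v else 0.
Proof. by rewrite scalerA (zz_ee zz); case: eqP => _; rewrite ?scale0r. Qed.
Lemma act_be0 M (v : M) : b *: (e 0%N *: v) = 0.
Proof. by rewrite scalerA (zz_be0 zz) scale0r. Qed.
Lemma act_e0a M (v : M) : e 0%N *: (a *: v) = 0.
Proof. by rewrite scalerA (zz_e0a zz) scale0r. Qed.
Lemma act_e_large M s (v : M) : (K < s)%N -> e s *: v = 0.
Proof. by move=> /(zz_e_large zz) ->; rewrite scale0r. Qed.

Definition act_zero := (act_xx, act_aa, act_bb, act_xa, act_ax, act_xb, act_bx).

(** The composites are idempotent and [f], [g] are mutually inverse between their images: over the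
    corner, [M] and [N] share a summand, which [v] shows to be nonzero at some vertex. *)
Definition linked (M N : lmodType A) : Prop :=
  exists f : M -> N, exists g : N -> M,
  [/\ zigzag_morphism f, zigzag_morphism g, forall v, f (g (f v)) = f v,
      forall v, g (f (g v)) = g v
    & exists s, exists v, [/\ e s *: v = v, g (f v) = v & v <> 0]].

(** * Projective summands *)

Section Projective.
Variable s : nat.

(** The vector [v] generates a copy of the projective at vertex [s], with socle spanned by [x v];
    [phi] detects the socle and is normalised to vanish on [v]. *)
Definition projective_type M : Prop := exists (phi : M -> F) (v : M),
  [/\ functional phi, forall u, phi (e s *: u) = phi u, e s *: v = v,
      phi (x *: v) = 1 & phi v = 0].

(** At the last vertex the arrow [a] is missing. The terms carrying [c] then vanish, and 1 is an
    arbitrary nonzero choice; [zz_ab_or] treats vertex 0 and [d] in the same way. *)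
Lemma zz_ba_or : exists2 c : F, c != 0 &
  (b * a * e s = scal c * x * e s) \/ (a * e s = 0 /\ e s * b = 0).
Proof.
have [/(zz_ba zz)[c c0 bae]|Ks] := ltnP s K; first by exists c => //; left.
exists 1; rewrite ?oner_neq0 //; right.
by rewrite (zz_ae zz) -(zz_be zz) (zz_e_large zz) ?ltnS // mul0r mulr0.
Qed.

Lemma zz_ab_or : exists2 d : F, d != 0 &
  (a * b * e s = scal d * x * e s) \/ (b * e s = 0 /\ e s * a = 0).
Proof.
case: s => [|t].
  by exists 1; rewrite ?oner_neq0 //; right; rewrite (zz_be0 zz) (zz_e0a zz).
have [/(zz_ab zz)[c c0 bae]|Ks] := ltnP t K; first by exists c => //; left.
exists 1; rewrite ?oner_neq0 //; right.
by rewrite (zz_e_large zz) ?ltnS // mul0r mulr0.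
Qed.

Variables (c d : F).
Hypotheses (c0 : c != 0) (d0 : d != 0).
Hypothesis hc : (b * a * e s = scal c * x * e s) \/ (a * e s = 0 /\ e s * b = 0).
Hypothesis hd : (a * b * e s = scal d * x * e s) \/ (b * e s = 0 /\ e s * a = 0).

(* For [M = N] and [phi (x v) = 1] this is a projection onto the module spanned by [v], [x v],
   [a v] and [b v]; the coefficients come from [b a v = c x v] and [a b v = d x v]. *)
Definition projective_map M N (phi : M -> F) (v : N) (u : M) : N :=
  phi (x *: u) *:: v + phi u *:: (x *: v)
  + (c^-1 * phi (b *: u)) *:: (a *: v) + (d^-1 * phi (a *: u)) *:: (b *: v).

(** Only four coordinates of [u] enter the map, so composites can be compared coordinate by
    coordinate, even between different modules. *)
Lemma projective_map_ext M M' N (phi : M -> F) (psi : M' -> F) (v : N) u u' :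
  phi u = psi u' -> phi (x *: u) = psi (x *: u') ->
  phi (a *: u) = psi (a *: u') -> phi (b *: u) = psi (b *: u') ->
  projective_map phi v u = projective_map psi v u'.
Proof. by rewrite /projective_map => -> -> -> ->. Qed.

Section Datum.
Variables (M : lmodType A) (phi : M -> F).
Hypotheses (lphi : functional phi) (phie : forall u, phi (e s *: u) = phi u).

Lemma phi_e t u : phi (e t *: u) = if t == s then phi u else 0.
Proof.
by rewrite -phie act_ee eq_sym; case: eqP => _; rewrite ?phie ?(functional0 lphi).
Qed.

Lemma phi_xe t u : phi (x *: (e t *: u)) = if t == s then phi (x *: u) else 0.
Proof. by rewrite act_xe phi_e. Qed.

Lemma phi_be t u : phi (b *: (e t *: u)) = if t == s.+1 then phi (b *: u) else 0.
Proof.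
rewrite -phie -act_be act_ee eq_sym; case: eqP => [_|_]; first by rewrite act_be phie.
by rewrite scaler0 (functional0 lphi).
Qed.

Lemma phi_ae t u : phi (a *: (e t *: u)) = if t.+1 == s then phi (a *: u) else 0.
Proof. by rewrite act_ae phi_e. Qed.

Lemma phi_ba u : b * a * e s = scal c * x * e s -> phi (b *: (a *: u)) = c * phi (x *: u).
Proof.
move=> h; rewrite -phie -act_be -act_ae !scalerA h -!scalerA.
by rewrite (functionalZ _ _ lphi) act_xe phie.
Qed.

Lemma phi_ab u : a * b * e s = scal d * x * e s -> phi (a *: (b *: u)) = d * phi (x *: u).
Proof.
case: (posnP s) => [s0 h|].
  rewrite -[LHS]phie s0 act_e0a (functional0 lphi).
  have -> : phi (x *: u) = phi (x *: (e s *: u)) by rewrite act_xe phie.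
  rewrite -(functionalZ _ _ lphi) !scalerA -h s0 -mulrA (zz_be0 zz) mulr0 scale0r.
  by rewrite (functional0 lphi).
case: s phie => // t phie' _ h.
rewrite -phie' -act_ae -act_be !scalerA h -!scalerA.
by rewrite (functionalZ _ _ lphi) act_xe phie'.
Qed.

Lemma phi_vanish z w : e s * z = 0 -> phi (z *: w) = 0.
Proof. by move=> h; rewrite -phie scalerA h scale0r (functional0 lphi). Qed.

End Datum.

Section Vector.
Variables (M : lmodType A) (v : M).
Hypothesis ev : e s *: v = v.

Lemma e_v t : e t *: v = if t == s then v else 0.
Proof. by rewrite -{1}ev act_ee; case: eqP => // ->; rewrite ev. Qed.

Lemma e_av t : e t *: (a *: v) = if t == s.+1 then a *: v else 0.
Proof. by rewrite -{1}ev act_ae act_ee; case: eqP => // ->; rewrite -act_ae ev. Qed.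

Lemma e_bv t : e t *: (b *: v) = if t.+1 == s then b *: v else 0.
Proof. by rewrite -act_be e_v; case: eqP => // _; rewrite scaler0. Qed.

Lemma ba_v : b * a * e s = scal c * x * e s -> b *: (a *: v) = c *:: (x *: v).
Proof. by move=> h; rewrite -{1}ev !scalerA h -!scalerA ev. Qed.

Lemma ab_v : a * b * e s = scal d * x * e s -> a *: (b *: v) = d *:: (x *: v).
Proof. by move=> h; rewrite -{1}ev !scalerA h -!scalerA ev. Qed.

Lemma v_vanish z : z * e s = 0 -> z *: v = 0.
Proof. by move=> h; rewrite -ev scalerA h scale0r. Qed.

End Vector.

(** The substantial cases are [a] and [b]: two terms survive on each side, and the factors [c^-1]
    and [d^-1] make them agree. *)
Lemma projective_map_morphism M N (phi : M -> F) (v : N) :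
  functional phi -> (forall u, phi (e s *: u) = phi u) -> e s *: v = v ->
  zigzag_morphism (projective_map phi v).
Proof.
move=> lphi phie ev; have phi0 := functional0 lphi.
split=> [|t u|u|u|u]; rewrite /projective_map.
- do 3? apply: flinear_add; apply: flinear_rank1 => //;
    do ?apply: functional_scale; exact: functional_comp.
- rewrite (phi_xe lphi phie) (phi_e lphi phie) (phi_be lphi phie) (phi_ae lphi phie).
  rewrite !scalerDr !scal_comm -act_xe (e_v ev) (e_av ev) (e_bv ev).
  by do 3 case: eqP => _; rewrite ?mulr0 ?scal0 ?scaler0.
- by rewrite !act_zero phi0 !scalerDr !scal_comm !act_zero !mulr0 !scal0 !scaler0 !(addr0, add0r).
- rewrite !act_zero phi0 !scalerDr !scal_comm !act_zero !mulr0 !scal0 !scaler0 !(addr0, add0r).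
  rewrite addrC; congr (_ + _).
    case: hc => [h|[h _]]; last by rewrite (v_vanish ev h) !scaler0.
    by rewrite (phi_ba lphi phie _ h) mulKf.
  case: hd => [h|[_ h]]; last by rewrite (phi_vanish lphi phie _ h) !(mulr0, scal0).
  by rewrite (ab_v ev h) scalA mulrAC mulVf // mul1r.
- rewrite !act_zero phi0 !scalerDr !scal_comm !act_zero !mulr0 !scal0 !scaler0 !(addr0, add0r).
  rewrite addrC; congr (_ + _).
    case: hd => [h|[h _]]; last by rewrite (v_vanish ev h) !scaler0.
    by rewrite (phi_ab lphi phie _ h) mulKf.
  case: hc => [h|[_ h]]; last by rewrite (phi_vanish lphi phie _ h) !(mulr0, scal0).
  by rewrite (ba_v ev h) scalA mulrAC mulVf // mul1r.
Qed.

Section Pair.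
Variables (M N : lmodType A) (phi : M -> F) (w : N) (psi : N -> F).
Hypotheses (lphi : functional phi) (phie : forall u, phi (e s *: u) = phi u).
Hypotheses (lpsi : functional psi) (psie : forall u, psi (e s *: u) = psi u).
Hypotheses (ew : e s *: w = w) (psixw : psi (x *: w) = 1) (psiw : psi w = 0).

Let psi_aw : psi (a *: w) = 0.
Proof. by rewrite -psie e_av // ltn_eqF // (functional0 lpsi). Qed.
Let psi_bw : psi (b *: w) = 0.
Proof. by rewrite -psie e_bv // gtn_eqF // (functional0 lpsi). Qed.

(** This lemma and the next three say that the map preserves all four coordinates. Going forth and
    back therefore repeats the first map. *)
Lemma projective_map_value u : psi (projective_map phi w u) = phi u.
Proof.
rewrite /projective_map !(functionalD _ _ lpsi, functionalZ _ _ lpsi).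
by rewrite psixw psiw psi_aw psi_bw !mulr0 mulr1 add0r !addr0.
Qed.

Lemma projective_map_x u : psi (x *: projective_map phi w u) = phi (x *: u).
Proof.
rewrite /projective_map !scalerDr !scal_comm !act_zero.
rewrite !(functionalD _ _ lpsi, functionalZ _ _ lpsi).
by rewrite psixw (functional0 lpsi) !mulr0 mulr1 !addr0.
Qed.

Lemma projective_map_a u : psi (a *: projective_map phi w u) = phi (a *: u).
Proof.
rewrite /projective_map !scalerDr !scal_comm !act_zero.
rewrite !(functionalD _ _ lpsi, functionalZ _ _ lpsi).
rewrite (functional0 lpsi) !mulr0 psi_aw mulr0 !add0r.
case: hd => [h|[_ h]]; last by rewrite !(phi_vanish _ _ _ h) // mulr0.
by rewrite (phi_ab _ _ _ h) // psixw mulr1 mulrAC mulVf // mul1r.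
Qed.

Lemma projective_map_b u : psi (b *: projective_map phi w u) = phi (b *: u).
Proof.
rewrite /projective_map !scalerDr !scal_comm !act_zero.
rewrite !(functionalD _ _ lpsi, functionalZ _ _ lpsi).
rewrite (functional0 lpsi) !mulr0 psi_bw mulr0 !addr0 add0r.
case: hc => [h|[_ h]]; last by rewrite !(phi_vanish _ _ _ h) // mulr0.
by rewrite (phi_ba _ _ _ h) // psixw mulr1 mulrAC mulVf // mul1r.
Qed.

End Pair.
End Projective.

Lemma projective_type_linked s M N : projective_type s M -> projective_type s N -> linked M N.
Proof.
move=> [phi [v [lphi phie ev phixv phiv]]] [psi [w [lpsi psie ew psixw psiw]]].
have [c c0 hc] := zz_ba_or s; have [d d0 hd] := zz_ab_or s.
have wE := (projective_map_value c d phi lpsi psie ew psixw psiw,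
  projective_map_x c d phi lpsi psixw,
  projective_map_a c d0 hd lphi phie lpsi psie ew psixw,
  projective_map_b d c0 hc lphi phie lpsi psie ew psixw).
have vE := (projective_map_value c d psi lphi phie ev phixv phiv,
  projective_map_x c d psi lphi phixv,
  projective_map_a c d0 hd lpsi psie lphi phie ev phixv,
  projective_map_b d c0 hc lpsi psie lphi phie ev phixv).
exists (projective_map c d phi w), (projective_map c d psi v); split.
- exact: (projective_map_morphism (s := s)).
- exact: (projective_map_morphism (s := s)).
- by move=> u; apply: projective_map_ext; rewrite vE wE.
- by move=> u; apply: projective_map_ext; rewrite wE vE.
exists s, v; split=> //.
  rewrite (@projective_map_ext c d _ _ _ psi phi v _ v); try by rewrite wE.
  rewrite /projective_map.
  have -> : phi (b *: v) = 0.
    by rewrite -phie (e_bv ev) gtn_eqF // (functional0 lphi).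
  have -> : phi (a *: v) = 0.
    by rewrite -phie (e_av ev) ltn_eqF // (functional0 lphi).
  by rewrite phixv phiv !mulr0 !scal0 scal1 !addr0.
by move=> v0; move: phixv; rewrite v0 scaler0 (functional0 lphi) => /eqP; rewrite eq_sym oner_eq0.
Qed.

(** * String summands *)

Definition edge_up (w : seq bool) (i : nat) : bool := nth false w i.
(** Past the end of [w] there must be no edge of either kind. The default [false] already excludes
    an upward edge; a downward one is excluded by the bound on [i]. *)
Definition edge_down (w : seq bool) (i : nat) : bool := (i < size w)%N && ~~ nth false w i.

(** The images of the basis of a string module that starts at vertex [j]. The condition
    [b *: u 0 = 0] at the left end is kept apart, because strings are built by adding vertices on
    the left. *)
Definition string_in M (j : nat) (w : seq bool) (u : nat -> M) : Prop :=
  forall i, [/\ e (j + i)%N *: u i = u i,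
    a *: u i = (if edge_up w i then u i.+1 else 0),
    b *: u i.+1 = (if edge_down w i then u i else 0)
  & (size w < i)%N -> u i = 0].

(** The transposed conditions, satisfied by a dual basis: they make the sum of the [phi i m *:: u i]
    commute with the arrows. *)
Definition string_out M (j : nat) (w : seq bool) (phi : nat -> M -> F) : Prop :=
  forall i, [/\ functional (phi i), forall m, phi i (e (j + i)%N *: m) = phi i m,
    forall m, phi i.+1 (a *: m) = (if edge_up w i then phi i m else 0)
  & forall m, phi i (b *: m) = (if edge_down w i then phi i.+1 m else 0)].

Definition string_type (j : nat) (w : seq bool) M : Prop :=
  exists (u : nat -> M) (phi : nat -> M -> F),
  [/\ forall m : M, x *: m = 0, string_in j w u /\ b *: u 0%N = 0,
      string_out j w phi, forall m, phi 0%N (a *: m) = 0 & phi 0%N (u 0%N) = 1].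

Definition string_map M N (phi : nat -> M -> F) (u : nat -> N) (m : M) : N :=
  \sum_(i < K.+1) phi i m *:: u i.

Lemma string_map_morphism M N j w (u : nat -> N) (phi : nat -> M -> F) :
  (forall m : M, x *: m = 0) -> (forall m : N, x *: m = 0) ->
  string_in j w u -> b *: u 0%N = 0 -> string_out j w phi ->
  (forall m, phi 0%N (a *: m) = 0) -> zigzag_morphism (string_map phi u).
Proof.
move=> xM xN hu bu0 hphi phia0.
have lphi i : functional (phi i) by case: (hphi i).
have lmap : flinear (string_map phi u).
  move=> c m m'; rewrite /string_map scaler_sumr -big_split; apply: eq_bigr => i _ /=.
  by rewrite lphi rmorphD rmorphM scalerDl scalerA.
have large i : (K < j + i)%N -> u i = 0.
  by move=> h; have [<- _ _ _] := hu i; rewrite act_e_large.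
split=> // [t m|m|m|m].
- rewrite /string_map scaler_sumr; apply: eq_bigr => i _.
  have [eu _ _ _] := hu i; have [_ phie _ _] := hphi i.
  rewrite -phie act_ee -{2}eu scal_comm act_ee eq_sym.
  by case: eqP => [->|_]; rewrite ?phie ?eu // (functional0 (lphi i)) scal0 scaler0.
- by rewrite xM xN (flinear0 lmap).
(* The two sums are shifted by one against each other. The boundary term on the left vanishes by
   [phi 0 (a m) = 0], the one on the right because there is no vertex beyond [K]. *)
- rewrite /string_map scaler_sumr big_ord_recl phia0 scal0 add0r big_ord_recr /=.
  have [_ au _ _] := hu K; rewrite scal_comm au.
  have -> : (if edge_up w K then u K.+1 else 0) = 0.
    by case: ifP => // _; rewrite large // ltn_addl.
  rewrite scaler0 addr0; apply: eq_bigr => i _; rewrite scal_comm.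
  have [_ -> _ _] := hu i; have [_ _ -> _] := hphi i.
  by rewrite /bump add1n; case: ifP => _; rewrite ?scaler0 ?scal0.
- rewrite /string_map scaler_sumr [RHS]big_ord_recl scal_comm bu0 scaler0 add0r big_ord_recr /=.
  have [_ _ _ ->] := hphi K.
  have -> : (if edge_down w K then phi K.+1 m else 0) *:: u K = 0.
    have [_ pe _ _] := hphi K.+1.
    by rewrite -pe act_e_large ?(functional0 (lphi _)) ?if_same ?scal0 // addnS ltnS leq_addl.
  rewrite addr0; apply: eq_bigr => i _; rewrite scal_comm.
  have [_ _ -> _] := hu i; have [_ _ _ ->] := hphi i.
  by rewrite /bump add1n; case: ifP => _; rewrite ?scaler0 ?scal0.
Qed.

(** Off the diagonal the vertices differ. On it, the value 1 at index 0 is carried along the string,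
    through [a] at an upward edge and through [b] at a downward one. *)
Lemma string_pairing M j w (u : nat -> M) (phi : nat -> M -> F) i i' :
  string_in j w u -> string_out j w phi -> phi 0%N (u 0%N) = 1 ->
  (i <= size w)%N -> phi i' (u i) = (i' == i)%:R.
Proof.
move=> hu hphi pu0 iw.
have lphi k : functional (phi k) by case: (hphi k).
have [->|ne] := eqVneq i' i; last first.
  have [eu _ _ _] := hu i; have [_ phie _ _] := hphi i'.
  by rewrite -phie -eu act_ee eqn_add2l (negPf ne) (functional0 (lphi _)).
elim: i iw => [//|i IHi] iw.
have [_ au bu _] := hu i; have [_ _ pa pb] := hphi i.
have {IHi} <- := IHi (ltnW iw).
have [up|up] := boolP (edge_up w i); first by have := pa (u i); rewrite au up.
have dn : edge_down w i by rewrite /edge_down iw.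
by have := pb (u i.+1); rewrite bu dn.
Qed.

Lemma string_map_pairing M N j w (u : nat -> M) (phi : nat -> M -> F) (u' : nat -> N)
    (phi' : nat -> N -> F) i m :
  string_in j w u -> string_out j w phi -> phi 0%N (u 0%N) = 1 ->
  string_in j w u' -> string_out j w phi' -> phi' 0%N (u' 0%N) = 1 ->
  (size w <= K)%N -> (i <= size w)%N -> phi' i (string_map phi u' m) = phi i m.
Proof.
move=> hu hphi pu hu' hphi' pu' wK iw.
have lphi k : functional (phi' k) by case: (hphi' k).
have iK : (i < K.+1)%N by rewrite ltnS (leq_trans iw).
rewrite /string_map.
rewrite (big_morph (phi' i) (fun u v => functionalD u v (lphi i)) (functional0 (lphi i))).
rewrite (bigD1 (Ordinal iK)) //= (functionalZ _ _ (lphi i)).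
rewrite (string_pairing _ hu' hphi' pu') // eqxx mulr1 big1 ?addr0 // => k ki.
rewrite (functionalZ _ _ (lphi i)).
have [kw|kw] := leqP k (size w).
  rewrite (string_pairing _ hu' hphi' pu') // eq_sym (_ : (k == i :> nat) = false) ?mulr0 //.
  by apply: contra_neqF ki => /eqP ki; apply: val_inj.
by have [_ _ _ ->] := hu' k; rewrite ?(functional0 (lphi _)) ?mulr0.
Qed.

Lemma string_type_linked j w M N : (size w <= K)%N ->
  string_type j w M -> string_type j w N -> linked M N.
Proof.
move=> wK [u [phi [xM [hu bu0] hphi pa pu]]] [v [psi [xN [hv bv0] hpsi sa sv]]].
exists (string_map phi v), (string_map psi u); split.
- exact: string_map_morphism hphi _.
- exact: string_map_morphism hpsi _.
- move=> m; apply: eq_bigr => i _.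
  have [iw|iw] := leqP i (size w); last by have [_ _ _ ->] := hv i; rewrite ?scaler0.
  rewrite (string_map_pairing (j := j) (w := w) (u := v) (phi := psi)) //.
  by rewrite (string_map_pairing (j := j) (w := w) (u := u) (phi := phi)).
- move=> m; apply: eq_bigr => i _.
  have [iw|iw] := leqP i (size w); last by have [_ _ _ ->] := hu i; rewrite ?scaler0.
  rewrite (string_map_pairing (j := j) (w := w) (u := u) (phi := phi)) //.
  by rewrite (string_map_pairing (j := j) (w := w) (u := v) (phi := psi)).
have [eu0 _ _ _] := hu 0%N.
exists (j + 0)%N, (u 0%N); split=> //; last first.
  move=> u0; move: pu; rewrite u0 functional0; last by case: (hphi 0%N).
  by move/eqP; rewrite eq_sym oner_eq0.
rewrite {1}/string_map big_ord_recl big1 => [|i _].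
  rewrite (string_map_pairing (j := j) (w := w) (u := u) (phi := phi)) //.
  by rewrite pu scal1 addr0.
have [iw|iw] := leqP (bump 0 i) (size w); last first.
  by have [_ _ _ ->] := hu (bump 0 i); rewrite ?scaler0.
rewrite (string_map_pairing (j := j) (w := w) (u := u) (phi := phi)) //.
by rewrite (string_pairing _ hu hphi pu) // scal0.
Qed.

(* The functorial filtration of [e j M]: [word_upper w j] consists of the vectors from which
   the string [w] can be followed to the right ([true] along [a], [false] against [b]), and
   [word_lower w j] is the preceding step of the filtration. *)
Fixpoint word_upper M (w : seq bool) (j : nat) (v : M) : Prop :=
  match w with
  | [::] => e j *: v = v /\ a *: v = 0
  | true :: w' => e j *: v = v /\ word_upper w' j.+1 (a *: v)
  | false :: w' => exists2 u, word_upper w' j.+1 u & v = b *: u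
  end.

Fixpoint word_lower M (w : seq bool) (j : nat) (v : M) : Prop :=
  match w with
  | [::] => exists2 u, e j.+1 *: u = u & v = b *: u
  | true :: w' => e j *: v = v /\ word_lower w' j.+1 (a *: v)
  | false :: w' => exists2 u, word_lower w' j.+1 u & v = b *: u
  end.

Lemma word_upper_e M w j (v : M) : word_upper w j v -> e j *: v = v.
Proof.
elim: w j v => [|[] w IHw] j v /= => [[]//|[]//|[u /IHw eu ->]].
by rewrite -act_be eu.
Qed.

Lemma word_lower_e M w j (v : M) : word_lower w j v -> e j *: v = v.
Proof.
elim: w j v => [|[] w IHw] j v /= => [[u eu ->]|[]//|[u /IHw eu ->]];
by rewrite -act_be eu.
Qed.

Lemma word_lower_subspace M w j : subspace (word_lower (M := M) w j).
Proof.
elim: w j => [|[] w IHw] j /=.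
- split; first by exists 0; rewrite ?scaler0.
  move=> c u v [u' eu ->] [v' ev ->]; exists (c *:: u' + v').
    by rewrite scalerDr scal_comm eu ev.
  by rewrite scalerDr scal_comm.
- have [w0 wlin] := IHw j.+1; split; first by rewrite !scaler0.
  move=> c u v [eu wu] [ev wv]; rewrite !scalerDr !scal_comm eu ev; split=> //.
  exact: wlin.
- have [w0 wlin] := IHw j.+1; split; first by exists 0; rewrite ?scaler0.
  move=> c u v [u' wu ->] [v' wv ->]; exists (c *:: u' + v'); first exact: wlin.
  by rewrite scalerDr scal_comm.
Qed.

(** * Following strings when the loops act as zero *)

Section XZero.
Variable M : lmodType A.
Hypothesis x0 : forall m : M, x *: m = 0.

Lemma ba_zero s (v : M) : e s *: v = v -> b *: (a *: v) = 0.
Proof.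
move=> ev; have [c _ [h|[h _]]] := zz_ba_or s.
  by rewrite (ba_v ev h) x0 scaler0.
by rewrite -ev [a *: _]scalerA h scale0r scaler0.
Qed.

Lemma ab_zero s (v : M) : e s *: v = v -> a *: (b *: v) = 0.
Proof.
move=> ev; have [c _ [h|[h _]]] := zz_ab_or s.
  by rewrite (ab_v ev h) x0 scaler0.
by rewrite -ev [b *: _]scalerA h scale0r scaler0.
Qed.

Lemma word_upper_string w j (v : M) : word_upper w j v ->
  exists2 u : nat -> M, u 0%N = v & string_in j w u.
Proof.
elim: w j v => [|[] w IHw] j v.
- move=> /= [ev av]; exists (fun i => if i is 0 then v else 0) => // -[|i].
    by rewrite addn0 /edge_up /edge_down /=; split=> //; rewrite scaler0.
  by rewrite /edge_up /edge_down /= ?nth_nil !scaler0; split.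
- move=> [ev /IHw[u u0 hu]]; exists (fun i => if i is i'.+1 then u i' else v) => // -[|i].
    by rewrite addn0; split=> //; rewrite u0 (ba_zero ev).
  by have [h1 h2 h3 h4] := hu i; rewrite addnS -addSn.
- move=> hv; have ev := word_upper_e hv; move: hv => [y wy vy].
  have [u u0 hu] := IHw _ _ wy.
  exists (fun i => if i is i'.+1 then u i' else v) => // -[|i].
    rewrite addn0; split=> //; last by rewrite /edge_down /= u0.
    by rewrite /edge_up /= vy (ab_zero (word_upper_e wy)).
  by have [h1 h2 h3 h4] := hu i; rewrite addnS -addSn.
Qed.

(** Dual to [word_upper_string]. At a downward edge the next functional is [phi (b m)]; at an upward
    edge it is a solution of [psi (a m) = phi m], chosen to vanish on the next lower subspace. *)
Lemma word_lower_string w j (phi : M -> F) : fin_dim M ->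
  functional phi -> (forall m, phi (e j *: m) = phi m) ->
  (forall v, word_lower w j v -> phi v = 0) ->
  exists2 psi : nat -> M -> F, psi 0%N = phi & string_out j w psi.
Proof.
move=> fM; elim: w j phi => [|[] w IHw] j phi lphi phie phiw.
- exists (fun i => if i is 0 then phi else fun=> 0) => // -[|i].
    rewrite addn0 /edge_up /edge_down /=; split=> // m.
    by rewrite -phie -act_be; apply: phiw; exists (e j.+1 *: m) => //; rewrite act_ee eqxx.
  by rewrite /edge_up /edge_down /= ?nth_nil; split=> // c u v; rewrite mulr0 addr0.
- have lower_e u : word_lower w j.+1 (a *: u) -> phi u = 0.
    move=> wu; rewrite -phie; apply: phiw; split; first by rewrite act_ee eqxx.
    by rewrite act_ae (word_lower_e wu).
  have [psi0 lpsi0 [psi0a psi0w]] :=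
    factor_functional fM (word_lower_subspace M w j.+1) lphi lower_e.
  pose psi m := psi0 (e j.+1 *: m).
  have psia m : psi (a *: m) = phi m by rewrite /psi -act_ae psi0a phie.
  have lpsi : functional psi by exact: functional_comp.
  have psie m : psi (e j.+1 *: m) = psi m by rewrite /psi act_ee eqxx.
  have [|chi chi0 hchi] := IHw _ _ lpsi psie.
    by move=> v wv; rewrite /psi (word_lower_e wv) psi0w.
  exists (fun i => if i is i'.+1 then chi i' else phi) => // -[|i].
    rewrite addn0 chi0; split=> // m.
    rewrite -phie -act_be -psia (ab_zero (s := j.+1)) ?(functional0 lpsi) //.
    by rewrite act_ee eqxx.
  by have [h1 h2 h3 h4] := hchi i; rewrite addnS -addSn.
- have lpsi : functional (fun m => phi (b *: m)) by exact: functional_comp.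
  have [m|v wv|chi chi0 hchi] := IHw j.+1 _ lpsi.
  + by rewrite act_be phie.
  + by apply: phiw; exists v.
  exists (fun i => if i is i'.+1 then chi i' else phi) => // -[|i].
    rewrite addn0 chi0; split=> // m; rewrite /edge_up /=.
    rewrite -phie -act_be -act_ae (ba_zero (s := j)) ?(functional0 lphi) //.
    by rewrite act_ee eqxx.
  by have [h1 h2 h3 h4] := hchi i; rewrite addnS -addSn.
Qed.

(** At each vertex the image of [b] lies in the kernel of [a], and both pieces are refined at the
    next vertex: words through [false] come first, then the empty word, then words through [true].
    The set [S] is followed to the first step that it meets. A set is needed rather than a vector,
    because the recursion takes preimages under [b] and images under [a]. *)
Lemma word_jump (d j : nat) (S : M -> Prop) : (j + d = K)%N ->
  (forall v, S v -> e j *: v = v) -> (exists v, S v) -> ~ S 0 ->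
  exists w, [/\ (size w <= d)%N, exists2 v, S v & word_upper w j v
    & forall v, S v -> ~ word_lower w j v].
Proof.
elim: d j S => [|d IHd] j S jN Se [v0 Sv0] nS0.
  have {}jN : j = K by rewrite -jN addn0.
  have large (v : M) : e j.+1 *: v = 0 by rewrite act_e_large // jN.
  exists [::]; split=> //.
    by exists v0 => //; split; [exact: Se | rewrite -(Se _ Sv0) act_ae large].
  by move=> v Sv [u]; rewrite large => <- v0'; apply: nS0; rewrite -[0](scaler0 _ b) -v0'.
have jN' : (j.+1 + d = K)%N by rewrite addSnnS.
have [[u eu Su]|nb] := pselect (exists2 u, e j.+1 *: u = u & S (b *: u)).
  have [|||w [wd [v [ev Sv] wv] nw]] := IHd j.+1 (fun u => e j.+1 *: u = u /\ S (b *: u)) jN'.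
  - by move=> v [].
  - by exists u.
  - by rewrite !scaler0 => -[_ /nS0].
  exists (false :: w); split=> //; first by exists (b *: v) => //; exists v.
  by move=> v' Sv' [y wy vy]; apply: (nw y) => //; split; [exact: word_lower_e wy | rewrite -vy].
have [[u Su au]|na] := pselect (exists2 u, S u & a *: u = 0).
  exists [::]; split=> //; first by exists u => //; split=> //; apply: Se.
  by move=> v Sv [y ey vy]; apply: nb; exists y => //; rewrite -vy.
have [|||w [wd [v [u Su ->] wu] nw]] := IHd j.+1 (fun v => exists2 u, S u & v = a *: u) jN'.
- by move=> v [u Su ->]; rewrite -act_ae Se.
- by exists (a *: v0), v0.
- by case=> u Su /esym au; apply: na; exists u.
exists (true :: w); split=> //; first by exists u => //; split=> //; apply: Se.
by move=> v' Sv' [ev' wv']; apply: (nw (a *: v')) => //; exists v'.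
Qed.

End XZero.

(** A string has to fit between its first vertex and [K], so words of length at most [K] suffice and
    the type is finite. *)
Definition zigzag_type_index : finType := ('I_K.+1 + 'I_K.+1 * K.-bseq bool)%type.

Definition has_zigzag_type (t : zigzag_type_index) M : Prop :=
  match t with
  | inl s => projective_type s M
  | inr (j, w) => string_type j w M
  end.

Lemma zigzag_type_exists M : fin_dim M -> (exists s, exists2 v : M, e s *: v = v & v <> 0) ->
  exists t, has_zigzag_type t M.
Proof.
move=> fM [s0 [v0 ev0 nv0]].
have small s (v : M) : e s *: v = v -> v <> 0 -> (s < K.+1)%N.
  by move=> ev nv; rewrite ltnS leqNgt; apply/negP => h; apply: nv; rewrite -ev act_e_large.
have [[s [m xm]]|nx] := pselect (exists s, exists m : M, x *: (e s *: m) <> 0).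
  have ne : e s *: m <> 0 by move=> h; apply: xm; rewrite h scaler0.
  have em : e s *: (e s *: m) = e s *: m by rewrite act_ee eqxx.
  exists (inl (Ordinal (small _ _ em ne))).
  (* As [x] squares to 0, the vector [x v] with [v = e s *: m] is not a multiple of [v], so some
     functional is 1 on it and 0 on [v]. *)
  have [||phi [lphi phi1 phi0]] :=
    @separate _ _ _ (fun u => exists c, u = c *:: (e s *: m)) (x *: (e s *: m)) fM.
  - split; first by exists 0; rewrite scal0.
    by move=> c u v [d ->] [d' ->]; exists (c * d + d'); rewrite scalA -scalerDl -rmorphD.
  - case=> c h; have := congr1 (fun u => x *: u) h; rewrite act_xx scal_comm.
    have [c0|c0] := eqVneq c 0; first by move: h; rewrite c0 scal0 => /xm.
    by move=> /(congr1 (fun u => c^-1 *:: u)); rewrite scaler0 scalA mulVf // scal1 => /esym /xm.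
  exists (fun u => phi (e s *: u)), (e s *: m); split=> //.
  + exact: functional_comp.
  + by move=> u; rewrite act_ee eqxx.
  + by rewrite -act_xe em.
  + by rewrite em; apply: phi0; exists 1; rewrite scal1.
have x0 (m : M) : x *: m = 0.
  rewrite {1}(zz_x_sum zz) -scalerA scaler_suml scaler_sumr big1 // => s _.
  by apply: contrapT => h; apply: nx; exists s, m.
pose P s := `[< exists2 v : M, e s *: v = v & v <> 0 >].
have exP : exists s, P s by exists s0; apply/asboolP; exists v0.
(* By minimality of [j] the vertex to its left carries no vector. This gives the two conditions at
   the left end of the string. *)
case: (ex_minnP exP) => j /asboolP [v ev nv] jmin.
have jK := small _ _ ev nv.
have low t (u : M) : (t < j)%N -> e t *: u = 0.
  move=> tj; apply: contrapT => nu; suff /jmin : P t by rewrite leqNgt tj.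
  by apply/asboolP; exists (e t *: u) => //; rewrite act_ee eqxx.
have [|||w [wK [_ -> wv] nw]] := word_jump (S := fun u => u = v) (subnKC (jK : (j <= K)%N)).
- by move=> _ ->.
- by exists v.
- by move=> /esym.
have [phi0 [lphi0 phi0v phi0w]] := separate fM (word_lower_subspace M w j) (nw v erefl).
have lphi : functional (fun m => phi0 (e j *: m)) by exact: functional_comp.
have [||psi psi0 hpsi] := word_lower_string (w := w) (j := j) x0 fM lphi.
- by move=> m; rewrite act_ee eqxx.
- by move=> u wu; rewrite (word_lower_e wu) phi0w.
have [u u0 hu] := word_upper_string x0 wv.
have wK' : (size w <= K)%N by rewrite (leq_trans wK) ?leq_subr.
exists (inr (Ordinal jK, Bseq wK')); exists u, psi; split=> //.
- split=> //; rewrite u0; case: (posnP j) => [j0|jpos].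
    by rewrite -ev j0 act_be0.
  by rewrite -ev -(prednK jpos) act_be low // prednK.
- move=> m; rewrite psi0; case: (posnP j) => [->|jpos].
    by rewrite act_e0a (functional0 lphi0).
  by rewrite -(prednK jpos) -act_ae low ?prednK // scaler0 (functional0 lphi0).
by rewrite psi0 u0 ev.
Qed.

Lemma zigzag_type_linked t M N : has_zigzag_type t M -> has_zigzag_type t N -> linked M N.
Proof.
case: t => [s|[j w]] /=; first exact: projective_type_linked.
exact: string_type_linked (size_bseq w).
Qed.

End ZigzagModules.

(** * Passing to a zigzag idempotent subalgebra *)

Section MatrixUnits.
Variables (F : fieldType) (A : pzAlgType F) (K : nat) (e : nat -> A) (x a b : A).
Hypothesis zz : zigzag K e x a b.

(* [q T * p T] are orthogonal idempotents with sum 1, each [p T] identifying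
   [q T * p T * M] with [e (s T) * M]. *)
Variables (I : finType) (s : I -> nat) (p q : I -> A) (G : A -> Prop).
Hypothesis pq : forall T T', p T * q T' = if T == T' then e (s T) else 0.
Hypothesis sum_qp : \sum_T q T * p T = 1.
Hypothesis s_onto : forall t, (t <= K)%N -> exists T, s T = t.
Hypothesis G_generates : forall S : A -> Prop, (forall z, G z -> S z) ->
  (forall c : F, S (scal c)) -> (forall y z, S y -> S z -> S (y + z)) ->
  (forall y z, S y -> S z -> S (y * z)) -> forall z, S z.
Hypothesis G_reduced : forall z, G z -> forall T T', exists c : F,
  exists2 y : A, y \in [:: 1; x; a; b] & p T * z * q T' = scal c * y * e (s T').
Implicit Types M N : lmodType A.

(** The Morita correspondence on morphisms: a vector is rebuilt from its coordinates [p T *: u],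
    each of which lies at a vertex. *)
Definition extension M N (f : M -> N) (u : M) : N := \sum_T q T *: f (p T *: u).

Lemma sum_qp_act M (u : M) : u = \sum_T q T *: (p T *: u).
Proof.
rewrite -[LHS]scale1r -sum_qp scaler_suml; apply: eq_bigr => T _.
by rewrite scalerA.
Qed.

Lemma p_inj M (u v : M) : (forall T, p T *: u = p T *: v) -> u = v.
Proof.
by move=> h; rewrite [u]sum_qp_act [v]sum_qp_act; apply: eq_bigr => T _; rewrite h.
Qed.

Lemma e_p T : e (s T) * p T = p T.
Proof.
rewrite -[RHS]mulr1 -sum_qp mulr_sumr (bigD1 T) //= mulrA pq eqxx big1 ?addr0 //.
by move=> T' /negPf ne; rewrite mulrA pq eq_sym ne mul0r.
Qed.

Section Extension.
Variables (M N : lmodType A) (f : M -> N).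
Hypothesis zf : zigzag_morphism e x a b f.

Lemma p_extension T u : p T *: extension f u = f (p T *: u).
Proof.
have [_ fe _ _ _] := zf.
rewrite /extension scaler_sumr (bigD1 T) //= scalerA pq eqxx -fe scalerA e_p.
by rewrite big1 ?addr0 // => T' /negPf ne; rewrite scalerA pq eq_sym ne scale0r.
Qed.

(** It is enough to treat generators [z]. Their matrix entries [p T * z * q T'] are multiples of
    elements with which [f] commutes. *)
Lemma extension_linear : linear (extension f).
Proof.
have [lf fe fx fa fb] := zf.
have eD u v : extension f (u + v) = extension f u + extension f v.
  rewrite /extension -big_split; apply: eq_bigr => T _ /=.
  by rewrite scalerDr (flinearD _ _ lf) scalerDr.
suff eZ z : forall u, extension f (z *: u) = z *: extension f u.
  by move=> z u v; rewrite eD eZ.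
elim/G_generates: z => [z Gz|c|y z hy hz|y z hy hz] u.
- rewrite /extension; under eq_bigr => T _ do rewrite {1}[u]sum_qp_act.
  transitivity (\sum_T \sum_T' q T *: ((p T * z * q T') *: f (p T' *: u))).
    apply: eq_bigr => T _; rewrite 2!scaler_sumr (flinear_sum _ _ _ lf) scaler_sumr.
    apply: eq_bigr => T' _; congr (_ *: _).
    have -> : p T *: (z *: (q T' *: (p T' *: u))) = (p T * z * q T') *: (p T' *: u).
      by rewrite !scalerA.
    have [c [y yP ->]] := G_reduced Gz T T'; rewrite -!scalerA (flinearZ _ _ lf).
    by move: yP; rewrite !inE => /or4P[] /eqP ->; rewrite ?scale1r ?fx ?fa ?fb fe.
  rewrite exchange_big /= scaler_sumr; apply: eq_bigr => T' _.
  rewrite [RHS]sum_qp_act; apply: eq_bigr => T _.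
  by rewrite !scalerA !mulrA.
- rewrite /extension scaler_sumr; apply: eq_bigr => T _.
  by rewrite scal_comm (flinearZ _ _ lf) scal_comm.
- by rewrite !scalerDl eD hy hz.
- by rewrite -!scalerA hy hz.
Qed.

End Extension.

(** The extended composites are nonzero idempotent endomorphisms of indecomposable modules, hence
    identities. That they are nonzero uses a [T] lying over the vertex of the common vector. *)
Lemma linked_iso M N : indecomposable M -> indecomposable N ->
  linked e x a b M N -> mod_iso M N.
Proof.
move=> iM iN [f [g [zf zg fgf gfg [t [v [ev gfv v0]]]]]].
have tK : (t <= K)%N.
  by rewrite leqNgt; apply/negP => tK; apply: v0; rewrite -ev (act_e_large zz).
have [T sT] := s_onto tK.
have pqv M' (w : M') : e t *: w = w -> p T *: (q T *: w) = w.
  by move=> ew; rewrite scalerA pq eqxx sT ew.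
have efv : e t *: f v = f v by have [_ fe _ _ _] := zf; rewrite -fe ev.
have gf1 : forall u, extension g (extension f u) = u.
  apply: (indecomposable_idempotent iM).
  - by move=> z u w; rewrite !(extension_linear zf, extension_linear zg).
  - by move=> u; apply: p_inj => T'; rewrite !p_extension // gfg.
  - exists (q T *: v); move/(congr1 (fun u => p T *: u)).
    by rewrite !p_extension // pqv // gfv scaler0.
have fg1 : forall u, extension f (extension g u) = u.
  apply: (indecomposable_idempotent iN).
  - by move=> z u w; rewrite !(extension_linear zf, extension_linear zg).
  - by move=> u; apply: p_inj => T'; rewrite !p_extension // fgf.
  - exists (q T *: f v); move/(congr1 (fun u => p T *: u)).
    rewrite !p_extension // pqv // fgf scaler0 => fv0; apply: v0.
    by rewrite -gfv fv0; have [lg _ _ _ _] := zg; rewrite (flinear0 lg).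
pose fM := GRing.isLinear.Build A M N _ _ (extension_linear zf).
pose fl : {linear M -> N} := HB.pack (extension f) fM.
by exists fl; exists (extension g).
Qed.

Theorem zigzag_finite_representation_type : finite_representation_type A.
Proof.
have typed M : fin_dim M -> indecomposable M ->
    exists t : zigzag_type_index K, has_zigzag_type e x a b t M.
  move=> fM [nz _]; apply: (zigzag_type_exists zz) => //.
  have [u u0] : exists u : M, u <> 0.
    by apply: contrapT => h; apply: nz => u; apply: contrapT => u0; apply: h; exists u.
  apply: contrapT => h; apply: u0; rewrite [u]sum_qp_act big1 // => T _.
  have -> : p T *: u = 0.
    apply: contrapT => pu; apply: h; exists (s T), (p T *: u) => //.
    by rewrite scalerA e_p.
  by rewrite scaler0.
(* If there is no finite-dimensional indecomposable module, the empty family serves; otherwise [M0]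
   fills the places of the types that no indecomposable module has. *)
have [[M0 _]|none] := pselect (exists M : lmodType A, fin_dim M /\ indecomposable M); last first.
  exists 0%N, (fun i : 'I_0 => False_rect _ (elimF idP (ltn0 i) (ltn_ord i))) => M fM iM.
  by case: none; exists M.
have /boolp.choice[N hN] : forall t : zigzag_type_index K, exists N : lmodType A,
    forall M, indecomposable M -> has_zigzag_type e x a b t M -> mod_iso M N.
  move=> t; have [[N [iN tN]]|none] :=
    pselect (exists N, indecomposable N /\ has_zigzag_type e x a b t N).
    by exists N => M iM tM; apply: linked_iso => //; apply: (zigzag_type_linked zz tM tN).
  by exists M0 => M iM tM; case: none; exists M.
exists #|zigzag_type_index K|, (fun i => N (enum_val i)) => M fM iM.
have [t tM] := typed _ fM iM.
by exists (enum_rank t); rewrite enum_rankK; apply: hN.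
Qed.

End MatrixUnits.

(** * Nonzero words *)

Definition near (i j : nat) : bool := (j == i.+1) || (i == j.+1).
Definition far (i j : nat) : bool := (i.+1 < j)%N || (j.+1 < i)%N.

(* The relations of the block, with words over {0, ..., K+1} in place of tuples of
   simple roots and with generators indexed by all natural numbers, those out of range
   being [0]. *)
Record klr_words (F : fieldType) (A : pzAlgType F) (K : nat) (E : seq nat -> A)
    (X Psi : nat -> A) : Prop := KlrWords {
  kw_EE : forall w w', E w * E w' = if w == w' then E w else 0;
  kw_size : forall w, size w != K.*2.+2 -> E w = 0;
  kw_letter : forall w i, i \in w -> (K.+1 < i)%N -> E w = 0;
  kw_sumn : forall w, sumn w != (K.+1 ^ 2)%N -> E w = 0;
  kw_total : forall z, (forall w, z * E w = 0) -> z = 0;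
  kw_XE : forall r w, X r * E w = E w * X r;
  kw_PsiE : forall u i j v,
    Psi (size u) * E (u ++ i :: j :: v) = E (u ++ j :: i :: v) * Psi (size u);
  kw_PsiX : forall r s, s != r -> s != r.+1 -> Psi r * X s = X s * Psi r;
  kw_PsiPsi : forall r s, (r.+1 < s)%N -> Psi r * Psi s = Psi s * Psi r;
  kw_XPsi : forall u i j v, X (size u) * Psi (size u) * E (u ++ i :: j :: v) =
    (Psi (size u) * X (size u).+1 - (i == j)%:R) * E (u ++ i :: j :: v);
  kw_XPsiS : forall u i j v, X (size u).+1 * Psi (size u) * E (u ++ i :: j :: v) =
    (Psi (size u) * X (size u) + (i == j)%:R) * E (u ++ i :: j :: v);
  kw_psi2_eq : forall u i v, Psi (size u) * Psi (size u) * E (u ++ i :: i :: v) = 0;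
  kw_psi2_far : forall i j, far i j -> exists2 t : F, t != 0 & forall u v,
    Psi (size u) * Psi (size u) * E (u ++ i :: j :: v) = scal t * E (u ++ i :: j :: v);
  kw_psi2_near : forall i j, near i j -> exists2 t : F, t != 0 & forall u v,
    X (size u) * E (u ++ i :: j :: v) = 0 ->
    Psi (size u) * Psi (size u) * E (u ++ i :: j :: v) =
      scal t * X (size u).+1 ^+ (if (i == 0)%N && (j == 1)%N then 2 else 1)
        * E (u ++ i :: j :: v);
  kw_braid : forall u i j k v, i != k ->
    Psi (size u).+1 * Psi (size u) * Psi (size u).+1 * E (u ++ i :: j :: k :: v) =
    Psi (size u) * Psi (size u).+1 * Psi (size u) * E (u ++ i :: j :: k :: v);
  kw_braid_near : forall i j, near i j -> exists2 t : F, t != 0 & forall u v,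
    (Psi (size u).+1 * Psi (size u) * Psi (size u).+1
      - Psi (size u) * Psi (size u).+1 * Psi (size u)) * E (u ++ i :: j :: i :: v) =
    scal t * (if (i == 1)%N && (j == 0)%N then X (size u) + X (size u).+2 else 1)
      * E (u ++ i :: j :: i :: v);
  kw_cyclotomic : forall v, X 0%N * E (K :: v) = 0;
  kw_first : forall i v, i != K -> E (i :: v) = 0
}.

Section Words.
Variables (F : fieldType) (A : pzAlgType F) (K : nat) (E : seq nat -> A) (X Psi : nat -> A).
Hypothesis kw : klr_words K E X Psi.

Lemma scal_eq0 (t : F) (z : A) : t != 0 -> scal t * z = 0 -> z = 0.
Proof.
by move=> t0 /(congr1 ( *%R (scal t^-1))); rewrite mulrA -rmorphM mulVf // rmorph1 mul1r mulr0.
Qed.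

Lemma scal_pull (t : F) (y z : A) : y * (scal t * z) = scal t * (y * z).
Proof. by rewrite mulrA -scalC -mulrA. Qed.

(* A path is the list of its steps, the last one first.  A box is added to the first
   (resp. second) column of a two-column Young diagram by [false] (resp. [true]), and
   [letter a b] gives the residue of this box when the columns have lengths [a] and [b]. *)
Definition letter (a b : nat) (x : bool) : nat :=
  if x then (K.+1 - b)%N else ((K - a) + (a - K))%N.

Notation firsts := (count negb).
Notation seconds := (count id).

Fixpoint word (P : seq bool) : seq nat :=
  if P is x :: P' then rcons (word P') (letter (firsts P') (seconds P') x) else [::].

Fixpoint valid (P : seq bool) : bool :=
  if P is x :: P' then (x ==> (seconds P' < firsts P')%N) && valid P' else true.

(** The tableau filled column by column. As paths list their last step first, the second column
    stands in front. *)
Definition colpath (a b : nat) : seq bool := nseq b true ++ nseq a false.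

Arguments colpath : simpl never.

Lemma size_step (T : Type) (x : T) P : size (x :: P) = (size P).+1. Proof. by []. Qed.

Lemma size_word P : size (word P) = size P.
Proof. by elim: P => //= x P IH; rewrite size_rcons IH. Qed.

Lemma size_path P : size P = (firsts P + seconds P)%N.
Proof. by elim: P => //= -[] P /= ->; lia. Qed.

Lemma valid_le P : valid P -> (seconds P <= firsts P)%N.
Proof. by elim: P => //= x P IH /andP[h /IH]; case: x h => /=; lia. Qed.

Lemma firsts_colpath a b : firsts (colpath a b) = a.
Proof. by rewrite count_cat !count_nseq /= mul0n mul1n. Qed.

Lemma seconds_colpath a b : seconds (colpath a b) = b.
Proof. by rewrite count_cat !count_nseq /= mul0n mul1n addn0. Qed.

Lemma size_colpath a b : size (colpath a b) = (a + b)%N.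
Proof. by rewrite size_path firsts_colpath seconds_colpath. Qed.

Lemma valid_colpath a b : (b <= a)%N -> valid (colpath a b).
Proof.
elim: b => [|b IHb] ab; first by rewrite /colpath /=; elim: a {ab} => //=.
by rewrite /= firsts_colpath seconds_colpath ab IHb // ltnW.
Qed.

Definition path_counts := (firsts_colpath, seconds_colpath, size_colpath).

Fixpoint word_tail (L : seq bool) (a b : nat) : seq nat :=
  if L is x :: L' then rcons (word_tail L' a b) (letter (firsts L' + a) (seconds L' + b) x)
  else [::].

Lemma word_cat L P : word (L ++ P) = word P ++ word_tail L (firsts P) (seconds P).
Proof.
elim: L => [|x L IH] /=; first by rewrite cats0.
by rewrite IH !count_cat rcons_cat.
Qed.

Lemma firsts_step x P : firsts (x :: P) = (if x then firsts P else (firsts P).+1).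
Proof. by case: x. Qed.

Lemma seconds_step x P : seconds (x :: P) = (if x then (seconds P).+1 else seconds P).
Proof. by case: x. Qed.

Definition counts_step := (firsts_step, seconds_step, size_step).

Lemma word_cons x P v : word (x :: P) ++ v = word P ++ letter (firsts P) (seconds P) x :: v.
Proof. by rewrite /= cat_rcons. Qed.

Lemma valid_cat_swap L P :
  valid (L ++ false :: true :: P) -> valid (L ++ true :: false :: P).
Proof.
elim: L => [|x L IH] /=; first by move=> /andP[h ->]; rewrite andbT; lia.
by rewrite !count_cat /= => /andP[h /IH ->]; rewrite andbT; move: h; case: x => //=; lia.
Qed.

Lemma valid_cat L P : valid (L ++ P) -> valid P.
Proof. by elim: L => //= x L IH /andP[_ /IH]. Qed.

(** The bound is sharp: at size [K.*2] the two letters are neighbours. *)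
Lemma letter_far P : valid (true :: P) -> (size P < K.*2)%N ->
  far (letter (firsts P) (seconds P) true) (letter (firsts P) (seconds P) false).
Proof. by move=> /andP[/= h _]; rewrite size_path /far /letter; lia. Qed.

Lemma nseq_catr (T : Type) i (y : T) s : nseq i y ++ y :: s = nseq i.+1 y ++ s.
Proof. by elim: i => //= i ->. Qed.

(** Bubble sort: each exchange makes a first-column step earlier than a second-column step, which
    keeps the path valid and its shape unchanged. *)
Lemma sort_ind (Phi : seq bool -> Prop) P :
  (forall L P', valid (L ++ false :: true :: P') ->
    firsts (L ++ false :: true :: P') = firsts P ->
    seconds (L ++ false :: true :: P') = seconds P ->
    Phi (L ++ true :: false :: P') -> Phi (L ++ false :: true :: P')) ->
  valid P -> Phi (colpath (firsts P) (seconds P)) -> Phi P.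
Proof.
elim: P Phi => [|x P IH] Phi Phi_swap //= /andP[xP vP] Phi_can.
apply: (IH (fun P' => Phi (x :: P'))) => //.
  move=> L P' vL fL sL; apply: (Phi_swap (x :: L)); rewrite /= ?fL ?sL //.
  by rewrite xP.
case: x xP Phi_swap Phi_can => /= [_ _|_ Phi_swap]; first by rewrite add0n add1n.
have vle := valid_le vP; set a := firsts P in Phi_swap vle *; set b := seconds P in Phi_swap vle *.
rewrite add1n add0n => Phi_can.
(* The last first-column step moves back through the second column; it has passed [i] of the steps
   and [j] are still before it. *)
have step i j : (i + j = b)%N -> Phi (nseq i true ++ false :: colpath a j).
  elim: j i => [|j IHj] i ij.
    by move: Phi_can; rewrite /colpath -ij addn0.
  rewrite [colpath _ _]/=; apply: Phi_swap.
  - suff vL k : (k + j < b)%N -> valid (nseq k true ++ false :: true :: colpath a j).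
      by apply: vL; lia.
    elim: k => [|k IHk] kj /=.
      by rewrite !path_counts valid_colpath; lia.
    by rewrite IHk; [rewrite !count_cat !count_nseq /= !path_counts; lia | lia].
  - by rewrite count_cat count_nseq /= firsts_colpath; lia.
  - by rewrite count_cat count_nseq /= seconds_colpath; lia.
  - by rewrite nseq_catr; apply: IHj; lia.
exact: (step 0%N).
Qed.

(** * Relations that kill words or generators *)

Lemma far_sym i j : far i j = far j i. Proof. by rewrite /far orbC. Qed.
Lemma near_sym i j : near i j = near j i. Proof. by rewrite /near orbC. Qed.

Lemma kill_far u i j v : far i j -> E (u ++ j :: i :: v) = 0 -> E (u ++ i :: j :: v) = 0.
Proof.
move=> /(kw_psi2_far kw)[t t0 ht] h; apply: (scal_eq0 t0).
by rewrite -ht -mulrA (kw_PsiE kw) h mul0r mulr0.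
Qed.

Lemma X_far m u i j v : far i j -> ((size u).+2 <= m)%N ->
  (forall r, (r < m)%N -> X r * E (u ++ j :: i :: v) = 0) ->
  forall r, (r < m)%N -> X r * E (u ++ i :: j :: v) = 0.
Proof.
move=> fij um h r rm; have [t t0 ht] := kw_psi2_far kw fij.
apply: (scal_eq0 t0); rewrite -scal_pull -ht.
have ij : (i == j) = false by apply/negbTE; move: fij; rewrite /far; lia.
rewrite -[Psi _ * Psi _ * _]mulrA (kw_PsiE kw) !mulrA.
have ji : (j == i) = false by rewrite eq_sym.
have [->|ru] := eqVneq r (size u).
  have := kw_XPsi kw u j i v; rewrite ji subr0 => ->.
  by rewrite -(mulrA (Psi _) (X _)) h ?mulr0 ?mul0r //; lia.
have [->|ru'] := eqVneq r (size u).+1.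
  have := kw_XPsiS kw u j i v; rewrite ji addr0 => ->.
  by rewrite -(mulrA (Psi _) (X _)) h ?mulr0 ?mul0r //; lia.
by rewrite -(kw_PsiX kw) // -(mulrA (Psi _) (X _)) h // mulr0 mul0r.
Qed.

(** With [X (size u)] acting as 0, the nilHecke relations make [Psi] inverse to the next [X] on this
    word, although [Psi] squares to 0 there. *)
Lemma kill_equal u i v : X (size u) * E (u ++ i :: i :: v) = 0 -> E (u ++ i :: i :: v) = 0.
Proof.
move=> X0; have eqE := kw_PsiE kw u i i v.
have h1 : Psi (size u) * X (size u).+1 * E (u ++ i :: i :: v) = E (u ++ i :: i :: v).
  have := kw_XPsi kw u i i v; rewrite -mulrA eqE mulrA X0 mul0r eqxx mulrBl mul1r.
  by move/eqP; rewrite eq_sym subr_eq0 => /eqP.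
have h2 : X (size u).+1 * Psi (size u) * E (u ++ i :: i :: v) = E (u ++ i :: i :: v).
  by rewrite (kw_XPsiS kw) eqxx mulrDl -mulrA X0 mulr0 add0r mul1r.
have h3 : Psi (size u) * E (u ++ i :: i :: v) = 0.
  rewrite -h1 -!mulrA (kw_XE kw) !mulrA.
  by rewrite (kw_psi2_eq kw) mul0r.
by rewrite -h2 -mulrA h3 mulr0.
Qed.

(** [Psi] squared passes through a zero word. As the first variable acts as 0, only the pure power
    of the second one is left in the parameter; it is a square exactly at the double bond seen from
    letter 0. *)
Lemma X_near u i j v : near i j -> X (size u) * E (u ++ i :: j :: v) = 0 ->
  E (u ++ j :: i :: v) = 0 ->
  X (size u).+1 ^+ (if (i == 0)%N && (j == 1)%N then 2 else 1) * E (u ++ i :: j :: v) = 0.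
Proof.
move=> /(kw_psi2_near kw)[t t0 ht] X0 h; apply: (scal_eq0 t0).
by rewrite mulrA -ht // -mulrA (kw_PsiE kw) h mul0r mulr0.
Qed.

Lemma kill_braid u i j v : near i j -> ~~ ((i == 1)%N && (j == 0)%N) ->
  E (u ++ i :: i :: j :: v) = 0 -> E (u ++ j :: i :: i :: v) = 0 ->
  E (u ++ i :: j :: i :: v) = 0.
Proof.
move=> nij nij0 h1 h2; have [t t0 ht] := kw_braid_near kw nij.
apply: (scal_eq0 t0); have := ht u v; rewrite (negPf nij0) mulr1 => <-.
have e1 := kw_PsiE kw (rcons u i) j i v; rewrite !cat_rcons size_rcons in e1.
have e2 := kw_PsiE kw u i j (i :: v).
by rewrite mulrBl -!mulrA e1 e2 h1 h2 !mul0r !mulr0 subrr.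
Qed.

(** At the double bond the divided difference is a sum of two [X] and not a constant, so the braid
    relation kills an [X] instead of the word. This covers the letters 1, 0, 1, where [X_near] would
    only give a square. *)
Lemma X_braid u v : E (u ++ 1%N :: 1%N :: 0%N :: v) = 0 -> E (u ++ 0%N :: 1%N :: 1%N :: v) = 0 ->
  X (size u) * E (u ++ 1%N :: 0%N :: 1%N :: v) = 0 ->
  X (size u).+2 * E (u ++ 1%N :: 0%N :: 1%N :: v) = 0.
Proof.
move=> h1 h2 X0; have [t t0 ht] := kw_braid_near kw (isT : near 1 0).
apply: (scal_eq0 t0); have := ht u v; rewrite /= -[RHS]mulrA [X in _ = _ * X]mulrDl X0 add0r => <-.
have e1 := kw_PsiE kw (rcons u 1%N) 0%N 1%N v; rewrite !cat_rcons size_rcons in e1.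
have e2 := kw_PsiE kw u 1%N 0%N (1%N :: v).
by rewrite mulrBl -!mulrA e1 e2 h1 h2 !mul0r !mulr0 subrr.
Qed.

(** Up to this length an exchange takes place after fewer than [K.*2] steps, so it swaps far letters
    and preserves vanishing in both directions. *)
Lemma dead_colpath P v : valid P -> (size P <= K.*2.+1)%N ->
  (E (word P ++ v) = 0) <-> (E (word (colpath (firsts P) (seconds P)) ++ v) = 0).
Proof.
move=> vP sP.
pose Phi Q := (E (word Q ++ v) = 0) <-> (E (word (colpath (firsts P) (seconds P)) ++ v) = 0).
apply: (sort_ind (Phi := Phi)) => // L P' vL fL sL; rewrite /Phi => <-.
have sizeP : size P = ((size L) + (size P').+2)%N.
  by rewrite size_path -fL -sL !count_cat /= (size_path L) (size_path P'); lia.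
have fr : far (letter (firsts P') (seconds P') true) (letter (firsts P') (seconds P') false).
  apply: letter_far; first exact: valid_cat vL.
  by lia.
rewrite !word_cat /= !cat_rcons -!catA /= ?cat_rcons.
by split; apply: kill_far; rewrite // far_sym.
Qed.

Lemma X_colpath P v : valid P -> (size P <= K.*2.+1)%N ->
  (forall r, (r < size P)%N -> X r * E (word (colpath (firsts P) (seconds P)) ++ v) = 0) ->
  forall r, (r < size P)%N -> X r * E (word P ++ v) = 0.
Proof.
move=> vP sP Xcan.
pose Phi Q := forall r, (r < size P)%N -> X r * E (word Q ++ v) = 0.
apply: (sort_ind (Phi := Phi)) => // L P' vL fL sL; rewrite /Phi => h.
have sizeP : size P = ((size L) + (size P').+2)%N.
  by rewrite size_path -fL -sL !count_cat /= (size_path L) (size_path P'); lia.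
have fr : far (letter (firsts P') (seconds P') true) (letter (firsts P') (seconds P') false).
  apply: letter_far; first exact: valid_cat vL.
  by lia.
move: h; rewrite !word_cat /= !cat_rcons -!catA /= ?cat_rcons => h.
by apply: X_far => //; rewrite size_word sizeP; lia.
Qed.

Lemma X_far_last u i j v : far i j -> X (size u) * E (u ++ j :: i :: v) = 0 ->
  X (size u).+1 * E (u ++ i :: j :: v) = 0.
Proof.
move=> fij h; have [t t0 ht] := kw_psi2_far kw fij.
apply: (scal_eq0 t0); rewrite -scal_pull -ht.
rewrite -[Psi _ * Psi _ * _]mulrA (kw_PsiE kw) !mulrA.
have ji : (j == i) = false by apply/negbTE; move: fij; rewrite /far; lia.
have := kw_XPsiS kw u j i v; rewrite ji addr0 => ->.
by rewrite -(mulrA (Psi _) (X _)) h mulr0 mul0r.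
Qed.

Definition allowed (a b i : nat) : bool :=
  (i == letter a b false) || ((b < a)%N && (i == letter a b true)).

(* Any path of the shape [(a, b)] may be used, as rearranging it only swaps far letters.  One
   is chosen after which a forbidden letter [i] follows [i], or [j] far from [i], or [i] and
   [j] near [i]; the quadratic relations or the braid relation then kill the word. *)
Lemma words_vanish m :
  (forall a b, (b <= a)%N -> (a + b = m)%N -> (m <= K.*2.+1)%N ->
     forall v r, (r < m)%N -> X r * E (word (colpath a b) ++ v) = 0) /\
  (forall a b, (b <= a)%N -> (a + b = m)%N -> (m <= K.*2)%N ->
     forall i v, (i <= K.+1)%N -> ~~ allowed a b i -> E (word (colpath a b) ++ i :: v) = 0).
Proof.
elim/ltn_ind: m => m IH.
have Xp P v r : valid P -> (size P < m)%N -> (size P <= K.*2.+1)%N -> (r < size P)%N ->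
    X r * E (word P ++ v) = 0.
  move=> vP Pm PK; apply: X_colpath => //; apply: (proj1 (IH _ Pm)) => //.
    exact: valid_le.
  by rewrite size_path.
have Zp P i v : valid P -> (size P < m)%N -> (size P <= K.*2)%N -> (i <= K.+1)%N ->
    ~~ allowed (firsts P) (seconds P) i -> E (word P ++ i :: v) = 0.
  move=> vP Pm PK iK na; apply/dead_colpath => //; first exact: leqW.
  apply: (proj2 (IH _ Pm)) => //; first exact: valid_le.
  by rewrite size_path.
have Xlast x Q v : valid (x :: Q) -> (size Q).+1 = m -> (m <= K.*2.+1)%N ->
    X (size (word Q)) * E (word Q ++ letter (firsts Q) (seconds Q) x :: v) = 0 ->
    forall r, (r < m)%N -> X r * E (word (x :: Q) ++ v) = 0.
  move=> vQ sQ mK h r rm; rewrite word_cons.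
  have [->|rQ] := eqVneq r (size (word Q)); first exact: h.
  by rewrite size_word in rQ; apply: Xp; [move: vQ => /= /andP[] | lia | lia | lia].
have Xnear x P i v : valid (x :: P) -> (size P).+2 = m -> (m <= K.*2.+1)%N -> (i <= K.+1)%N ->
    near (letter (firsts P) (seconds P) x) i ->
    ~~ ((letter (firsts P) (seconds P) x == 0%N) && (i == 1%N)) ->
    ~~ allowed (firsts P) (seconds P) i ->
    X (size (word (x :: P))) * E (word (x :: P) ++ i :: v) = 0.
  move=> vP sP mK iK nji ji na; have vP' : valid P by move: vP => /= /andP[].
  have -> : size (word (x :: P)) = (size (word P)).+1 by rewrite !size_word.
  rewrite word_cons; have := @X_near (word P) (letter (firsts P) (seconds P) x) i v nji.
  rewrite (negPf ji) expr1; apply; last by apply: Zp => //; lia.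
  by rewrite -word_cons; apply: Xp => //=; rewrite ?size_word; lia.
have Xm a b : (b <= a)%N -> (a + b = m)%N -> (m <= K.*2.+1)%N ->
    forall v r, (r < m)%N -> X r * E (word (colpath a b) ++ v) = 0.
  move=> ba abm mK v; have vab := valid_colpath ba.
  case: b ba abm vab => [_ am|[a1 am|b ba abm]] vab.
  - case: a am vab => [|[|a]] am vab; first by move=> r; lia.
      apply: (Xlast false (colpath 0 0)) => //.
      have -> : letter (firsts (colpath 0 0)) (seconds (colpath 0 0)) false = K.
        by rewrite !path_counts /letter; lia.
      exact: kw_cyclotomic kw v.
    apply: (Xlast false (colpath a.+1 0)) => //; first by rewrite path_counts; lia.
    rewrite !path_counts.
    (* For [a = K] the last two letters are 0 and 1. [X_near] would give only the square of [X], so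
       the braid relation on 1, 0, 1 is used. *)
    have [aK|aK] := eqVneq a K; last first.
      apply: (Xnear false (colpath a 0)); rewrite ?path_counts ?valid_colpath //;
        rewrite /near /allowed /letter; lia.
    case: a am aK vab => [|a] am aK vab; first by exfalso; lia.
    have l0 : letter a 0 false = 1%N by rewrite /letter; lia.
    have l1 : letter a.+1 0 false = 0%N by rewrite /letter; lia.
    have l2 : letter a.+2 0 false = 1%N by rewrite /letter; lia.
    have w1 t : word (colpath a.+1 0) ++ t = word (colpath a 0) ++ 1%N :: t.
      by rewrite -[colpath a.+1 0]/(false :: colpath a 0) word_cons !path_counts l0.
    rewrite -[colpath a.+2 0]/(false :: colpath a.+1 0) word_cons !path_counts l1 l2 w1.
    have -> : size (word (false :: colpath a.+1 0)) = (size (word (colpath a 0))).+2.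
      by rewrite !size_word /= !path_counts.
    apply: X_braid.
    + rewrite -w1; apply: Zp; rewrite ?path_counts ?valid_colpath //; try lia.
      by rewrite /allowed /letter; lia.
    + apply: Zp; rewrite ?path_counts ?valid_colpath //; try lia.
      by rewrite /allowed /letter; lia.
    + by rewrite -w1; apply: Xp; rewrite ?size_word ?path_counts ?valid_colpath //; lia.
  (* The second column opens with the letter [K.+1]. After at least two boxes of the first column it
     is far from the letter before it and can be moved one place back, into the range of the
     induction. *)
  - apply: (Xlast true (colpath a 0)) => //; first by rewrite path_counts; lia.
    rewrite !path_counts; case: a a1 am vab => [//|a] _ am vab.
    case: a am vab => [|a] am vab.
      apply: (Xnear false (colpath 0 0)); rewrite ?path_counts //;
        rewrite /near /allowed /letter; lia.
    have -> : size (word (colpath a.+2 0)) = (size (word (colpath a.+1 0))).+1.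
      by rewrite !size_word !path_counts.
    rewrite -[colpath a.+2 0]/(false :: colpath a.+1 0) word_cons !path_counts.
    apply: X_far_last; first by rewrite /far /letter; lia.
    have := @Xp (true :: colpath a.+1 0) (letter a.+1 0 false :: v) (size (word (colpath a.+1 0))).
    rewrite word_cons !path_counts -/(letter _ _ true).
    have -> : letter a.+1 0 true = letter a.+2 0 true by [].
    have vt : valid (true :: colpath a.+1 0) by exact: (@valid_colpath a.+1 1).
    by apply=> //; rewrite size_step ?size_word !path_counts; lia.
  - apply: (Xlast true (colpath a b.+1)) => //; first by rewrite path_counts; lia.
    rewrite !path_counts; apply: (Xnear true (colpath a b));
      rewrite ?path_counts ?(valid_colpath (b := b.+1)) //; rewrite /near /allowed /letter; lia.
split=> // a b ba abm mK i v iK na.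
have Xm' P w r : valid P -> size P = m -> (r < m)%N -> X r * E (word P ++ w) = 0.
  move=> vP sP rm; apply: X_colpath; rewrite ?sP //; first by lia.
  apply: Xm => //; rewrite -?size_path //; [exact: valid_le | lia].
have Zeq x P w : valid (x :: P) -> (size P).+1 = m ->
    E (word (x :: P) ++ letter (firsts P) (seconds P) x :: w) = 0.
  move=> vP sP; rewrite word_cons; apply: kill_equal; rewrite -word_cons.
  by apply: Xm' => //; rewrite size_word -sP.
have Zfar x P w : valid (x :: P) -> (size P).+1 = m ->
    far (letter (firsts P) (seconds P) x) i ->
    ~~ allowed (firsts P) (seconds P) i -> E (word (x :: P) ++ i :: w) = 0.
  move=> vP sP fji naP; rewrite word_cons; apply: kill_far => //.
  by apply: Zp => //; [move: vP => /= /andP[] | lia | lia].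
have Zbraid x y P w : valid (y :: x :: P) -> (size P).+2 = m ->
    letter (firsts P) (seconds P) x = i ->
    let j := letter (firsts (x :: P)) (seconds (x :: P)) y in
    near i j -> ~~ ((i == 1%N) && (j == 0%N)) -> (j <= K.+1)%N ->
    ~~ allowed (firsts P) (seconds P) j -> ~~ allowed (firsts (x :: P)) (seconds (x :: P)) i ->
    E (word (y :: x :: P) ++ i :: w) = 0.
  move=> vP sP xi j nij ij jK na1 na2; rewrite word_cons -/j word_cons xi.
  have [vP1 vP2] : valid P /\ valid (x :: P) by move: vP => /= /and3P[_ -> ->].
  apply: kill_braid => //; last by apply: Zp => //; lia.
  by rewrite -xi -word_cons xi; apply: Zp => //=; lia.
suff [P [vP fP sP dP]] : exists P,
    [/\ valid P, firsts P = a, seconds P = b & E (word P ++ i :: v) = 0].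
  by have := @dead_colpath P (i :: v) vP; rewrite fP sP => -[|h _];
    rewrite ?h // size_path fP sP; lia.
have [ab|ab] := ltnP b a.
  case: a ab ba abm na => [//|a] ab ba abm na.
  have vP : valid (false :: colpath a b) by rewrite /= valid_colpath.
  have [iy|iy] := eqVneq i (letter a b false).
    exists (false :: colpath a b); split; rewrite ?counts_step ?path_counts //.
    by have := Zeq false (colpath a b) v vP; rewrite !path_counts -iy; apply; lia.
  have [fi|fi] := boolP (far (letter a b false) i).
    exists (false :: colpath a b); split; rewrite ?counts_step ?path_counts //.
    apply: Zfar; rewrite ?path_counts //.
    by move: mK iK abm na iy; clear; rewrite /allowed /letter; lia.
  case: a ab ba abm na vP iy fi => [|a] ab ba abm na vP iy fi.
    by exfalso; move: mK iK abm ab na iy fi; clear; rewrite /allowed /far /letter; lia.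
  have ba' : (b <= a)%N by move: mK iK abm ab na iy fi; clear; rewrite /allowed /far /letter; lia.
  have vP' : valid (false :: false :: colpath a b) by exact: valid_colpath ba'.
  exists (false :: false :: colpath a b); split; rewrite ?counts_step ?path_counts //.
  apply: Zbraid; rewrite ?counts_step ?path_counts //;
    move: mK iK abm ab na iy fi; clear; rewrite /near /allowed /far /letter; lia.
have {ab ba} eab : b = a by lia.
case: a eab abm na => [|a] -> am na.
  exists [::]; split=> //; apply: (kw_first kw).
  by move: mK iK am na; clear; rewrite /allowed /letter; lia.
have vP : valid (true :: colpath a.+1 a) by exact: (@valid_colpath a.+1 a.+1).
have [iy|iy] := eqVneq i (letter a.+1 a true).
  exists (true :: colpath a.+1 a); split; rewrite ?counts_step ?path_counts //.
  by have := Zeq true (colpath a.+1 a) v vP; rewrite !path_counts -iy; apply; lia.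
have [fi|fi] := boolP (far (letter a.+1 a true) i).
  exists (true :: colpath a.+1 a); split; rewrite ?counts_step ?path_counts //.
  apply: Zfar; rewrite ?path_counts //; first lia.
  by move: mK iK am na iy; clear; rewrite /allowed /letter; lia.
(* Here [i] repeats the residue of the last box of the first column. Placing that box just before
   the last step produces the braid pattern. *)
have [i1|i1] := eqVneq i (K - a)%N.
  have vP' : valid (true :: false :: colpath a a).
    by rewrite /= !path_counts valid_colpath //; lia.
  exists (true :: false :: colpath a a); split; rewrite ?counts_step ?path_counts //.
  apply: Zbraid; rewrite ?counts_step ?path_counts //;
    move: mK iK am na iy fi i1; clear; rewrite /near /allowed /far /letter; lia.
case: a am na vP iy fi i1 => [|a] am na vP iy fi i1.
  by exfalso; move: mK iK am na iy fi i1; clear; rewrite /allowed /far /letter; lia.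
have vP' : valid (true :: true :: colpath a.+2 a) by exact: (@valid_colpath a.+2 a.+2).
exists (true :: true :: colpath a.+2 a); split; rewrite ?counts_step ?path_counts //.
apply: Zbraid; rewrite ?counts_step ?path_counts //;
  move: mK iK am na iy fi i1; clear; rewrite /near /allowed /far /letter; lia.
Qed.

(** * The zigzag algebra of the block *)

Lemma path_X P v r : valid P -> (size P <= K.*2.+1)%N -> (r < size P)%N ->
  X r * E (word P ++ v) = 0.
Proof.
move=> vP sP; move: r; apply: X_colpath => // r rP.
by apply: (proj1 (words_vanish (size P))); rewrite -?size_path //; apply: valid_le.
Qed.

Lemma path_dead P i v : valid P -> (size P <= K.*2)%N -> (i <= K.+1)%N ->
  ~~ allowed (firsts P) (seconds P) i -> E (word P ++ i :: v) = 0.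
Proof.
move=> vP sP iK na; apply/dead_colpath => //; first exact: leqW.
by apply: (proj2 (words_vanish (size P))) => //; rewrite -?size_path //; apply: valid_le.
Qed.

(** [z] makes the idempotents [E w] and [E w'] isomorphic. The inverse stays existential, as its
    explicit form is irrelevant later. *)
Definition word_iso (w w' : seq nat) (z : A) : Prop := z * E w = E w' * z /\
  exists R, [/\ R * E w' = E w * R, R * z * E w = E w & z * R * E w' = E w'].

Lemma word_iso1 w : word_iso w w 1.
Proof. by split; [rewrite mul1r mulr1 | exists 1; rewrite !mul1r mulr1]. Qed.

Lemma word_iso_mul w w' w'' y z : word_iso w w' y -> word_iso w' w'' z -> word_iso w w'' (z * y).
Proof.
move=> [yE [R [RE Ry yR]]] [zE [S [SE Sz zS]]]; split.
  by rewrite -mulrA yE mulrA zE mulrA.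
exists (R * S); split.
- by rewrite -mulrA SE mulrA RE mulrA.
- rewrite -!mulrA yE (mulrA z) (mulrA S) (mulrA S) Sz -yE mulrA.
  by rewrite Ry.
- rewrite -!mulrA SE (mulrA R) (mulrA y) (mulrA y) yR -SE mulrA.
  by rewrite zS.
Qed.

(** The scalars of [Psi] squared for [i j] and for [j i] come from separate statements. Evaluating
    the cube of [Psi] in two ways shows that they agree unless both words vanish, in which case 0 is
    an inverse. *)
Lemma word_iso_psi u i j v : far i j ->
  word_iso (u ++ i :: j :: v) (u ++ j :: i :: v) (Psi (size u)).
Proof.
move=> fij; have PE := kw_PsiE kw u i j v; split=> //.
have [t t0 ht] := kw_psi2_far kw fij.
have fji : far j i by rewrite far_sym.
have [t' t0' ht'] := kw_psi2_far kw fji.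
have [tt|tt] := eqVneq t t'; last first.
  have E0 : E (u ++ i :: j :: v) = 0.
    apply: (scal_eq0 (t := (t - t') * t)); first by rewrite mulf_neq0 ?subr_eq0.
    have h : scal t * (Psi (size u) * E (u ++ i :: j :: v)) =
             scal t' * (Psi (size u) * E (u ++ i :: j :: v)).
      by rewrite -scal_pull -ht [in RHS]PE [RHS]mulrA -ht' -!mulrA PE.
    rewrite rmorphM -mulrA -ht -[X in _ * X]mulrA rmorphB mulrBl -scal_pull h.
    by rewrite scal_pull subrr.
  have E0' : E (u ++ j :: i :: v) = 0 by apply: kill_far => //; rewrite far_sym.
  by exists 0; split; rewrite ?(E0, E0', mulr0, mul0r).
exists (scal t^-1 * Psi (size u)); split.
- by rewrite -mulrA (kw_PsiE kw) scal_pull.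
- by rewrite -!mulrA (mulrA (Psi _)) ht mulrA -rmorphM mulVf // rmorph1 mul1r.
- by rewrite scal_pull -mulrA ht' -tt mulrA -rmorphM mulVf // rmorph1 mul1r.
Qed.

(** Carries the letter at place [a + b] to place [a], past [b] letters of the second column. *)
Definition ins_elt (a b : nat) : A := \prod_(a <= r < a + b) Psi r.

Lemma ins_eltS a b : ins_elt a b.+1 = ins_elt a b * Psi (a + b)%N.
Proof. by rewrite /ins_elt addnS big_nat_recr // leq_addr. Qed.

Lemma ins_elt_X a b r : (a + b < r)%N -> ins_elt a b * X r = X r * ins_elt a b.
Proof.
elim: b => [|b IHb] abr; first by rewrite /ins_elt addn0 big_geq // mul1r mulr1.
rewrite ins_eltS -mulrA (kw_PsiX kw); [|lia|lia].
by rewrite !mulrA IHb //; lia.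
Qed.

Lemma ins_elt_Psi a b r : (a + b < r)%N -> ins_elt a b * Psi r = Psi r * ins_elt a b.
Proof.
elim: b => [|b IHb] abr; first by rewrite /ins_elt addn0 big_geq // mul1r mulr1.
rewrite ins_eltS -mulrA (kw_PsiPsi kw (s := r)); last lia.
by rewrite !mulrA IHb //; lia.
Qed.

Lemma ins_elt_iso a b v : (b <= a)%N -> (a + b <= K.*2)%N ->
  word_iso (word (false :: colpath a b) ++ v) (word (colpath a.+1 b) ++ v) (ins_elt a b).
Proof.
elim: b v => [|b IHb] v ba abK; first by rewrite /ins_elt addn0 big_geq //; apply: word_iso1.
rewrite ins_eltS.
have -> : word (colpath a.+1 b.+1) ++ v = word (colpath a.+1 b) ++ letter a b true :: v.
  by rewrite -[colpath a.+1 b.+1]/(true :: colpath a.+1 b) word_cons !path_counts.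
apply: (word_iso_mul _ (IHb (letter a b true :: v) _ _)); [|lia|lia].
rewrite -[colpath a b.+1]/(true :: colpath a b) !word_cons !counts_step !path_counts.
rewrite -(size_colpath a b) -size_word; apply: word_iso_psi.
have := @letter_far (colpath a b); rewrite !path_counts; apply; last lia.
by rewrite -[true :: _]/(colpath a b.+1) valid_colpath.
Qed.

Fixpoint sort_elt (P : seq bool) : A :=
  match P with
  | [::] => 1
  | true :: P' => sort_elt P'
  | false :: P' => ins_elt (firsts P') (seconds P') * sort_elt P'
  end.

Lemma sort_elt_iso P v : valid P -> (size P <= K.*2.+1)%N ->
  word_iso (word P ++ v) (word (colpath (firsts P) (seconds P)) ++ v) (sort_elt P).
Proof.
elim: P v => [|x P IH] v vP sP; first exact: word_iso1.
have vP' : valid P by move: vP => /= /andP[].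
have sP' : (size P <= K.*2.+1)%N by apply: leq_trans sP; rewrite /=.
have := IH (letter (firsts P) (seconds P) x :: v) vP' sP'; rewrite word_cons.
have -> : word (colpath (firsts P) (seconds P)) ++ letter (firsts P) (seconds P) x :: v =
    word (x :: colpath (firsts P) (seconds P)) ++ v by rewrite word_cons !path_counts.
case: x vP sP => vP sP; rewrite !counts_step //= => h.
by apply: word_iso_mul h _; apply: ins_elt_iso; [exact: valid_le | rewrite -size_path].
Qed.

Lemma sort_elt_X P r : (size P <= r)%N -> sort_elt P * X r = X r * sort_elt P.
Proof.
elim: P => [|[] P IH] /= Pr; first by rewrite mul1r mulr1.
  by apply: IH; apply: ltnW.
by rewrite -mulrA IH 1?ltnW // !mulrA ins_elt_X // -size_path.
Qed.

Lemma sort_elt_Psi P r : (size P <= r)%N -> sort_elt P * Psi r = Psi r * sort_elt P.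
Proof.
elim: P => [|[] P IH] /= Pr; first by rewrite mul1r mulr1.
  by apply: IH; apply: ltnW.
by rewrite -mulrA IH 1?ltnW // !mulrA ins_elt_Psi // -size_path.
Qed.

(** An exact identity of products, not one up to scalars: an exchange adds a single factor. This is
    what makes inner [Psi] act as matrix units. *)
Lemma sort_elt_swap L P :
  sort_elt (L ++ false :: true :: P) = sort_elt (L ++ true :: false :: P) * Psi (size P).
Proof.
elim: L => [|[] L IH] //=; last by rewrite IH !count_cat /= !mulrA.
rewrite add0n add1n ins_eltS -size_path -!mulrA; congr (_ * _).
by rewrite sort_elt_Psi.
Qed.

(** The two kinds of steps would have the same letter only if [a.+1 = b] or [a + b = K.*2.+1], and a
    last step within this length meets neither. *)
Lemma word_inj P P' : valid P -> valid P' -> (size P <= K.*2.+1)%N -> word P = word P' -> P = P'.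
Proof.
elim: P P' => [|x P IH] [|y P'] //= vP vP' sP.
- by move=> /(congr1 size); rewrite size_rcons.
- by move=> /(congr1 size); rewrite size_rcons.
move=> /rcons_inj [wP]; move: vP vP' => /andP[hx vP] /andP[hy vP'].
have PP' := IH P' vP vP' (ltnW sP) wP; subst P' => h; congr (_ :: _).
move: h hx hy; rewrite size_path in sP.
case: x y => [] [] //= h hx hy.
  by exfalso; move: h hx sP; rewrite /letter; clear; lia.
by exfalso; move: h hy sP; rewrite /letter; clear; lia.
Qed.

Lemma sumn_word P : sumn (word P) =
  (\sum_(i < firsts P) letter i 0 false + \sum_(i < seconds P) letter 0 i true)%N.
Proof.
elim: P => [|x P IH] /=; first by rewrite !big_ord0.
rewrite sumn_rcons IH; case: x; rewrite /= !(add0n, add1n) big_ord_recr /=.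
  by rewrite addnA.
by rewrite addnAC.
Qed.

(** The right-hand side is 0 + 2(1 + ... + K) + (K + 1), the letters counted with the multiplicities
    of the block. *)
Lemma sum_letters b : (b <= K)%N ->
  (\sum_(i < K.*2.+1 - b) letter i 0 false + \sum_(i < b) letter 0 i true + (K - b).+1
     = K.+1 ^ 2)%N.
Proof.
have low a : (a <= K)%N -> (2 * \sum_(i < a) letter i 0 false + a * a = a * (K.*2.+1))%N.
  elim: a => [|a IHa] aK; first by rewrite big_ord0.
  by have := IHa (ltnW aK); rewrite big_ord_recr /= /letter; nia.
have high s : (2 * \sum_(i < K.+1 + s) letter i 0 false + K * K = K * (K.*2.+1) + s * s.+1)%N.
  elim: s => [|s IHs].
    by have := low K (leqnn K); rewrite addn0 big_ord_recr /= /letter; nia.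
  rewrite addnS big_ord_recr mulnDr [LHS]addnAC IHs.
  have -> : letter (@ord_max (K.+1 + s)) 0 false = s.+1 by rewrite /letter /=; lia.
  by nia.
elim: b => [|b IHb] bK.
  by have := high K; rewrite subn0 big_ord0 -addnn addSn expnS expn1; nia.
have := IHb (ltnW bK); have -> : (K.*2.+1 - b = (K.*2.+1 - b.+1).+1)%N by lia.
have l1 : letter (K.*2.+1 - b.+1) 0 false = (K - b)%N by rewrite /letter; lia.
have l2 : letter 0 b true = (K.+1 - b)%N by [].
have recF n : (\sum_(i < n.+1) letter i 0 false = \sum_(i < n) letter i 0 false
    + letter n 0 false)%N by rewrite big_ord_recr.
have recT n : (\sum_(i < n.+1) letter 0 i true = \sum_(i < n) letter 0 i true
    + letter 0 n true)%N by rewrite big_ord_recr.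
by rewrite recF recT l1 l2; lia.
Qed.

(* A path of length 2K+1 with [b] steps to the second column is only prolonged by a
   letter [K - b + 1], by either of the two kinds of steps. *)
Definition full_word (P : seq bool) : seq nat := word P ++ [:: (K - seconds P).+1].

Lemma seconds_le P : valid P -> (size P <= K.*2.+1)%N -> (seconds P <= K)%N.
Proof. by move=> /valid_le; rewrite size_path; lia. Qed.

Lemma nonzero_path u v : (size u <= K.*2.+1)%N -> E (u ++ v) != 0 ->
  exists2 P, valid P & word P = u.
Proof.
elim/last_ind: u v => [|u i IH] v; first by exists [::].
rewrite size_rcons cat_rcons => su Euv.
have [P vP Pu] := IH _ (ltnW su) Euv.
have sP : (size P <= K.*2)%N by rewrite -size_word Pu.
have iK : (i <= K.+1)%N.
  rewrite leqNgt; apply/negP => iK; move/eqP: Euv; apply.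
  by apply: (kw_letter kw) iK; rewrite mem_cat inE eqxx orbT.
have [|na] := boolP (allowed (firsts P) (seconds P) i); last first.
  by move/eqP: Euv; rewrite -Pu path_dead.
move=> /orP[/eqP ->|/andP[ba /eqP ->]].
  by exists (false :: P); rewrite //= Pu.
by exists (true :: P); rewrite /= ?Pu // ba.
Qed.

(** All letters but the last follow a path; the last one is then forced by the sum of the
    letters. *)
Lemma nonzero_full_word w : E w != 0 ->
  exists2 P, valid P & size P = K.*2.+1 /\ full_word P = w.
Proof.
move=> Ew.
have sw : size w = K.*2.+2 by apply/eqP; apply: contraNT Ew => /(kw_size kw) ->.
have sumw : sumn w = (K.+1 ^ 2)%N by apply/eqP; apply: contraNT Ew => /(kw_sumn kw) ->.
case/lastP: w Ew sw sumw => [//|u i] Ew; rewrite size_rcons => -[su].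
rewrite sumn_rcons => sumw.
have [||P vP Pu] := @nonzero_path u [:: i]; rewrite ?su ?cats1 //.
have sP : size P = K.*2.+1 by rewrite -size_word Pu.
exists P => //; split=> //; rewrite /full_word Pu cats1; congr rcons.
have bK := seconds_le vP (eq_leq sP).
move: sumw (sum_letters bK); rewrite -Pu sumn_word.
have -> : (K.*2.+1 - seconds P = firsts P)%N by move: sP; rewrite size_path; lia.
by lia.
Qed.

Definition block_path := {T : K.*2.+1.-tuple bool | valid T}.
Implicit Types T : block_path.
Definition path_of T : seq bool := tval (sval T).

Lemma size_path_of T : size (path_of T) = K.*2.+1.
Proof. exact: size_tuple. Qed.

Lemma valid_path_of T : valid (path_of T).
Proof. exact: (valP T). Qed.

Lemma full_word_inj T T' : full_word (path_of T) = full_word (path_of T') -> T = T'.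
Proof.
rewrite /full_word !cats1 => /rcons_inj[wT _]; apply: val_inj; apply: val_inj.
by apply: word_inj wT; rewrite ?valid_path_of ?size_path_of.
Qed.

Lemma block_path_exists P : valid P -> size P = K.*2.+1 -> exists T, path_of T = P.
Proof. by move=> vP sP; exists (exist _ (Tuple (introT eqP sP)) vP). Qed.

Lemma full_word_orth T T' :
  E (full_word (path_of T)) * E (full_word (path_of T')) =
  if T == T' then E (full_word (path_of T)) else 0.
Proof.
rewrite (kw_EE kw); have [->|TT'] := eqVneq T T'; first by rewrite eqxx.
by rewrite ifN //; apply: contraNneq TT' => /full_word_inj ->.
Qed.

Lemma sum_full_word : \sum_(T : block_path) E (full_word (path_of T)) = 1.
Proof.
apply/eqP; rewrite eq_sym -subr_eq0; apply/eqP; apply: (kw_total kw) => w.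
rewrite mulrBl mul1r; have [->|Ew] := eqVneq (E w) 0; first by rewrite !mulr0 subrr.
have [P vP [sP <-]] := nonzero_full_word Ew.
have [T0 <-] := block_path_exists vP sP.
rewrite mulr_suml (bigD1 T0) //= full_word_orth eqxx big1 ?addr0 ?subrr // => T TT0.
by rewrite full_word_orth (negPf TT0).
Qed.

Lemma path_iso P : valid P -> size P = K.*2.+1 ->
  word_iso (full_word P) (full_word (colpath (firsts P) (seconds P))) (sort_elt P).
Proof.
by move=> vP sP; rewrite /full_word path_counts; apply: sort_elt_iso => //; rewrite sP.
Qed.

(** * Vertices and arrows of the block *)

Definition top_path (t : nat) : seq bool := colpath (K.+1 + t) (K - t).
(** For [t < K], a second-column step leads from here to [top_path t], and a first-column step to
    the shape of [top_path t.+1]: this is the branching point behind the arrow between the two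
    vertices. *)
Definition mid_path (t : nat) : seq bool := colpath (K.+1 + t) (K - t.+1).

Definition vertex (t : nat) : A := if (t <= K)%N then E (full_word (top_path t)) else 0.

Definition index_of (P : seq bool) : nat := K - seconds P.

Lemma full_word_can P : valid P -> size P = K.*2.+1 ->
  full_word (colpath (firsts P) (seconds P)) = full_word (top_path (index_of P)).
Proof.
move=> vP sP; rewrite /top_path /index_of; congr (full_word (colpath _ _));
  by have := valid_le vP; move: sP; rewrite size_path; lia.
Qed.

Lemma top_mid t : (t < K)%N -> top_path t = true :: mid_path t.
Proof.
move=> tK; rewrite /top_path /mid_path -[true :: colpath _ _]/(colpath _ (K - t.+1).+1).
by congr colpath; lia.
Qed.

Lemma size_mid t : (t < K)%N -> size (mid_path t) = K.*2.
Proof. by rewrite size_colpath; lia. Qed.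

Lemma valid_mid t : valid (mid_path t).
Proof. by apply: valid_colpath; lia. Qed.

Lemma valid_true P : valid P -> (seconds P < firsts P)%N -> valid (true :: P).
Proof. by move=> /= -> ->. Qed.

(** The full words of the two continuations differ only by exchanging the last two letters, so the
    last [Psi] relates them. *)
Lemma last_letters P : valid P -> size P = K.*2 -> (seconds P < firsts P)%N ->
  let b := (K - (seconds P).+1)%N in
  [/\ letter (firsts P) (seconds P) true = b.+2, letter (firsts P) (seconds P) false = b.+1,
      full_word (true :: P) = word P ++ [:: b.+2; b.+1]
    & full_word (false :: P) = word P ++ [:: b.+1; b.+2]].
Proof.
move=> vP; rewrite size_path => sP fs b.
have e1 : letter (firsts P) (seconds P) true = b.+2 by rewrite /b /letter; lia.
have e2 : letter (firsts P) (seconds P) false = b.+1 by rewrite /b /letter; lia.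
split=> //; rewrite /full_word word_cons ?e1 ?e2 !counts_step //.
by congr (_ ++ [:: _; _]); rewrite /b; lia.
Qed.

Section MiddlePath.
Variable P : seq bool.
Hypotheses (vP : valid P) (sP : size P = K.*2) (fP : (seconds P < firsts P)%N).

Let sw : size (word P) = K.*2. Proof. by rewrite size_word. Qed.

Lemma turn x : Psi K.*2 * E (full_word (x :: P)) = E (full_word (~~ x :: P)) * Psi K.*2.
Proof.
have [_ _ eT eF] := last_letters vP sP fP.
by case: x; rewrite [~~ _]/= eT eF -sw (kw_PsiE kw).
Qed.

Lemma X_full_word r x : (r <= K.*2)%N -> X r * E (full_word (x :: P)) = 0.
Proof.
move=> rK; apply: path_X; rewrite ?size_step ?sP //.
by case: x; [apply: valid_true | exact: vP].
Qed.

Lemma X_turn x : X K.*2.+1 * (Psi K.*2 * E (full_word (x :: P))) = 0.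
Proof.
have [_ _ eT eF] := last_letters vP sP fP.
have := @X_full_word K.*2 x (leqnn _); rewrite mulrA -sw.
by case: x; rewrite ?eT ?eF => X0;
  rewrite (kw_XPsiS kw) ?(gtn_eqF (ltnSn _)) ?(ltn_eqF (ltnSn _)) addr0 -mulrA X0 mulr0.
Qed.

Lemma turn_X x : Psi K.*2 * (X K.*2.+1 * E (full_word (x :: P))) = 0.
Proof.
have : X K.*2 * (Psi K.*2 * E (full_word (x :: P))) = 0.
  by rewrite turn mulrA X_full_word // mul0r.
have [_ _ eT eF] := last_letters vP sP fP; rewrite -sw !mulrA.
by case: x; rewrite ?eT ?eF (kw_XPsi kw) ?(gtn_eqF (ltnSn _)) ?(ltn_eqF (ltnSn _)) subr0.
Qed.

(** Both letters are at least 1, so the double bond is not involved and the last [X] occurs to the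
    first power. *)
Lemma turn2 x : exists2 t : F, t != 0 &
  Psi K.*2 * (Psi K.*2 * E (full_word (x :: P))) = scal t * X K.*2.+1 * E (full_word (x :: P)).
Proof.
have [_ _ eT eF] := last_letters vP sP fP.
have := @X_full_word K.*2 x (leqnn _).
set b := (K - _)%N in eT eF; case: x; rewrite ?eT ?eF => X0.
  have [|t t0 ht] := @kw_psi2_near _ _ _ _ _ _ kw b.+2 b.+1; first by rewrite /near eqxx orbT.
  by exists t => //; have := ht (word P) [::]; rewrite sw mulrA expr1 => ->.
have [|t t0 ht] := @kw_psi2_near _ _ _ _ _ _ kw b.+1 b.+2; first by rewrite /near eqxx.
by exists t => //; have := ht (word P) [::]; rewrite sw mulrA expr1 => ->.
Qed.

End MiddlePath.

Lemma vertexE t : (t <= K)%N -> vertex t = E (full_word (top_path t)).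
Proof. by rewrite /vertex => ->. Qed.

Lemma vertex_orth s t : vertex s * vertex t = if s == t then vertex s else 0.
Proof.
have [->|st] := eqVneq s t.
  by rewrite /vertex; case: ifP => _; rewrite ?mulr0 // (kw_EE kw) eqxx.
rewrite /vertex; case: ifP => sK; case: ifP => tK; rewrite ?mulr0 ?mul0r //.
rewrite (kw_EE kw) ifN //; apply: contraNneq st => /(congr1 (last 0%N)).
by rewrite /full_word !cats1 !last_rcons /top_path !path_counts; lia.
Qed.

Lemma vertex_X r t : X r * vertex t = vertex t * X r.
Proof. by rewrite /vertex; case: ifP => _; rewrite ?mulr0 ?mul0r // (kw_XE kw). Qed.

Section Arrows.
Variable R : nat -> A.

Definition sort_mid (t : nat) : A := ins_elt (K.+1 + t) (K - t.+1).
Notation bent t := (E (full_word (false :: mid_path t))).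

Hypothesis R_inverse : forall t, (t < K)%N ->
  [/\ R t * vertex t.+1 = bent t * R t, R t * sort_mid t * bent t = bent t
    & sort_mid t * R t * vertex t.+1 = vertex t.+1].

(** Turning the last two letters leaves the column order, and [sort_mid] restores it. For [down_elt]
    the sorting is first undone by the inverse [R]. *)
Definition up_elt (t : nat) : A := sort_mid t * (Psi K.*2 * vertex t).
Definition down_elt (t : nat) : A := Psi K.*2 * (R t * vertex t.+1).

Section OneArrow.
Variable t : nat.
Hypothesis tK : (t < K)%N.

Let mid_ok : [/\ valid (mid_path t), size (mid_path t) = K.*2
  & (seconds (mid_path t) < firsts (mid_path t))%N].
Proof. by rewrite valid_mid size_mid // !path_counts; split=> //; lia. Qed.

Lemma vertex_mid : vertex t = E (full_word (true :: mid_path t)).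
Proof. by rewrite vertexE ?top_mid // ltnW. Qed.

Lemma sort_midE : sort_mid t * bent t = vertex t.+1 * sort_mid t.
Proof.
rewrite vertexE // /sort_mid.
have -> : full_word (top_path t.+1) = word (colpath (K.+1 + t).+1 (K - t.+1)) ++ [:: t.+2].
  by rewrite /full_word /top_path !path_counts addnS; congr (_ ++ [:: _]); lia.
have -> : full_word (false :: mid_path t) = word (false :: mid_path t) ++ [:: t.+2].
  by rewrite /full_word counts_step !path_counts; congr (_ ++ [:: _]); lia.
by have [] := @ins_elt_iso (K.+1 + t) (K - t.+1) [:: t.+2] _ _; try lia.
Qed.

Lemma sort_mid_X r : (K.*2 < r)%N -> sort_mid t * X r = X r * sort_mid t.
Proof. by move=> rK; apply: ins_elt_X; lia. Qed.

Lemma turn_vertex : Psi K.*2 * vertex t = bent t * (Psi K.*2 * vertex t).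
Proof.
have [vP sP fP] := mid_ok.
by rewrite vertex_mid (turn vP sP fP) /= mulrA (kw_EE kw) eqxx.
Qed.

Lemma turn_bent : Psi K.*2 * bent t = vertex t * (Psi K.*2 * bent t).
Proof.
have [vP sP fP] := mid_ok.
by rewrite vertex_mid (turn vP sP fP) /= mulrA (kw_EE kw) eqxx.
Qed.

Lemma R_vertex : R t * vertex t.+1 = bent t * (R t * vertex t.+1).
Proof.
have [RE _ _] := R_inverse tK.
by rewrite RE mulrA (kw_EE kw) eqxx.
Qed.

(** [R] is known only as an inverse, so commutation with the last [X] is transferred from
    [sort_mid]. *)
Lemma R_X : R t * vertex t.+1 * X K.*2.+1 = X K.*2.+1 * (R t * vertex t.+1).
Proof.
have [RE RS SR] := R_inverse tK.
rewrite -mulrA -vertex_X -{1}SR -[sort_mid t * _ * _]mulrA.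
rewrite (mulrA (X _)) -sort_mid_X // -mulrA RE (mulrA (X _)) (kw_XE kw) -(mulrA (bent t)).
by rewrite !mulrA RS.
Qed.

Lemma vertex_up : vertex t.+1 * up_elt t = up_elt t.
Proof.
rewrite /up_elt turn_vertex (mulrA (sort_mid t)) sort_midE -!mulrA.
by rewrite mulrA vertex_orth eqxx.
Qed.

Lemma up_vertex : up_elt t * vertex t = up_elt t.
Proof. by rewrite /up_elt -!mulrA vertex_orth eqxx. Qed.

Lemma vertex_down : vertex t * down_elt t = down_elt t.
Proof.
rewrite /down_elt R_vertex (mulrA (Psi _)) turn_bent -!mulrA.
by rewrite mulrA vertex_orth eqxx.
Qed.

Lemma down_vertex : down_elt t * vertex t.+1 = down_elt t.
Proof. by rewrite /down_elt -!mulrA vertex_orth eqxx. Qed.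

Lemma X_up : X K.*2.+1 * up_elt t = 0.
Proof.
have [vP sP fP] := mid_ok.
by rewrite /up_elt mulrA -sort_mid_X // -mulrA vertex_mid (X_turn vP sP fP) mulr0.
Qed.

Lemma up_X : up_elt t * X K.*2.+1 = 0.
Proof.
have [vP sP fP] := mid_ok.
by rewrite /up_elt -!mulrA -vertex_X vertex_mid (turn_X vP sP fP) mulr0.
Qed.

Lemma X_down : X K.*2.+1 * down_elt t = 0.
Proof.
have [vP sP fP] := mid_ok.
by rewrite /down_elt R_vertex (mulrA (Psi _)) (mulrA (X _)) (X_turn vP sP fP) mul0r.
Qed.

Lemma down_X : down_elt t * X K.*2.+1 = 0.
Proof.
have [vP sP fP] := mid_ok.
by rewrite /down_elt -mulrA R_X R_vertex (mulrA (X _)) mulrA (turn_X vP sP fP) mul0r.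
Qed.

Lemma down_up : exists2 c : F, c != 0 & down_elt t * up_elt t = scal c * (X K.*2.+1 * vertex t).
Proof.
have [vP sP fP] := mid_ok; have [c c0 hc] := turn2 vP sP fP true; exists c => //.
have [_ RS _] := R_inverse tK.
rewrite [RHS]mulrA vertex_mid -hc -vertex_mid /down_elt -!mulrA vertex_up /up_elt.
congr (_ * _); rewrite [LHS]mulrA {1}turn_vertex [LHS]mulrA RS.
by rewrite -turn_vertex.
Qed.

Lemma up_down : exists2 c : F, c != 0 & up_elt t * down_elt t = scal c * (X K.*2.+1 * vertex t.+1).
Proof.
have [vP sP fP] := mid_ok; have [c c0 hc] := turn2 vP sP fP false; exists c => //.
have [_ _ SR] := R_inverse tK.
rewrite /up_elt -!mulrA vertex_down /down_elt R_vertex (mulrA (Psi _) (bent t)) (mulrA (Psi _)) hc.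
rewrite -!mulrA -R_vertex scal_pull; congr (_ * _).
by rewrite mulrA sort_mid_X // -!mulrA -[in RHS]SR !mulrA.
Qed.

End OneArrow.

Section TwoArrows.
Variable t : nat.
Hypothesis tK : (t.+1 < K)%N.

Let C := colpath (K.+1 + t) (K - t.+2).
Let S0 := ins_elt (K.+1 + t) (K - t.+2).
Let tK' : (t < K)%N := ltnW tK.

Let sC : size (word C) = K.*2.-1.
Proof. by rewrite size_word size_colpath; lia. Qed.

Let sC1 : (size (word C)).+1 = K.*2.
Proof. by rewrite sC; lia. Qed.

(** After [C] only [t.+1] and [t.+3] are allowed. The braid relation leads both double arrows
    through one of these zero words. *)
Let E_C : E (word C ++ [:: t.+2; t.+3; t.+1]) = 0 /\ E (word C ++ [:: t.+2; t.+1; t.+3]) = 0.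
Proof.
by split; apply: path_dead; rewrite ?path_counts ?valid_colpath /allowed /letter //; lia.
Qed.

Let sort_mid_C : sort_mid t = S0 * Psi (size (word C)).
Proof.
rewrite /sort_mid /S0 (_ : (K - t.+1 = (K - t.+2).+1)%N) ?ins_eltS; last lia.
by congr (_ * Psi _); rewrite sC; lia.
Qed.

Let S0_turn : S0 * Psi K.*2 = Psi K.*2 * S0.
Proof. by apply: ins_elt_Psi; lia. Qed.

Let mid_C : mid_path t = true :: C.
Proof. by rewrite /mid_path (_ : (K - t.+1 = (K - t.+2).+1)%N) //; lia. Qed.

Let letters_C : [/\ letter (K.+1 + t) (K - t.+2) true = t.+3,
  letter (K.+1 + t) (K - t.+1) true = t.+2, letter (K.+1 + t) (K - t.+2) false = t.+1
  & letter (K.+2 + t) (K - t.+2) false = t.+2].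
Proof. by split; rewrite /letter; lia. Qed.

Let vertex_word : vertex t = E (word C ++ [:: t.+3; t.+2; t.+1]).
Proof.
have [l1 l2 _ _] := letters_C.
rewrite vertex_mid // /full_word word_cons !counts_step !path_counts l2 mid_C word_cons.
rewrite !path_counts l1; congr E; congr (_ ++ [:: _; _; _]); lia.
Qed.

Let bent_word : bent t = E (word C ++ [:: t.+3; t.+1; t.+2]).
Proof.
have [l1 _ l3 _] := letters_C.
have l3' : letter (K.+1 + t) (K - t.+1) false = t.+1 by rewrite -l3.
rewrite /full_word word_cons !counts_step !path_counts l3' mid_C word_cons.
rewrite !path_counts l1; congr E; congr (_ ++ [:: _; _; _]); lia.
Qed.

(** The product contains one side of the braid relation on the letters [t.+3], [t.+2], [t.+1]; the
    other side passes through a zero word. *)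
Lemma up_up : up_elt t.+1 * up_elt t = 0.
Proof.
rewrite /up_elt -!mulrA -[vertex t.+1 * _]/(vertex t.+1 * up_elt t) vertex_up // /up_elt sort_mid_C.
rewrite -!mulrA (mulrA (Psi K.*2) S0) -S0_turn vertex_word.
have := kw_braid kw (word C) (i := t.+3) t.+2 (k := t.+1) [::]; rewrite -!mulrA => braid.
rewrite -sC1 braid; last by lia.
by rewrite (kw_PsiE kw) (proj1 E_C) !(mul0r, mulr0).
Qed.

(** The same braid argument, once the abstract inverses are removed: multiplying by the isomorphism
    [sort_mid t.+1 * S0] cancels [R t.+1], and inserting the square of [Psi] on the far letters
    [t.+1], [t.+3] produces a factor [sort_mid t] that cancels [R t]. *)
Lemma down_down : down_elt t * down_elt t.+1 = 0.
Proof.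
have [_ _ l3 l4] := letters_C; have [RE' RS' SR'] := R_inverse tK.
have sE := sort_midE tK.
have [_ RS _] := R_inverse tK'.
have braid := kw_braid kw (word C) (i := t.+1) t.+2 (k := t.+3) [::]; rewrite -!mulrA in braid.
have W0 v : word (false :: C) ++ v = word C ++ t.+1 :: v.
  by rewrite word_cons !path_counts l3.
have W1 v : word (mid_path t.+1) ++ v = word (colpath (K.+1 + t).+1 (K - t.+2)) ++ v.
  by rewrite /mid_path addnS.
have bent1 : bent t.+1 = E (word (colpath (K.+1 + t).+1 (K - t.+2)) ++ [:: t.+2; t.+3]).
  rewrite /full_word word_cons W1 !path_counts counts_step !path_counts addnS.
  by rewrite l4; congr E; congr (_ ++ [:: _; _]); lia.
have [S0E [R0 [R0E _ SR0]]] : word_iso (word (false :: C) ++ [:: t.+2; t.+3])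
    (word (colpath (K.+1 + t).+1 (K - t.+2)) ++ [:: t.+2; t.+3]) S0.
  by apply: ins_elt_iso; lia.
have [S0E' _] : word_iso (word (false :: C) ++ [:: t.+3; t.+2])
    (word (colpath (K.+1 + t).+1 (K - t.+2)) ++ [:: t.+3; t.+2]) S0.
  by apply: ins_elt_iso; lia.
have v1 : vertex t.+1 = E (word (colpath (K.+1 + t).+1 (K - t.+2)) ++ [:: t.+3; t.+2]).
  rewrite vertex_mid // /full_word word_cons W1 counts_step !path_counts addnS.
  by rewrite /letter; congr E; congr (_ ++ [:: _; _]); lia.
rewrite -bent1 W0 in S0E R0E SR0; rewrite -v1 W0 in S0E'.
suff D0 : down_elt t * down_elt t.+1 *
    (sort_mid t.+1 * (S0 * E (word C ++ [:: t.+1; t.+2; t.+3]))) = 0.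
  have vE : vertex t.+2 =
      sort_mid t.+1 * (S0 * E (word C ++ [:: t.+1; t.+2; t.+3])) * (R0 * R t.+1).
    by rewrite -[LHS]SR' -mulrA RE' -SR0 -!mulrA (mulrA R0) R0E -!mulrA.
  by rewrite -(down_vertex t.+1) vE; rewrite !mulrA in D0 *; rewrite D0 !mul0r.
have turn1 : Psi K.*2 * E (word C ++ [:: t.+1; t.+2; t.+3]) =
    E (word C ++ [:: t.+1; t.+3; t.+2]) * Psi K.*2.
  have := kw_PsiE kw (rcons (word C) t.+1) t.+2 t.+3 [::].
  by rewrite !cat_rcons size_rcons sC1.
have down1 : down_elt t.+1 * (sort_mid t.+1 * bent t.+1) = Psi K.*2 * bent t.+1.
  rewrite /down_elt sE -!mulrA (mulrA (vertex _)) vertex_orth eqxx -sE.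
  by rewrite (mulrA (R _)) RS'.
have -> : down_elt t * down_elt t.+1 *
      (sort_mid t.+1 * (S0 * E (word C ++ [:: t.+1; t.+2; t.+3]))) =
    down_elt t * (S0 * E (word C ++ [:: t.+1; t.+3; t.+2])) * Psi K.*2.
  rewrite S0E (mulrA (sort_mid _)) -(mulrA (down_elt t)) (mulrA (down_elt _) (_ * _)) down1.
  have -> : Psi K.*2 * bent t.+1 * S0 = S0 * E (word C ++ [:: t.+1; t.+3; t.+2]) * Psi K.*2.
    by rewrite -mulrA -S0E mulrA -S0_turn -mulrA turn1 mulrA.
  by rewrite !mulrA.
have f13 : far t.+1 t.+3 by rewrite /far; lia.
have [c c0 hc] := kw_psi2_far kw f13.
have turn2 : Psi (size (word C)) * E (word C ++ [:: t.+1; t.+3; t.+2]) =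
  bent t * Psi (size (word C)) by rewrite (kw_PsiE kw) bent_word.
have -> : down_elt t * (S0 * E (word C ++ [:: t.+1; t.+3; t.+2])) =
    Psi K.*2 * (R t * (S0 * E (word C ++ [:: t.+1; t.+3; t.+2]))).
  by rewrite S0E' /down_elt -!mulrA (mulrA (vertex _)) vertex_orth eqxx.
apply: (scal_eq0 c0); have := hc (word C) [:: t.+2]; rewrite -mulrA => {}hc.
have -> : scal c * (Psi K.*2 * (R t * (S0 * E (word C ++ [:: t.+1; t.+3; t.+2]))) * Psi K.*2) =
    Psi K.*2 * (R t * (S0 * (scal c * E (word C ++ [:: t.+1; t.+3; t.+2])))) * Psi K.*2.
  by rewrite !scal_pull [LHS]mulrA.
rewrite -hc (mulrA S0) -sort_mid_C turn2 (mulrA (sort_mid t)) (mulrA (R t)) (mulrA (R t)) RS -turn2.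
rewrite -!mulrA -turn1 -sC1 braid; last by lia.
by rewrite (kw_PsiE kw) (proj2 E_C) !(mul0r, mulr0).
Qed.
End TwoArrows.

(** The loop is a nonzero multiple of a composite of two arrows, each killed by [X]. For [K = 0]
    there are no arrows, and the double bond on the word 0, 1 gives the square directly. *)
Lemma X2_vertex t : X K.*2.+1 * (X K.*2.+1 * vertex t) = 0.
Proof.
have [tK|Kt] := ltnP t K.
  have [c c0 h] := down_up tK; apply: (scal_eq0 c0).
  by rewrite -scal_pull -h mulrA X_down // mul0r.
have [eK|] := eqVneq t K; last first.
  by move=> neK; rewrite /vertex ifN ?mulr0 // -ltnNge; lia.
case: t Kt eK => [_ K0|t tK eK].
  have w01 : full_word (top_path 0) = [:: 0%N; 1%N].
    by rewrite /full_word /top_path -K0 -[colpath _ _]/([:: false]) /= -K0.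
  have X1 : X K.*2.+1 = X 1%N by rewrite -K0.
  rewrite vertexE // w01 mulrA -expr2 X1.
  have := @X_near [::] 0 1 [::] isT; apply.
    by have := kw_cyclotomic kw [:: 1%N]; rewrite -K0.
  by apply: (kw_first kw); rewrite -K0.
have tK' : (t < K)%N by rewrite -eK.
have [c c0 h] := up_down tK'; apply: (scal_eq0 c0).
by rewrite -scal_pull -h mulrA X_up // mul0r.
Qed.

Definition arrow_x : A := X K.*2.+1 * \sum_(t < K.+1) vertex t.
Definition arrow_up : A := \sum_(t < K) up_elt t.
Definition arrow_down : A := \sum_(t < K) down_elt t.

Lemma sum_vertex s : (\sum_(t < K.+1) vertex t) * vertex s = vertex s.
Proof.
have [sK|sK] := leqP s K; last by rewrite /vertex leqNgt sK mulr0.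
rewrite mulr_suml (bigD1 (inord s)) //= inordK // vertex_orth eqxx big1 ?addr0 // => t ts.
rewrite vertex_orth ifN //; apply: contraNneq ts => ts.
by apply/eqP/val_inj; rewrite /= inordK.
Qed.

Lemma arrow_x_vertex s : arrow_x * vertex s = X K.*2.+1 * vertex s.
Proof. by rewrite /arrow_x -mulrA sum_vertex. Qed.

Lemma sum_arrow (h : nat -> A) (s : nat) (y : nat -> A) :
  (forall t : 'I_K, h t = if (t == s :> nat) then y s else 0) ->
  \sum_(t < K) h t = if (s < K)%N then y s else 0.
Proof.
move=> hE; case: ltnP => sK.
  have := hE (Ordinal sK); rewrite eqxx /= => hs.
  rewrite (bigD1 (Ordinal sK)) //= hs big1 ?addr0 // => t ts.
  by rewrite hE ifN.
by rewrite big1 // => t _; rewrite hE ifN // ltn_eqF // (leq_trans _ sK).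
Qed.

Lemma arrow_up_vertex s : arrow_up * vertex s = if (s < K)%N then up_elt s else 0.
Proof.
rewrite mulr_suml; apply: (@sum_arrow (fun t => up_elt t * vertex s) s up_elt) => t.
by rewrite -up_vertex -mulrA vertex_orth; case: eqP => [->|_]; rewrite ?mulr0 // up_vertex.
Qed.

Lemma vertex_arrow_up s : vertex s.+1 * arrow_up = if (s < K)%N then up_elt s else 0.
Proof.
rewrite mulr_sumr; apply: (@sum_arrow (fun t => vertex s.+1 * up_elt t) s up_elt) => t.
rewrite -vertex_up // mulrA vertex_orth eqSS eq_sym.
by case: eqP => [<-|_]; rewrite ?mul0r // vertex_up.
Qed.

Lemma arrow_down_vertex s : arrow_down * vertex s.+1 = if (s < K)%N then down_elt s else 0.
Proof.
rewrite mulr_suml; apply: (@sum_arrow (fun t => down_elt t * vertex s.+1) s down_elt) => t.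
by rewrite -down_vertex -mulrA vertex_orth eqSS; case: eqP => [->|_]; rewrite ?mulr0 // down_vertex.
Qed.

Lemma vertex_arrow_down s : vertex s * arrow_down = if (s < K)%N then down_elt s else 0.
Proof.
rewrite mulr_sumr; apply: (@sum_arrow (fun t => vertex s * down_elt t) s down_elt) => t.
rewrite -vertex_down // mulrA vertex_orth eq_sym.
by case: eqP => [<-|_]; rewrite ?mul0r // vertex_down.
Qed.

Lemma arrow_x_up s : (s < K)%N -> arrow_x * up_elt s = 0.
Proof. by move=> sK; rewrite -vertex_up // mulrA arrow_x_vertex -mulrA vertex_up // X_up. Qed.

Lemma arrow_x_down s : (s < K)%N -> arrow_x * down_elt s = 0.
Proof. by move=> sK; rewrite -vertex_down // mulrA arrow_x_vertex -mulrA vertex_down // X_down. Qed.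

Lemma block_zigzag : zigzag K vertex arrow_x arrow_up arrow_down.
Proof.
have xE : arrow_x = \sum_(t < K.+1) vertex t * X K.*2.+1.
  by rewrite /arrow_x mulr_sumr; apply: eq_bigr => t _; rewrite vertex_X.
have down0 : arrow_down * vertex 0 = 0.
  by rewrite mulr_suml big1 // => t _; rewrite -down_vertex -mulrA vertex_orth mulr0.
have up0 : vertex 0 * arrow_up = 0.
  by rewrite mulr_sumr big1 // => t _; rewrite -vertex_up // mulrA vertex_orth mul0r.
split.
- exact: vertex_orth.
- by move=> s sK; rewrite /vertex leqNgt sK.
- rewrite [RHS]mulr_sumr; under eq_bigr do rewrite arrow_x_vertex.
  by rewrite -mulr_sumr.
- move=> s; rewrite arrow_x_vertex xE mulr_sumr vertex_X.
  have [sK|sK] := leqP s K; last first.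
    have v0 : vertex s = 0 by rewrite /vertex leqNgt sK.
    by rewrite v0 mul0r big1 // => t _; rewrite mul0r.
  rewrite (bigD1 (inord s)) //= inordK // mulrA vertex_orth eqxx big1 ?addr0 // => t ts.
  rewrite mulrA vertex_orth ifN ?mul0r //; apply: contraNneq ts => ->.
  by apply/eqP/val_inj; rewrite /= inordK.
- by move=> s; rewrite arrow_up_vertex vertex_arrow_up.
- by move=> s; rewrite arrow_down_vertex vertex_arrow_down.
- exact: down0.
- exact: up0.
- rewrite {2}/arrow_up mulr_sumr big1 // => s _.
  by rewrite -vertex_up // mulrA arrow_up_vertex; case: ifP => sK; rewrite ?mul0r // up_up.
- rewrite {2}/arrow_down mulr_sumr big1 // => -[[|s] sK] _ /=.
    by rewrite -vertex_down // mulrA down0 mul0r.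
  by rewrite -vertex_down // mulrA arrow_down_vertex ltnW // down_down.
- rewrite {2}xE mulr_sumr big1 // => t _.
  by rewrite mulrA arrow_x_vertex -mulrA -vertex_X X2_vertex.
- by rewrite /arrow_up mulr_sumr big1 // => s _; rewrite arrow_x_up.
- rewrite xE mulr_sumr big1 // => t _; rewrite mulrA arrow_up_vertex.
  by case: ifP => tK; rewrite ?mul0r // up_X.
- by rewrite /arrow_down mulr_sumr big1 // => s _; rewrite arrow_x_down.
- rewrite xE mulr_sumr big1 // => -[[|t] tK] _ /=; first by rewrite mulrA down0 mul0r.
  by rewrite mulrA arrow_down_vertex; case: ifP => tK'; rewrite ?mul0r // down_X.
- move=> s sK; have [c c0 h] := down_up sK; exists c => //.
  rewrite -[LHS]mulrA arrow_up_vertex sK -vertex_up // mulrA arrow_down_vertex sK h.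
  by rewrite -mulrA arrow_x_vertex.
- move=> s sK; have [c c0 h] := up_down sK; exists c => //.
  rewrite -[LHS]mulrA arrow_down_vertex sK -vertex_down // mulrA arrow_up_vertex sK h.
  by rewrite -mulrA arrow_x_vertex.
Qed.


(** * Matrix entries of the generators *)

Lemma valid_swap_back L P : valid (L ++ true :: false :: P) -> (seconds P < firsts P)%N ->
  valid (L ++ false :: true :: P).
Proof.
move=> vL fP; elim: L vL => [|x L IH] /=; first by move=> /andP[_ ->]; rewrite fP.
by rewrite !count_cat /= => /andP[h /IH ->]; rewrite andbT; move: h; case: x => //=; lia.
Qed.

Lemma word_middle L x y P t : word (L ++ y :: x :: P) ++ t =
  word P ++ letter (firsts P) (seconds P) x ::
    letter (firsts (x :: P)) (seconds (x :: P)) y ::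
    (word_tail L (firsts (y :: x :: P)) (seconds (y :: x :: P)) ++ t).
Proof. by rewrite word_cat -catA [word (y :: _)]/= !cat_rcons. Qed.

Lemma full_word_middle L x y P : full_word (L ++ y :: x :: P) =
  word P ++ letter (firsts P) (seconds P) x ::
    letter (firsts (x :: P)) (seconds (x :: P)) y ::
    (word_tail L (firsts (y :: x :: P)) (seconds (y :: x :: P))
       ++ [:: (K - seconds (L ++ y :: x :: P)).+1]).
Proof. exact: word_middle. Qed.

Section Reduction.
Variable q : block_path -> A.
Notation w T := (full_word (path_of T)).
Notation ix T := (index_of (path_of T)).

Hypothesis q_inverse : forall T, [/\ q T = E (w T) * q T,
  q T * (sort_elt (path_of T) * E (w T)) = E (w T), sort_elt (path_of T) * q T = vertex (ix T)
  & q T * vertex (ix T) = q T].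

Definition sort_idem T : A := sort_elt (path_of T) * E (w T).

Definition reduced (z : A) : Prop := forall T T', exists c : F,
  exists2 y : A, y \in [:: 1; arrow_x; arrow_up; arrow_down]
    & sort_idem T * z * q T' = scal c * y * vertex (ix T').

Lemma pq T T' : sort_idem T * q T' = if T == T' then vertex (ix T) else 0.
Proof.
have [qE _ sq _] := q_inverse T'; rewrite qE /sort_idem -mulrA (mulrA (E _) (E _)) full_word_orth.
have [->|_] := eqVneq T T'; last by rewrite mul0r mulr0.
by rewrite -qE.
Qed.

Lemma reduced0 T T' z : sort_idem T * z * q T' = 0 -> exists c : F,
  exists2 y : A, y \in [:: 1; arrow_x; arrow_up; arrow_down]
    & sort_idem T * z * q T' = scal c * y * vertex (ix T').
Proof. by move=> ->; exists 0, 1; rewrite ?inE ?eqxx // rmorph0 !mul0r. Qed.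

Lemma p_kill T T' z : z * E (w T') = 0 -> sort_idem T * z * q T' = 0.
Proof.
move=> z0; have [qE _ _ _] := q_inverse T'.
by rewrite qE -mulrA (mulrA z) z0 mul0r mulr0.
Qed.

(** A [Psi] sends the full word of [T'] to that of a single path [P], so its column at [T'] has at
    most one nonzero entry. *)
Lemma p_move T T' P r : valid P -> size P = K.*2.+1 ->
  Psi r * E (w T') = E (full_word P) * Psi r ->
  sort_idem T * Psi r * q T' = if path_of T == P then sort_elt P * (Psi r * q T') else 0.
Proof.
move=> vP sP h; have [qE _ _ _] := q_inverse T'; have [T0 T0P] := block_path_exists vP sP.
have hq : Psi r * q T' = E (full_word P) * (Psi r * q T').
  by rewrite {1}qE mulrA h -mulrA.
rewrite -mulrA hq -T0P /sort_idem -mulrA (mulrA (E _) (E _)) full_word_orth.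
have -> : (path_of T == path_of T0) = (T == T0).
  apply/eqP/eqP => [TT0|->//]; apply: full_word_inj; by rewrite TT0.
have [->|_] := eqVneq T T0; last by rewrite mul0r mulr0.
by rewrite T0P -hq.
Qed.

Lemma reduced_E u : reduced (E u).
Proof.
move=> T T'; have [uT|uT] := eqVneq u (w T'); last first.
  by apply/reduced0/p_kill; rewrite (kw_EE kw) (negPf uT).
have [qE _ _ _] := q_inverse T'.
rewrite uT -mulrA -qE pq; have [->|_] := eqVneq T T'.
  by exists 1, 1; rewrite ?inE ?eqxx // rmorph1 !mul1r.
by exists 0, 1; rewrite ?inE ?eqxx // rmorph0 !mul0r.
Qed.

Lemma reduced_X r : (r < K.*2.+2)%N -> reduced (X r).
Proof.
rewrite ltnS leq_eqVlt => /orP[/eqP ->|rK] T T'; last first.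
  apply/reduced0/p_kill; apply: path_X; rewrite ?size_path_of ?valid_path_of //.
have -> : sort_idem T * X K.*2.+1 * q T' = X K.*2.+1 * (sort_idem T * q T').
  by rewrite /sort_idem -(mulrA (sort_elt _)) -(kw_XE kw) mulrA sort_elt_X ?size_path_of // -!mulrA.
rewrite pq; have [->|_] := eqVneq T T'.
  exists 1, arrow_x; rewrite ?inE ?eqxx ?orbT // rmorph1 mul1r.
  by rewrite arrow_x_vertex.
by exists 0, 1; rewrite ?inE ?eqxx // rmorph0 !mul0r mulr0.
Qed.

Lemma split_path r (P : seq bool) : (r.+1 < size P)%N ->
  exists L y x P', P = L ++ y :: x :: P' /\ size P' = r.
Proof.
move=> rP; exists (take (size P - r.+2) P).
have := cat_take_drop (size P - r.+2) P; have := size_drop (size P - r.+2) P.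
case: (drop _ _) => [|y [|x P']] /= sD eP; [lia | lia |].
by exists y, x, P'; split=> //; lia.
Qed.

(** Exchanging two steps of the same column, or leaving the valid paths, creates a forbidden letter.
    Otherwise the entry is 1 in the direction of sorting, and the scalar of [Psi] squared in the
    other. *)
Lemma reduced_Psi_inner r : (r < K.*2)%N -> reduced (Psi r).
Proof.
move=> rK T T'.
have [|L [y [x [P [T'P sP]]]]] := @split_path r (path_of T'); first by rewrite size_path_of; lia.
have vT' := valid_path_of T'; have sT' := size_path_of T'; rewrite T'P in vT' sT'.
have vxP : valid (y :: x :: P) := valid_cat vT'.
have vP : valid P by move: vxP => /= /and3P[].
have PsiE : Psi r * E (w T') = E (word P ++ letter (firsts (x :: P)) (seconds (x :: P)) y ::
    letter (firsts P) (seconds P) x ::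
    (word_tail L (firsts (y :: x :: P)) (seconds (y :: x :: P))
       ++ [:: (K - seconds (L ++ y :: x :: P)).+1])) * Psi r.
  by rewrite T'P full_word_middle -sP -size_word (kw_PsiE kw).
have sP' := size_path P.
have dead : ~~ allowed (firsts P) (seconds P) (letter (firsts (x :: P)) (seconds (x :: P)) y) ->
    exists c : F, exists2 y : A, y \in [:: 1; arrow_x; arrow_up; arrow_down]
    & sort_idem T * Psi r * q T' = scal c * y * vertex (ix T').
  move=> na; apply/reduced0/p_kill; rewrite PsiE path_dead ?mul0r //; first by lia.
  by move: na; rewrite /allowed /letter; case: (y); rewrite !counts_step; case: (x) => //=; lia.
have [_ _ sq _] := q_inverse T'.
case: y x T'P vT' sT' vxP PsiE dead => [] [] T'P vT' sT' vxP PsiE dead.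
- by apply: dead; move: vxP; rewrite !counts_step /= /allowed /letter; lia.
- have [fP|fP] := ltnP (seconds P) (firsts P); last first.
    by apply: dead; have := valid_le vP; rewrite !counts_step /= /allowed /letter; lia.
  have vQ := valid_swap_back vT' fP.
  rewrite (@p_move T T' (L ++ false :: true :: P) r) //; last first.
  + rewrite PsiE full_word_middle !counts_step; congr (E _ * _).
    by rewrite !count_cat /=.
  + by rewrite -sT' !size_cat.
  case: eqP => _; last by exists 0, 1; rewrite ?inE ?eqxx // rmorph0 !mul0r.
  have [qE _ _ _] := q_inverse T'.
  have [c c0 hc] : exists2 c : F, c != 0 & Psi r * (Psi r * E (w T')) = scal c * E (w T').
    have fr : far (letter (firsts P) (seconds P) false)
       (letter (firsts (false :: P)) (seconds (false :: P)) true).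
      by rewrite far_sym !counts_step; apply: letter_far => //; rewrite ?sP //= fP.
    have [c c0 hc] := kw_psi2_far kw fr; exists c => //.
    by rewrite T'P full_word_middle -sP -size_word mulrA hc.
  exists c, 1; rewrite ?inE ?eqxx // mulr1 sort_elt_swap sP -T'P -sq.
  have hq : Psi r * (Psi r * q T') = scal c * q T'.
    by rewrite {1}qE !mulrA -(mulrA (Psi r)) hc -mulrA -qE.
  by rewrite -mulrA hq scal_pull.
- rewrite (@p_move T T' (L ++ true :: false :: P) r) //; last first.
  + rewrite PsiE full_word_middle !counts_step; congr (E _ * _).
    by rewrite !count_cat /=.
  + by rewrite -sT' !size_cat.
  + exact: valid_cat_swap.
  case: eqP => _; last by exists 0, 1; rewrite ?inE ?eqxx // rmorph0 !mul0r.
  exists 1, 1; rewrite ?inE ?eqxx // rmorph1 !mul1r -sq T'P sort_elt_swap sP.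
  by rewrite mulrA.
- by apply: dead; move: vxP; rewrite !counts_step /= /allowed /letter; lia.
Qed.

Lemma reduced_Psi_last : reduced (Psi K.*2).
Proof.
move=> T T'; have [qE _ sq _] := q_inverse T'.
have [x [P T'P]] : exists x P, path_of T' = x :: P.
  by case: (path_of T') (size_path_of T') => // x P; exists x, P.
have vT' := valid_path_of T'; have sT' := size_path_of T'.
rewrite T'P in vT' sT'; have {sT'} [sP] := sT'; rewrite /= in vT'.
have vP : valid P by move: vT' => /andP[].
have sP' := size_path P.
(* Two columns of length [K] before the last step mean vertex 0, from which no arrow leads down: the
   exchanged word is zero. *)
have [fP|fP] := ltnP (seconds P) (firsts P); last first.
  have bP := valid_le vP.
  have xF : x = false by apply/negbTE; move: vT'; case: (x) => //=; lia.
  apply/reduced0/p_kill; rewrite T'P xF /full_word word_cons.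
  have -> : letter (firsts P) (seconds P) false = 0%N by rewrite /letter; lia.
  rewrite -sP -size_word (kw_PsiE kw) path_dead ?mul0r ?sP // counts_step.
    by lia.
  by rewrite /allowed /letter; lia.
have := turn vP sP fP x; rewrite -T'P => PsiE.
rewrite (p_move T _ _ PsiE); [| by case: (x); [exact: vP | exact: valid_true] | by rewrite /= sP].
case: eqP => _; last by exists 0, 1; rewrite ?inE ?eqxx // rmorph0 !mul0r.
have srtPsi : sort_elt P * (Psi K.*2 * q T') = Psi K.*2 * (sort_elt P * q T').
  by rewrite mulrA sort_elt_Psi ?sP // -mulrA.
case: x T'P vT' {PsiE} => T'P vT'; rewrite T'P in sq *.
  have tK : (index_of (true :: P) < K)%N by rewrite /index_of /=; lia.
  have e1 : (K.+1 + index_of (true :: P) = firsts P)%N by rewrite /index_of /=; lia.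
  have e2 : (K - (index_of (true :: P)).+1 = seconds P)%N by rewrite /index_of /=; lia.
  exists 1, arrow_up; rewrite ?inE ?eqxx ?orbT // rmorph1 mul1r arrow_up_vertex tK.
  by rewrite /= /up_elt /sort_mid e1 e2 -mulrA srtPsi -[sort_elt P]/(sort_elt (true :: P)) sq.
pose t := (K - (seconds P).+1)%N.
have tK : (t < K)%N by rewrite /t; lia.
have ixt : index_of (false :: P) = t.+1 by rewrite /index_of /t /=; lia.
have e1 : (K.+1 + t = firsts P)%N by rewrite /t; lia.
have e2 : (K - t.+1 = seconds P)%N by rewrite /t; lia.
rewrite ixt in sq *.
exists 1, arrow_down; rewrite ?inE ?eqxx ?orbT // rmorph1 mul1r arrow_down_vertex tK.
rewrite /= srtPsi /down_elt; congr (_ * _).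
have bentE : sort_elt P * q T' = bent t * (sort_elt P * q T').
  have := @sort_elt_iso P (letter (firsts P) (seconds P) false :: [:: (K - seconds P).+1]) vP.
  case=> [|sE _]; first by rewrite sP.
  rewrite {1}qE T'P /full_word word_cons counts_step mulrA sE -mulrA; congr (E _ * _).
  by rewrite word_cons counts_step /mid_path e1 e2 !path_counts.
have [_ RS _] := R_inverse tK.
rewrite bentE -RS -!mulrA -bentE -sq /= /sort_mid e1 e2.
by rewrite -mulrA.
Qed.
End Reduction.
End Arrows.

Theorem klr_words_finite_type :
  (forall S : A -> Prop, (forall w, S (E w)) -> (forall r, (r < K.*2.+2)%N -> S (X r)) ->
    (forall r, (r < K.*2.+1)%N -> S (Psi r)) -> (forall c : F, S (scal c)) ->
    (forall y z, S y -> S z -> S (y + z)) -> (forall y z, S y -> S z -> S (y * z)) ->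
    forall z, S z) ->
  finite_representation_type A.
Proof.
move=> gen.
have /boolp.choice[R hR] : forall t, exists Rt, (t < K)%N ->
  [/\ Rt * vertex t.+1 = E (full_word (false :: mid_path t)) * Rt,
      Rt * sort_mid t * E (full_word (false :: mid_path t)) = E (full_word (false :: mid_path t))
    & sort_mid t * Rt * vertex t.+1 = vertex t.+1].
  move=> t; have [tK|_] := ltnP t K; last by exists 0.
  have [] := @ins_elt_iso (K.+1 + t) (K - t.+1) [:: t.+2] _ _; [lia | lia |].
  have -> : word (colpath (K.+1 + t).+1 (K - t.+1)) ++ [:: t.+2] = full_word (top_path t.+1).
    by rewrite /full_word /top_path !path_counts addnS; congr (_ ++ [:: _]); lia.
  have -> : word (false :: colpath (K.+1 + t) (K - t.+1)) ++ [:: t.+2] =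
      full_word (false :: mid_path t).
    by rewrite /full_word counts_step !path_counts; congr (_ ++ [:: _]); lia.
  by rewrite -vertexE // => _ [Rt hRt]; exists Rt.
have /boolp.choice[q hq] : forall T : block_path, exists qT,
  [/\ qT = E (full_word (path_of T)) * qT,
    qT * (sort_elt (path_of T) * E (full_word (path_of T))) = E (full_word (path_of T)),
    sort_elt (path_of T) * qT = vertex (index_of (path_of T))
  & qT * vertex (index_of (path_of T)) = qT].
  move=> T; have vT := valid_path_of T; have sT := size_path_of T.
  have [sE [S [SE Ss sS]]] := path_iso vT sT; rewrite (full_word_can vT sT) in sE SE sS.
  exists (S * vertex (index_of (path_of T))); rewrite vertexE ?leq_subr //; split.
  - by rewrite SE mulrA (kw_EE kw) eqxx.
  - by rewrite sE -mulrA (mulrA (E _)) (kw_EE kw) eqxx -sE mulrA.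
  - by rewrite mulrA.
  - by rewrite -mulrA (kw_EE kw) eqxx.
pose G z := (exists u, z = E u) \/ (exists2 r, (r < K.*2.+2)%N & z = X r)
  \/ (exists2 r, (r < K.*2.+1)%N & z = Psi r).
apply: (@zigzag_finite_representation_type _ _ _ _ _ _ _ (block_zigzag hR) block_path
  (fun T => index_of (path_of T)) sort_idem q G).
- by move=> T T'; rewrite (pq hq).
- by rewrite -sum_full_word; apply: eq_bigr => T _; have [_ -> _ _] := hq T.
- move=> t tK; have [] := @block_path_exists (top_path t).
  + by apply: valid_colpath; lia.
  + by rewrite size_colpath; lia.
  by move=> T eT; exists T; rewrite eT /index_of path_counts; lia.
- move=> S GS Sc SD SM; apply: gen => // [w|r rK|r rK]; apply: GS.
  + by left; exists w.
  + by right; left; exists r.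
  + by right; right; exists r.
move=> z [[u ->]|[[r rK ->]|[r rK ->]]].
- exact: reduced_E.
- exact: reduced_X.
- move: rK; rewrite ltnS leq_eqVlt => /orP[/eqP ->|rK]; first exact: reduced_Psi_last.
  exact: reduced_Psi_inner.
Qed.
End Words.

(** * The block as an algebra of words *)

Section CutProjection.
Variables (F : fieldType) (A : pzAlgType F) (c : central_idempotent A).

Fact cut_proj_subproof (a : A) : a * cidem c * cidem c = a * cidem c.
Proof. by rewrite -mulrA cidem_idem. Qed.

(** A ring morphism onto the block, so the relations and the generators of the whole algebra pass to
    the block. *)
Definition cut_proj (a : A) : cut c := mkcut (cut_proj_subproof a).

Fact cut_proj_zmod : zmod_morphism cut_proj.
Proof. by move=> a b; apply: val_inj; rewrite /= mulrBl. Qed.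

Fact cut_proj_monoid : monoid_morphism cut_proj.
Proof.
split=> [|a b]; apply: val_inj; rewrite /= ?mul1r //.
by rewrite -!mulrA; congr (_ * _); rewrite mulrA -cidem_central -mulrA cidem_idem.
Qed.

HB.instance Definition _ := GRing.isZmodMorphism.Build A (cut c) cut_proj cut_proj_zmod.
HB.instance Definition _ := GRing.isMonoidMorphism.Build A (cut c) cut_proj cut_proj_monoid.

Lemma cut_proj_scal (k : F) : cut_proj (scal k) = scal k.
Proof. exact: val_inj. Qed.

Lemma cut_proj_val (a : cut c) : cut_proj (val a) = a.
Proof. by apply: val_inj; rewrite /= cutP. Qed.

End CutProjection.

(** * Evaluating the parameter polynomials *)

Section Bivariate.
Variables (F : fieldType) (A : pzAlgType F) (q : {poly {poly F}}).

Lemma sum_widen (V : nmodType) (g : nat -> V) (m n : nat) : (m <= n)%N ->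
  (forall i, (m <= i)%N -> g i = 0) -> \sum_(i < m) g i = \sum_(i < n) g i.
Proof.
move=> mn g0; rewrite -!(big_mkord xpredT g) [RHS](big_cat_nat (n := m)) //=.
by rewrite [X in _ + X]big_nat_cond [X in _ + X]big1 ?addr0 // => i /andP[/andP[/g0]].
Qed.

Hypothesis q_small : forall m n, q`_m`_n != 0 -> (m < 3)%N && (n < 3)%N.

Let size_q : (size q <= 3)%N.
Proof.
apply/leq_sizeP => m m3; apply/polyP => n; rewrite coef0; apply/eqP.
by apply: contraT => /q_small; rewrite ltnNge m3.
Qed.

Let size_q_coef (m : nat) : (size (q`_m)%R <= 3)%N.
Proof.
apply/leq_sizeP => n n3; apply/eqP.
by apply: contraT => /q_small; rewrite andbC ltnNge n3.
Qed.

Lemma bieval_small (a b : A) :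
  bieval q a b = \sum_(m < 3) \sum_(n < 3) scal q`_m`_n * (a ^+ m * b ^+ n).
Proof.
pose g (m n : nat) := scal q`_m`_n * (a ^+ m * b ^+ n).
rewrite /bieval (sum_widen (g := fun m : nat => \sum_(n < size q`_m) g m n) size_q).
  apply: eq_bigr => m _.
  apply: (sum_widen (g := g m) (size_q_coef m)) => n hn.
  by rewrite /g nth_default // rmorph0 mul0r.
by move=> m hm; rewrite /g nth_default // big1 // => n _; rewrite coef0 rmorph0 mul0r.
Qed.

Lemma bidivdiff_small (a b c : A) :
  bidivdiff q a b c = \sum_(m < 3) \sum_(n < 3)
    scal q`_m`_n * ((\sum_(s < m) a ^+ (m.-1 - s) * c ^+ s) * b ^+ n).
Proof.
pose g (m n : nat) := scal q`_m`_n * ((\sum_(s < m) a ^+ (m.-1 - s) * c ^+ s) * b ^+ n).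
rewrite /bidivdiff (sum_widen (g := fun m : nat => \sum_(n < size q`_m) g m n) size_q).
  apply: eq_bigr => m _.
  apply: (sum_widen (g := g m) (size_q_coef m)) => n hn.
  by rewrite /g nth_default // rmorph0 mul0r.
by move=> m hm; rewrite /g nth_default // big1 // => n _; rewrite coef0 rmorph0 mul0r.
Qed.

End Bivariate.

Section TwoTerms.
Variables (F : fieldType) (A : pzAlgType F) (q : {poly {poly F}}) (i j : nat).

Hypothesis q_supp : forall m n, q`_m`_n != 0 ->
  ((m == i) && (n == 0%N)) || ((m == 0%N) && (n == j)).
Hypotheses (i0 : (0 < i < 3)%N) (j0 : (0 < j < 3)%N).

Let q_small (m n : nat) : q`_m`_n != 0 -> (m < 3)%N && (n < 3)%N.
Proof. by move=> /q_supp; lia. Qed.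

Let q0 (m n : nat) : ~~ (((m == i) && (n == 0%N)) || ((m == 0%N) && (n == j))) -> q`_m`_n = 0.
Proof. by move=> h; apply/eqP; apply: contraNT h => /q_supp. Qed.

Let sum_two (h : nat -> nat -> A) :
  \sum_(m < 3) \sum_(n < 3) scal q`_m`_n * h m n = scal q`_i`_0 * h i 0%N + scal q`_0`_j * h 0%N j.
Proof.
rewrite !big_ord_recl !big_ord0 /= /bump /= !addn0 !addn1 !addr0.
rewrite (q0 (m := 0) (n := 0)) ?(q0 (m := 1) (n := 1)) ?(q0 (m := 1) (n := 2));
  rewrite ?(q0 (m := 2) (n := 1)) ?(q0 (m := 2) (n := 2)); try lia.
rewrite !rmorph0 !mul0r !addr0 add0r.
have [[ei z]|[ei z]] : i = 1%N /\ q`_2`_0 = 0 \/ i = 2%N /\ q`_1`_0 = 0.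
- by move: i0 q0; case: (i) => [|[|[|//]]] // _ q0'; [left | right]; rewrite q0'.
- have [[ej z']|[ej z']] : j = 1%N /\ q`_0`_2 = 0 \/ j = 2%N /\ q`_0`_1 = 0.
  + by move: j0 q0; case: (j) => [|[|[|//]]] // _ q0'; [left | right]; rewrite q0' //; lia.
  + by rewrite z z' ei ej !rmorph0 !mul0r !addr0 addrC.
  + by rewrite z z' ei ej !rmorph0 !mul0r !addr0 add0r addrC.
- have [[ej z']|[ej z']] : j = 1%N /\ q`_0`_2 = 0 \/ j = 2%N /\ q`_0`_1 = 0.
  + by move: j0 q0; case: (j) => [|[|[|//]]] // _ q0'; [left | right]; rewrite q0' //; lia.
  + by rewrite z z' ei ej !rmorph0 !mul0r !addr0 add0r addrC.
  + by rewrite z z' ei ej !rmorph0 !mul0r !add0r addrC.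
Qed.

Lemma bieval_two (a b : A) : bieval q a b = scal q`_i`_0 * a ^+ i + scal q`_0`_j * b ^+ j.
Proof.
rewrite (bieval_small q_small) (sum_two (fun m n => a ^+ m * b ^+ n)).
by rewrite !expr0 mulr1 mul1r.
Qed.

Lemma bidivdiff_two (a b c : A) :
  bidivdiff q a b c = scal q`_i`_0 * (if (i == 2)%N then a + c else 1).
Proof.
rewrite (bidivdiff_small q_small).
rewrite (sum_two (fun m n => (\sum_(s < m) a ^+ (m.-1 - s) * c ^+ s) * b ^+ n)).
rewrite big_ord0 mul0r mulr0 addr0 expr0 mulr1; congr (_ * _).
move: i0; case: (i) => [|[|[|//]]] // _; rewrite !big_ord_recl big_ord0 /= /bump.
  by rewrite !expr0 mulr1 addr0.
by rewrite !expr0 !addn0 !expr1 mulr1 mul1r addr0.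
Qed.
End TwoTerms.

(** * The Cartan data near one end of the Dynkin diagram *)

Section CartanEnd.
Variables (l K : nat) (flip : bool).

(* The node at distance [j] from the end of the Dynkin diagram selected by [flip]. *)
Definition node (j : nat) : 'I_l.+1 := if flip then rev_ord (inord j) else inord j.

Lemma nodeE j : (j <= l)%N -> node j = (if flip then (l - j)%N else j) :> nat.
Proof. by move=> jl; rewrite /node; case: ifP => _ /=; rewrite inordK // subSS. Qed.

Lemma node_inj i j : (i <= l)%N -> (j <= l)%N -> node i = node j -> i = j.
Proof.
move=> il jl /(congr1 (@nat_of_ord _)); rewrite !nodeE //.
by case: flip; lia.
Qed.

(** The letters up to [K.+1] then avoid the opposite end, so the only double bond among them joins 0
    and 1. *)
Hypothesis Kl : (K.+2 <= l)%N.
Variable i : nat.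
Hypothesis iK : (i <= K.+1)%N.

Lemma symmetrizer_node : symmetrizer l (node i) = if i == 0%N then 2 else 1.
Proof.
have il : (i <= l)%N by lia.
by rewrite /symmetrizer nodeE //; case: flip; do !case: ifP; lia.
Qed.

Lemma root_form_diag : root_form l (node i) (node i) = if i == 0%N then 4 else 2.
Proof. by rewrite /root_form symmetrizer_node /cartan eqxx; case: ifP. Qed.

Variable j : nat.
Hypothesis jK : (j <= K.+1)%N.

Lemma cartan_node : i != j -> cartan l (node i) (node j) =
  if near i j then (if (i == 1%N) && (j == 0%N) then -2 else -1) else 0.
Proof.
move=> ij; have [il jl] : (i <= l)%N /\ (j <= l)%N by split; lia.
rewrite /cartan !nodeE //; case: flip.
  have -> : (l - i == l - j)%N = false by lia.
  have -> : (l - i == 0)%N = false by lia.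
  have -> : (l - j == 0)%N = false by lia.
  have -> : (l - i == l)%N = (i == 0%N) by lia.
  have -> : (l - j == l)%N = (j == 0%N) by lia.
  have -> : (l - i == l.-1)%N = (i == 1%N) by lia.
  have -> : (l - j == l.-1)%N = (j == 1%N) by lia.
  have -> : (l - i == (l - j).+1)%N = (j == i.+1) by lia.
  have -> : (l - j == (l - i).+1)%N = (i == j.+1) by lia.
  rewrite andbF /= /near.
  by case: (i) (j) => [|[|i']] [|[|j']] //=; rewrite ?andbF ?orbF.
have -> : (i == l) = false by lia.
have -> : (j == l) = false by lia.
rewrite (negPf ij) andbF /= /near orbC.
by case: (i) (j) => [|[|i']] [|[|j']] //=; rewrite ?andbF ?orbF.
Qed.

Lemma root_form_off : i != j -> root_form l (node i) (node j) =
  if near i j then (if (i == 0%N) || (j == 0%N) then -2 else -1) else 0.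
Proof.
move=> ij; rewrite /root_form symmetrizer_node cartan_node //.
by move: ij; rewrite /near; do !case: ifP => //; lia.
Qed.

End CartanEnd.

Lemma bieval_constant (F : fieldType) (A : pzAlgType F) (q : {poly {poly F}}) (a b : A) :
  (forall m n : nat, q`_m`_n != 0 -> (m == 0%N) && (n == 0%N)) -> bieval q a b = scal q`_0`_0.
Proof.
move=> q_supp; rewrite (bieval_small (q := q)); last by move=> m n /q_supp; lia.
have q0 (m n : nat) : ~~ ((m == 0%N) && (n == 0%N)) -> q`_m`_n = 0.
  by move=> h; apply/eqP; apply: contraNT h => /q_supp.
rewrite (bigD1 ord0) //= [X in _ + X]big1 => [|m m0]; last first.
  rewrite big1 // => n _; rewrite q0 ?rmorph0 ?mul0r //.
  by apply: contraNN m0 => /andP[/eqP m0 _]; apply/eqP/ord_inj.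
rewrite addr0 (bigD1 ord0) //= [X in _ + X]big1 => [|n n0]; last first.
  by rewrite q0 ?rmorph0 ?mul0r //.
by rewrite !expr0 !mulr1 addr0.
Qed.

Section ParamSums.
Variables (F : fieldType) (l K : nat) (flip : bool) (Q : 'I_l.+1 -> 'I_l.+1 -> {poly {poly F}}).
Hypotheses (hQ : klr_parameters Q) (Kl : (K.+2 <= l)%N).
Local Notation node := (node l flip).
Local Notation expo i j := (if (i == 1)%N && (j == 0)%N then 2%N else 1%N).
Variables i j : nat.
Hypotheses (iK : (i <= K.+1)%N) (jK : (j <= K.+1)%N).

Lemma node_neq : i != j -> node i != node j.
Proof. by apply: contraNneq => /node_inj ->; lia. Qed.

Lemma Q_far : far i j -> (Q (node i) (node j))`_0`_0 != 0 /\
  forall m n : nat, (Q (node i) (node j))`_m`_n != 0 -> (m == 0%N) && (n == 0%N).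
Proof.
move=> fij; have ij : i != j by move: fij; rewrite /far; lia.
have nij : near i j = false by move: fij; rewrite /far /near; lia.
split.
  apply: (klr_param_lead hQ); first exact: node_neq.
  by rewrite (cartan_node flip Kl iK jK ij) nij.
move=> m n /(klr_param_supp hQ (node_neq ij)).
rewrite (root_form_off flip Kl iK jK ij) nij.
rewrite (root_form_diag flip Kl iK) (root_form_diag flip Kl jK).
by do !case: ifP; lia.
Qed.

Lemma Q_near : near i j ->
  [/\ (Q (node i) (node j))`_(expo i j)`_0 != 0, (Q (node i) (node j))`_0`_(expo j i) != 0
  & forall m n : nat, (Q (node i) (node j))`_m`_n != 0 ->
    ((m == expo i j) && (n == 0%N)) || ((m == 0%N) && (n == expo j i))].
Proof.
move=> nij; have ij : i != j by move: nij; rewrite /near; lia.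
have nji : near j i by rewrite near_sym.
have ji : j != i by rewrite eq_sym.
split.
- apply: (klr_param_lead hQ); first exact: node_neq.
  by rewrite (cartan_node flip Kl iK jK ij) nij; case: ifP.
- rewrite (klr_param_sym hQ (node_neq ij)) coef_swapXY.
  apply: (klr_param_lead hQ); first by rewrite eq_sym node_neq.
  by rewrite (cartan_node flip Kl jK iK ji) nji; case: ifP.
move=> m n /(klr_param_supp hQ (node_neq ij)).
rewrite (root_form_off flip Kl iK jK ij) nij.
rewrite (root_form_diag flip Kl iK) (root_form_diag flip Kl jK).
by move: nij; rewrite /near; do !case: ifP => //=; lia.
Qed.

End ParamSums.

Lemma klr_relations_image (F : fieldType) (l n : nat) (Q : 'I_l.+1 -> 'I_l.+1 -> {poly {poly F}})
    (L : 'I_l.+1 -> nat) (A B : pzAlgType F) (f : {rmorphism A -> B})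
    (e : n.-tuple 'I_l.+1 -> A) (x : 'I_n -> A) (psi : 'I_n.-1 -> A) :
  (forall c, f (scal c) = scal c) -> klr_relations Q L e x psi ->
  klr_relations Q L (f \o e) (f \o x) (f \o psi).
Proof.
move=> fc H; split => /=.
- by move=> nu mu; rewrite -rmorphM (klr_ee H); case: eqP => _ //; rewrite rmorph0.
- by rewrite -rmorph_sum (klr_sum_e H) rmorph1.
- by move=> r nu; rewrite -!rmorphM (klr_xe H).
- by move=> r nu; rewrite -!rmorphM (klr_psie H).
- by move=> r s; rewrite -!rmorphM (klr_xx H).
- by move=> r s h1 h2; rewrite -!rmorphM (klr_psix H).
- by move=> r s h; rewrite -!rmorphM (klr_psipsi H).
- by move=> r nu; rewrite -!rmorphM (klr_xpsi H) !(rmorphM, rmorphB, rmorph_nat).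
- by move=> r nu; rewrite -!rmorphM (klr_xpsiS H) !(rmorphM, rmorphD, rmorph_nat).
- by move=> r nu; rewrite -rmorphXn -rmorphM (klr_psi2 H) rmorphM bieval_rmorph.
- move=> r s nu rs; rewrite -!rmorphM -rmorphB -rmorphM (klr_braid H) //.
  by case: ifP => _; rewrite ?rmorph0 // rmorphM bidivdiff_rmorph.
- by move=> r nu r0; rewrite -rmorphXn -rmorphM (klr_cyclotomic H) // rmorph0.
Qed.

Section BlockWords.
Variables (F : fieldType) (l K n : nat) (flip : bool).
Variables (Q : 'I_l.+1 -> 'I_l.+1 -> {poly {poly F}}) (A : pzAlgType F).
Variables (e : n.-tuple 'I_l.+1 -> A) (x : 'I_n -> A) (psi : 'I_n.-1 -> A).
Local Notation node := (node l flip).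
Hypotheses (hQ : klr_parameters Q) (Kl : (K.+2 <= l)%N) (hn : n = K.*2.+2).
Hypothesis rels : klr_relations Q (fundamental_weight (node K)) e x psi.
Local Notation small := (all (fun i => (i <= K.+1)%N)).
Hypothesis supp : forall nu : n.-tuple 'I_l.+1,
  (exists w, [/\ map node w = nu, small w & sumn w = (K.+1 ^ 2)%N]) \/ e nu = 0.

Definition e_word (w : seq nat) : A := if small w then oapp e 0 (insub (map node w)) else 0.
Definition x_nat (r : nat) : A := oapp x 0 (insub r).
Definition psi_nat (r : nat) : A := oapp psi 0 (insub r).

Lemma e_word_tuple w (t : n.-tuple 'I_l.+1) : small w -> map node w = t -> e_word w = e t.
Proof.
move=> sw wt; rewrite /e_word sw; case: insubP => [t' _ et'|] /=.
  by congr e; apply: val_inj; rewrite /= et' wt.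
by rewrite wt size_tuple eqxx.
Qed.

Lemma e_wordP w : e_word w = 0 \/
  exists t : n.-tuple 'I_l.+1, [/\ small w, map node w = t & e_word w = e t].
Proof.
rewrite /e_word; case: ifP => sw; last by left.
by case: insubP => [t _ et|]; [right; exists t | left].
Qed.

Lemma map_node_inj w w' : small w -> small w' -> map node w = map node w' -> w = w'.
Proof.
elim: w w' => [|i w IH] [|j w'] //= /andP[iK sw] /andP[jK sw'] [ij ww'].
by rewrite (IH w') // (node_inj _ _ ij) //; lia.
Qed.

Lemma x_natE (r : 'I_n) : x_nat r = x r.
Proof. by rewrite /x_nat valK. Qed.

Lemma psi_natE (r : 'I_n.-1) : psi_nat r = psi r.
Proof. by rewrite /psi_nat valK. Qed.

Lemma x_natP r : x_nat r = 0 \/ exists2 s : 'I_n, r = s & x_nat r = x s.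
Proof. by rewrite /x_nat; case: insubP => [s _ <-|] /=; [right; exists s | left]. Qed.

Lemma psi_natP r : psi_nat r = 0 \/ exists2 s : 'I_n.-1, r = s & psi_nat r = psi s.
Proof. by rewrite /psi_nat; case: insubP => [s _ <-|] /=; [right; exists s | left]. Qed.

Lemma e_word_size w : size w != n -> e_word w = 0.
Proof.
move=> sw; have [//|[t [_ wt _]]] := e_wordP w.
by move: sw; rewrite -(size_map node) wt size_tuple eqxx.
Qed.

(** One case split for all local relations: either both words are out of range and zero, or both are
    tuples related by [swap]. *)
Lemma two_places u i j v : (e_word (u ++ i :: j :: v) = 0 /\ e_word (u ++ j :: i :: v) = 0) \/
  exists (r : 'I_n.-1) (t : n.-tuple 'I_l.+1),
  [/\ [/\ (i <= K.+1)%N, (j <= K.+1)%N & size u = r],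
      map node (u ++ i :: j :: v) = t, tnth t (fst_place r) = node i,
      tnth t (snd_place r) = node j
    & e_word (u ++ i :: j :: v) = e t /\ e_word (u ++ j :: i :: v) = e (swap r t)].
Proof.
have [sm|sm] := boolP (small (u ++ i :: j :: v)); last first.
  left; rewrite /e_word (negPf sm) ifN //; apply: contraNN sm.
  by rewrite !all_cat /= => /and4P[-> -> -> ->].
have [sz|sz] := eqVneq (size (u ++ i :: j :: v)) n; last first.
  left; rewrite !e_word_size //; apply: contraNneq sz => <-.
  by rewrite !size_cat.
right; have ru : (size u < n.-1)%N by move: sz; rewrite size_cat /=; lia.
have szt : size (map node (u ++ i :: j :: v)) == n by rewrite size_map sz.
have szt' : size (map node (u ++ j :: i :: v)) == n.
  by rewrite size_map -sz !size_cat.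
have sm' : small (u ++ j :: i :: v).
  by move: sm; rewrite !all_cat /= => /and4P[-> -> -> ->].
exists (Ordinal ru), (Tuple szt).
have tf : tnth (Tuple szt) (fst_place (Ordinal ru)) = node i.
  by rewrite (tnth_nth (node i)) /= map_cat nth_cat size_map ltnn subnn.
have ts : tnth (Tuple szt) (snd_place (Ordinal ru)) = node j.
  by rewrite (tnth_nth (node i)) /= map_cat nth_cat size_map ltnNge leqnSn subSnn.
split=> //; first by move: sm; rewrite all_cat /= => /and4P[].
split; first exact: e_word_tuple.
rewrite (e_word_tuple (t := Tuple szt')) //; congr e; apply: eq_from_tnth => p.
rewrite tnth_mktuple; case: tpermP => [->|->|/eqP pf /eqP ps].
- by rewrite ts (tnth_nth (node i)) /= map_cat nth_cat size_map ltnn subnn.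
- by rewrite tf (tnth_nth (node i)) /= map_cat nth_cat size_map ltnNge leqnSn subSnn.
rewrite !(tnth_nth (node i)) /= !map_cat !nth_cat size_map.
case: ltnP => // up; have : (p - size u >= 2)%N.
  move: pf ps; rewrite -!(inj_eq (@ord_inj _)) /=; lia.
by case: (p - size u)%N => [|[|m]].
Qed.

Lemma three_places u i j k v : e_word (u ++ i :: j :: k :: v) = 0 \/
  exists (r s : 'I_n.-1) (t : n.-tuple 'I_l.+1),
  [/\ [/\ (i <= K.+1)%N, (j <= K.+1)%N & (k <= K.+1)%N],
      [/\ size u = r, s = r.+1 :> nat & e_word (u ++ i :: j :: k :: v) = e t],
      tnth t (fst_place r) = node i, tnth t (snd_place r) = node j
    & tnth t (snd_place s) = node k].
Proof.
have [[-> _]|[r [t [[iK jK ur] ut tf ts [et _]]]]] := two_places u i j (k :: v); first by left.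
have := two_places (rcons u i) j k v; rewrite !cat_rcons.
move=> [[-> _]|[s [t' [[_ kK us] ut' _ ts' _]]]]; first by left.
have tt' : t = t' by apply: val_inj; rewrite /= -ut ut'.
right; exists r, s, t; split=> //; last by rewrite tt'.
by split=> //; rewrite -us size_rcons ur.
Qed.

Lemma x_fst (r : 'I_n.-1) : x_nat r = x (fst_place r).
Proof. exact: (x_natE (fst_place r)). Qed.

Lemma x_snd (r : 'I_n.-1) : x_nat r.+1 = x (snd_place r).
Proof. exact: (x_natE (snd_place r)). Qed.

Lemma e_word_cons i v : e_word (i :: v) = 0 \/
  exists (r : 'I_n) (t : n.-tuple 'I_l.+1),
  [/\ r = 0%N :> nat, (i <= K.+1)%N, tnth t r = node i & e_word (i :: v) = e t].
Proof.
have [->|[t [sw wt ->]]] := e_wordP (i :: v); [by left | right].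
have n0 : (0 < n)%N by rewrite hn.
exists (Ordinal n0), t; split=> //; first by move: sw => /= /andP[].
by rewrite (tnth_nth (node i)) /= -wt.
Qed.

Lemma block_klr_words : klr_words K e_word x_nat psi_nat.
Proof.
split.
- move=> w w'; have [-> |[t [sw wt ->]]] := e_wordP w; first by rewrite mul0r if_same.
  have [h|[t' [sw' wt' ->]]] := e_wordP w'.
    rewrite h mulr0; case: eqP => // ww'; move: h; rewrite -ww'.
    by rewrite (e_word_tuple sw wt).
  rewrite (klr_ee rels); congr (if _ then _ else _).
  apply/eqP/eqP => [tt'|ww']; first by apply: map_node_inj; rewrite // wt wt' tt'.
  by apply: val_inj; rewrite /= -wt -wt' ww'.
- by move=> w sw; apply: e_word_size; rewrite hn.
- move=> w i iw Ki; rewrite /e_word ifN //; apply/negP => /allP /(_ i iw).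
  by rewrite leqNgt Ki.
- move=> w; have [-> //|[t [sw wt ->]]] := e_wordP w.
  have [[w' [wt' sw' <-]]|-> //] := supp t.
  by rewrite (@map_node_inj w w') ?eqxx // wt wt'.
- move=> z hz; rewrite -[z]mulr1 -(klr_sum_e rels) mulr_sumr big1 // => nu _.
  have [[w [wnu sw _]]|->] := supp nu; last by rewrite mulr0.
  by rewrite -(e_word_tuple sw wnu).
- move=> r w; have [-> |[s _ ->]] := x_natP r; first by rewrite mul0r mulr0.
  have [-> |[t [_ _ ->]]] := e_wordP w; first by rewrite mul0r mulr0.
  exact: (klr_xe rels).
- move=> u i j v; have [[-> ->]|[r [t [[_ _ ->] _ _ _ [-> ->]]]]] := two_places u i j v.
    by rewrite mul0r mulr0.
  by rewrite psi_natE (klr_psie rels).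
- move=> r s sr srS; have [-> |[r' er ->]] := psi_natP r; first by rewrite mul0r mulr0.
  have [-> |[s' es ->]] := x_natP s; first by rewrite mul0r mulr0.
  apply: (klr_psix rels); rewrite -(inj_eq (@ord_inj _)) /= -es -er //.
- move=> r s rs; have [-> |[r' er ->]] := psi_natP r; first by rewrite mul0r mulr0.
  have [-> |[s' es ->]] := psi_natP s; first by rewrite mul0r mulr0.
  by apply: (klr_psipsi rels); rewrite -es -er rs.
- move=> u i j v; have [[-> _]|[r [t [[iK jK ->] _ tf ts [-> _]]]]] := two_places u i j v.
    by rewrite !mulr0.
  rewrite psi_natE -[nat_of_ord r]/(nat_of_ord (fst_place r)) x_natE.
  rewrite -[(nat_of_ord _).+1]/(nat_of_ord (snd_place r)) x_natE (klr_xpsi rels) tf ts.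
  congr ((_ - (nat_of_bool _)%:R) * _); apply/eqP/eqP => [|-> //].
  by apply: node_inj; lia.
- move=> u i j v; have [[-> _]|[r [t [[iK jK ->] _ tf ts [-> _]]]]] := two_places u i j v.
    by rewrite !mulr0.
  rewrite psi_natE -[(nat_of_ord _).+1]/(nat_of_ord (snd_place r)) x_natE.
  rewrite -[nat_of_ord r]/(nat_of_ord (fst_place r)) x_natE (klr_xpsiS rels) tf ts.
  congr ((_ + (nat_of_bool _)%:R) * _); apply/eqP/eqP => [|-> //].
  by apply: node_inj; lia.
- move=> u i v; have [[-> _]|[r [t [[iK _ ->] _ tf ts [-> _]]]]] := two_places u i i v.
    by rewrite !mulr0.
  rewrite psi_natE -expr2 (klr_psi2 rels) tf ts (klr_param_diag hQ).
  by rewrite /bieval size_poly0 big_ord0 mul0r.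
- move=> i j fij; have [/andP[iK jK]|ijK] := boolP ((i <= K.+1) && (j <= K.+1))%N; last first.
    exists 1; rewrite ?oner_neq0 // => u v.
    have [[-> _]|[r [t [[iK jK _] _ _ _ _]]]] := two_places u i j v; first by rewrite !mulr0.
    by rewrite iK jK in ijK.
  have [q0 q_supp] := Q_far flip hQ Kl iK jK fij.
  exists ((Q (node i) (node j))`_0`_0) => // u v.
  have [[-> _]|[r [t [[_ _ ->] _ tf ts [-> _]]]]] := two_places u i j v.
    by rewrite !mulr0.
  by rewrite psi_natE -expr2 (klr_psi2 rels) tf ts bieval_constant.
- move=> i j nij; have [/andP[iK jK]|ijK] := boolP ((i <= K.+1) && (j <= K.+1))%N; last first.
    exists 1; rewrite ?oner_neq0 // => u v.
    have [[-> _]|[r [t [[iK jK _] _ _ _ _]]]] := two_places u i j v; first by rewrite !mulr0.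
    by rewrite iK jK in ijK.
  have [_ q0 q_supp] := Q_near flip hQ Kl iK jK nij.
  exists ((Q (node i) (node j))`_0`_(if (j == 1)%N && (i == 0)%N then 2%N else 1%N)) => // u v.
  have [[-> _]|[r [t [[_ _ ->] _ tf ts [-> _]]]]] := two_places u i j v.
    by rewrite !mulr0.
  rewrite psi_natE x_fst x_snd -expr2 => X0.
  rewrite (klr_psi2 rels) tf ts (bieval_two q_supp); try by case: ifP.
  rewrite mulrDl [X in X + _](_ : _ = 0) ?add0r; last first.
    by case: ifP => _; rewrite ?expr2 ?expr1 -!mulrA X0 !mulr0.
  by rewrite andbC.
- move=> u i j k v ik.
  have [->|[r [s [t [[iK jK kK] [-> rs ->] tf ts tk]]]]] := three_places u i j k v.
    by rewrite !mulr0.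
  rewrite -rs !psi_natE; apply/eqP; rewrite -subr_eq0 -mulrBl (klr_braid rels) //.
  rewrite tf tk ifN //; apply: contraNneq ik => /(node_inj (flip := flip)) ->; lia.
- move=> i j nij; have [/andP[iK jK]|ijK] := boolP ((i <= K.+1) && (j <= K.+1))%N; last first.
    exists 1; rewrite ?oner_neq0 // => u v.
    have [[-> _]|[r [t [[iK jK _] _ _ _ _]]]] := two_places u i j (i :: v); first by rewrite !mulr0.
    by rewrite iK jK in ijK.
  have [q0 _ q_supp] := Q_near flip hQ Kl iK jK nij.
  exists ((Q (node i) (node j))`_(if (i == 1)%N && (j == 0)%N then 2%N else 1%N)`_0) => // u v.
  have [->|[r [s [t [_ [-> rs ->] tf ts tk]]]]] := three_places u i j i v.
    by rewrite !mulr0.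
  rewrite -rs !psi_natE x_fst x_snd (klr_braid rels) // tf tk ts eqxx.
  rewrite (bidivdiff_two q_supp); try by case: ifP.
- move=> v; have [->|[r [t [r0 _ tr ->]]]] := e_word_cons K v; first by rewrite mulr0.
  have := klr_cyclotomic rels t r0.
  by rewrite /fundamental_weight tr eqxx expr1 -r0 x_natE.
- move=> i v iK; have [//|[r [t [r0 iK' tr ->]]]] := e_word_cons i v.
  have := klr_cyclotomic rels t r0; rewrite /fundamental_weight tr.
  have -> : (node i == node K) = false; last by rewrite mul1r.
  by apply: contraNF iK => /eqP /node_inj ->; lia.
Qed.

End BlockWords.

(** * The content of the block *)

Section Content.
Variables (l K : nat) (flip : bool) (beta : Qplus l).
Local Notation node := (node l flip).
Hypothesis Kl : (K.+2 <= l)%N.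

(** The coefficients of [null_root - xi k 2] or [null_root - xi k (-2)], read from the end of the
    diagram at distance [K] from [k]. *)
Definition block_content (j : nat) : nat :=
  if j == 0%N then 1 else if (j <= K)%N then 2 else if j == K.+1 then 1 else 0.

Hypothesis beta_node : forall j, (j <= l)%N -> beta (node j) = block_content j.

Definition end_distance (i : 'I_l.+1) : nat := if flip then (l - i)%N else i.

Lemma node_end_distance i : node (end_distance i) = i.
Proof.
have il := ltn_ord i; apply: ord_inj; rewrite nodeE /end_distance; last by case: flip; lia.
by case: flip; lia.
Qed.

Lemma end_distance_le i : (end_distance i <= l)%N.
Proof. by have il := ltn_ord i; rewrite /end_distance; case: flip; lia. Qed.

Lemma sum_block_content (g : nat -> nat) N : (K.+2 <= N)%N ->
  (\sum_(j < N) g j * block_content j = g 0 + 2 * \sum_(1 <= j < K.+1) g j + g K.+1)%N.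
Proof.
move=> KN; rewrite -(big_mkord xpredT (fun j => g j * block_content j)%N).
rewrite (big_cat_nat (n := K.+2)) //= [X in (_ + X)%N]big_nat_cond.
rewrite [X in (_ + X)%N]big1 ?addn0 => [|j]; last first.
  by rewrite andbT => /andP[Kj _]; rewrite /block_content !ifN ?muln0 //; lia.
have bK : block_content K.+1 = 1%N by rewrite /block_content ltnn eqxx.
rewrite big_nat_recr // big_ltn // bK [block_content 0]/= !muln1.
congr (_ + _ + _)%N; rewrite big_distrr /=.
rewrite !big_nat; apply: eq_bigr => j jK.
by rewrite mulnC /block_content; do !case: ifP; lia.
Qed.

Lemma height_block : height beta = K.*2.+2.
Proof.
pose h (j : 'I_l.+1) := node j.
have h_inj : injective h by move=> i j /node_inj ij; apply: ord_inj; apply: ij; rewrite -ltnS.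
rewrite /height (reindex_inj h_inj) /=.
rewrite (eq_bigr (fun j : 'I_l.+1 => (1 * block_content j)%N)); last first.
  by move=> j _; rewrite mul1n /h beta_node // -ltnS.
rewrite (sum_block_content (fun=> 1%N)) ?sum_nat_const_nat; last by lia.
by lia.
Qed.

Lemma count_content n (nu : n.-tuple 'I_l.+1) (i : 'I_l.+1) :
  in_I_beta beta nu -> count_mem i nu = beta i.
Proof.
move=> /eqP /(congr1 (fun v : 'rV[rat]_l.+1 => v 0 i)); rewrite root_ofE summxE => h.
apply/eqP; rewrite -(eqr_nat rat) -h; apply/eqP.
rewrite -sum1_count big_tuple natr_sum big_mkcond; apply: eq_bigr => r _ /=.
by rewrite alphaE [in RHS]eq_sym (inj_eq (@ord_inj _)); case: eqP.
Qed.

Lemma sumn_count (w : seq nat) N : all (fun j => (j < N)%N) w ->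
  sumn w = (\sum_(j < N) j * count_mem (nat_of_ord j) w)%N.
Proof.
elim: w => [|i w IH] /=; first by rewrite big1 // => j _; rewrite muln0.
move=> /andP[iN /IH ->].
rewrite [RHS](eq_bigr (fun j : 'I_N => ((i == j) * j + j * count_mem (nat_of_ord j) w)%N)).
  rewrite big_split; congr (_ + _)%N.
  rewrite (eq_bigr (fun j => if j == Ordinal iN then i else 0%N)) -?big_mkcond ?big_pred1_eq //.
  by move=> j _; rewrite -(inj_eq (@ord_inj _)) eq_sym /=; case: eqP => [->|_]; rewrite ?mul1n.
by move=> j _; rewrite mulnDr mulnC.
Qed.

Lemma content_word n (nu : n.-tuple 'I_l.+1) : in_I_beta beta nu ->
  exists w, [/\ map node w = nu, all (fun j => (j <= K.+1)%N) w & sumn w = (K.+1 ^ 2)%N].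
Proof.
move=> nub; exists (map end_distance nu).
have cnt j : (j <= l)%N -> count_mem j (map end_distance nu) = block_content j.
  move=> jl; rewrite count_map -beta_node // -(count_content _ nub).
  apply: eq_count => i /=; apply/eqP/eqP => [<-|->]; first by rewrite node_end_distance.
  by rewrite /end_distance nodeE //; case: flip; lia.
split.
- by rewrite -map_comp -[RHS]map_id; apply: eq_map => i /=; rewrite node_end_distance.
- apply/allP => j jw; have jl : (j <= l)%N.
    by move: jw => /mapP[i _ ->]; apply: end_distance_le.
  have : (0 < count_mem j (map end_distance nu))%N by rewrite -has_count has_pred1.
  by rewrite cnt // /block_content; do !case: ifP; lia.
rewrite (@sumn_count _ l.+1); last by apply/allP => j /mapP[i _ ->]; rewrite ltnS end_distance_le.
rewrite (eq_bigr (fun j : 'I_l.+1 => (j * block_content j)%N)); last first.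
  by move=> j _; rewrite cnt // -ltnS.
rewrite (sum_block_content id) //; last by lia.
have : (2 * \sum_(1 <= j < K.+1) j = K * K.+1)%N.
  elim: (K) => [|m IH]; first by rewrite big_nil.
  by rewrite big_nat_recr //= mulnDr IH; lia.
by rewrite expnS expn1; lia.
Qed.

End Content.

Theorem block_finite_type (F : fieldType) (l K : nat) (flip : bool)
    (Q : 'I_l.+1 -> 'I_l.+1 -> {poly {poly F}}) (beta : Qplus l) :
  klr_parameters Q -> (K.+2 <= l)%N ->
  (forall j, (j <= l)%N -> beta (node l flip j) = block_content K j) ->
  finite_representation_type (klr_block Q (fundamental_weight (node l flip K)) beta).
Proof.
move=> hQ Kl beta_node; set L := fundamental_weight _.
have hn := height_block Kl beta_node; set n := height beta in hn.
pose c := e_beta Q L n beta.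
have rels := klr_relations_image (cut_proj_scal c) (klr_presentation Q L n).
have supp (nu : n.-tuple 'I_l.+1) : (exists w, [/\ map (node l flip) w = nu,
    all (fun j => (j <= K.+1)%N) w & sumn w = (K.+1 ^ 2)%N]) \/
    cut_proj c (klr_e Q L nu) = 0.
  have [nub|nub] := boolP (in_I_beta beta nu); first by left; apply: content_word nub.
  right; apply: val_inj; rewrite /= /e_beta_elt mulr_sumr big1 // => mu mub.
  rewrite (klr_ee (klr_presentation Q L n)) ifN //.
  by apply: contraNneq nub => ->.
have kw := block_klr_words hQ Kl hn rels supp.
apply: (klr_words_finite_type kw) => S SE SX SP Sc SD SM z.
rewrite -[z]cut_proj_val; elim/gen_ind: (val z) => [[nu|r|r]|k|a b Sa Sb|a b Sa Sb].
- have [[w [wnu sw _]]|e0] := supp nu.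
    by have := SE w; rewrite (e_word_tuple _ sw wnu).
  by move: e0; rewrite /klr_e => ->; have := Sc 0; rewrite rmorph0.
- by have := SX r; rewrite x_natE; apply; rewrite -hn.
- by have := SP r; rewrite psi_natE; apply; rewrite -[K.*2.+1]/(K.*2.+2.-1) -hn.
- by rewrite cut_proj_scal.
- by rewrite rmorphD; apply: SD.
- by rewrite rmorphM; apply: SM.
Qed.

Lemma beta_content_up (l k : nat) (beta : Qplus l) : (k + 2 <= l)%N ->
  root_of beta = null_root l - xi l k 2 ->
  forall j, (j <= l)%N -> beta (node l false j) = block_content k j.
Proof.
move=> kl hbeta j0 j0l; set j := node l false j0.
have jE : (j : nat) = j0 by rewrite /j nodeE.
have := congr1 (fun v : 'rV[rat]_l.+1 => v 0 j) hbeta.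
rewrite -[2 : int]/(Posz 2) root_ofE /null_root /xi big_nat1 !mxE !sum_alphaE addn1 jE => e.
apply/eqP; rewrite -(eqr_nat rat) e; apply/eqP; rewrite /block_content.
case: (boolP (j0 == 0%N)) => h0; case: (leqP j0 k) => h1;
case: (boolP (j0 == k.+1)) => h2; case: (leqP 1 j0) => h3;
case: (boolP (j0 == l)) => h4; case: (ltnP j0 l) => h5;
case: (leqP (k + 2) j0) => h6 /=; try (exfalso; lia); lra.
Qed.

Lemma beta_content_down (l k : nat) (beta : Qplus l) : (2 <= k <= l)%N ->
  root_of beta = null_root l - xi l k (-2) ->
  forall j, (j <= l)%N -> beta (node l true j) = block_content (l - k) j.
Proof.
move=> kl hbeta j0 j0l; set j := node l true j0.
have jE : (j : nat) = (l - j0)%N by rewrite /j nodeE.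
have := congr1 (fun v : 'rV[rat]_l.+1 => v 0 j) hbeta.
rewrite -[- 2 : int]/(Negz 1) root_ofE /null_root /xi big_nat1 !mxE !sum_alphaE subn1 jE => e.
apply/eqP; rewrite -(eqr_nat rat) e; apply/eqP; rewrite /block_content.
case: (boolP (j0 == 0%N)) => h0; case: (leqP j0 (l - k)) => h1;
case: (boolP (j0 == (l - k).+1)) => h2; case: (boolP ((l - j0)%N == k.-1)) => h7;
case: (leqP 1 (l - j0)) => h3; case: (boolP ((l - j0)%N == 0%N)) => h8;
case: (boolP ((l - j0)%N == l)) => h4; case: (ltnP (l - j0) l) => h5;
case: (ltnP (l - j0) (k - 2).+1) => h6 /=; try (exfalso; lia); lra.
Qed.

Theorem proposition4p1 (F : closedFieldType) (l : nat) (hl : (2 <= l)%N)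
    (Q : 'I_l.+1 -> 'I_l.+1 -> {poly {poly F}}) (hQ : klr_parameters Q)
    (k : 'I_l.+1) (i : int) (hi : i \in [:: 2; -2])
    (hki : 0 <= k%:Z + i <= l%:Z)
    (beta : Qplus l) (hbeta : root_of beta = null_root l - xi l k i) :
  finite_representation_type (klr_block Q (fundamental_weight k) beta).
Proof.
have kl := ltn_ord k; move: hi; rewrite !inE => /orP[] /eqP ei; rewrite ei in hki hbeta.
  have kE : k = node l false k by apply: ord_inj; rewrite nodeE.
  rewrite {1}kE; apply: block_finite_type hQ _ _; first by lia.
  by apply: beta_content_up => //; lia.
(* For the negative sign the diagram is read from node [l], which is at distance [l - k] from
   [k]. *)
have kE : k = node l true (l - k) by apply: ord_inj; rewrite nodeE; lia.
rewrite {1}kE; apply: block_finite_type hQ _ _; first by lia.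
by apply: beta_content_down => //; lia.
Qed.
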